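(* Under the standing assumptions below, assume in addition that there exists $\alpha>0$ with $\mathbb E[\tau^\alpha]<+\infty$. Then $\zeta$ is a Markov process with respect to $\mathbb F^{\zeta,c}_+$: for all $0\le t<u$ and every bounded measurable (equivalently, bounded continuous) $g:\mathbb R\to\mathbb R$, $$\mathbb E[g(\zeta_u)\mid\mathcal F^{\zeta,c}_{t+}]=\mathbb E[g(\zeta_u)\mid\zeta_t]\quad\mathbb P\text{-a.s.}$$
   Context: $\gamma$ a standard gamma process (driftless subordinator, $\gamma_0=0$, càdlàg, $\mathbb E[e^{-\lambda\gamma_t}]=(1+\lambda)^{-t}$) on a complete probability space $(\Omega,\mathcal F,\mathbb P)$ with null sets $\mathcal N_P$; $\tau:\Omega\to(0,\infty)$ a random variable independent of $\gamma$; $\zeta_t=\gamma_{t\wedge\tau}/\gamma_\tau$, $t\ge0$; $\mathcal F^{\zeta,c}_t=\sigma(\zeta_s,s\le t)\vee\mathcal N_P$ and $\mathcal F^{\zeta,c}_{t+}=\bigcap_{s>t}\mathcal F^{\zeta,c}_s$. *)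

(* Defs.v *)
From HB Require Import structures.
From mathcomp Require Import all_boot all_order all_algebra.
From mathcomp Require Import all_classical all_reals all_analysis.
Set Implicit Arguments. Unset Strict Implicit. Unset Printing Implicit Defensive.
Import Order.TTheory GRing.Theory Num.Theory.
Import numFieldNormedType.Exports.
Local Open Scope classical_set_scope.
Local Open Scope ring_scope.

Section defs.
Context {d : measure_display} {T : measurableType d} {R : realType}.

Definition gen_sigma (I : Type) (J : set I) (X : I -> T -> R) : set (set T) :=
  <<s [set A | exists i, J i /\ exists B : set R, measurable B /\ A = X i @^-1` B] >>.

Definition null_sets (P : probability T R) : set (set T) := P.-negligible.

Definition join_sigma (G1 G2 : set (set T)) : set (set T) := <<s G1 `|` G2 >>.

Definition indep_sigma (P : probability T R) (G1 G2 : set (set T)) : Prop :=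
  forall A B, G1 A -> G2 B -> P (A `&` B) = (P A * P B)%E.

Definition is_cond_exp (P : probability T R) (G : set (set T)) (X Y : T -> R) : Prop :=
  (forall B : set R, measurable B -> G (Y @^-1` B)) /\
  P.-integrable setT (EFin \o Y) /\
  forall A, G A -> (\int[P]_(x in A) (Y x)%:E = \int[P]_(x in A) (X x)%:E)%E.

(* gamma is a standard gamma process (driftless subordinator, gamma_0 = 0,
   cadlag paths, independent stationary increments whose Laplace transform is
   E[exp(-lam (gamma_t - gamma_s))] = (1+lam)^(-(t-s))). *)
Definition standard_gamma_process (P : probability T R) (gamma : R -> T -> R) : Prop :=
  (forall t, 0 <= t -> measurable_fun setT (gamma t)) /\
  (forall w, gamma 0 w = 0) /\
  (forall w s t, 0 <= s <= t -> gamma s w <= gamma t w) /\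
  (forall w t, 0 <= t -> gamma s w @[s --> t^'+] --> gamma t w) /\
  (forall w t, 0 < t -> cvg (gamma s w @[s --> t^'-])) /\
  (forall s t, 0 <= s <= t ->
     indep_sigma P (gen_sigma [set r | 0 <= r <= s] gamma)
                   (gen_sigma [set tt] (fun _ x => gamma t x - gamma s x))) /\
  (forall s t lam, 0 <= s <= t -> 0 <= lam ->
     (\int[P]_x (expR (- (lam * (gamma t x - gamma s x))))%:E
      = ((1 + lam) `^ (- (t - s)))%:E)%E).

Definition zeta (gamma : R -> T -> R) (tau : T -> R) (t : R) (w : T) : R :=
  gamma (Order.min t (tau w)) w / gamma (tau w) w.

Definition Fzc (P : probability T R) (gamma : R -> T -> R) (tau : T -> R) (t : R)
  : set (set T) :=
  join_sigma (gen_sigma [set s | 0 <= s <= t] (zeta gamma tau)) (null_sets P).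

Definition Fzc_plus (P : probability T R) (gamma : R -> T -> R) (tau : T -> R) (t : R)
  : set (set T) :=
  [set A | forall s, t < s -> Fzc P gamma tau s A].

End defs.

(* Main.v *)
Require Import Defs.
From HB Require Import structures.
From mathcomp Require Import all_boot all_order all_algebra.
From mathcomp Require Import all_classical all_reals all_analysis.
From mathcomp Require Import measurable_realfun.
From mathcomp Require Import ring lra.
Import Order.TTheory GRing.Theory Num.Theory.
Import numFieldNormedType.Exports.
Local Open Scope classical_set_scope.
Local Open Scope ring_scope.
Set Implicit Arguments.
Unset Strict Implicit.

(* Write N_s = gamma_tau - gamma_s on {s < tau}.  There zeta_r / (1 - zeta_s) = gamma_r / N_s
   for r <= s, and the future of zeta is a function of the increments of gamma after s, of tau
   and of gamma_s / N_s.  By Lukacs' theorem the ratios gamma_r / gamma_s, r <= s, are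
   independent of gamma_s and of (tau, increments after s), so zeta is Markov for its own
   completed filtration.

   To pass to the right limit, let A be in F_(t+), s decreasing to t.  Conditioning 1_A at time
   s on (gamma_t / N_s, gamma_s / N_s) gives psi(gamma_t / N_s, gamma_s / N_s).  A gamma
   variable of parameter a, divided by a number C >= 1, moves by at most C^a - 1 in total
   variation; hence, at a vanishing cost, gamma_s - gamma_t can be integrated out and N_s
   replaced by N_t, so that 1_A is asymptotically indistinguishable from some
   p_s(gamma_t / N_t) when tested against products of rays in (gamma_t / N_t,
   (gamma_(u /\ tau) - gamma_t) / N_t).  These rays can be chosen so that their indicators are
   continuous along the one-sided limit s -> t.  A monotone class argument extends the test
   functions to g(zeta_u) - E[g(zeta_u) | zeta_t], against which p_s(gamma_t / N_t) integrates to 0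
   exactly.  On {tau <= t}, zeta_t = zeta_u = 1. *)

(** * Expectations of bounded measurable functions *)

Section expectation.
Context {d : measure_display} {T : measurableType d} {R : realType}.
Context (P : probability T R).

(** The obstacle is that the functions p_s have no evident limit as s decreases to t. None is ever
    taken: only differences of expectations are shown to tend to 0, using that the p_s take values
    in [0, 1]. In the end the p_s term is exactly 0 for each s, so a constant sequence tends to 0.
    This is why the monotone class lemmas below are stated for sequences of weights and limits 0,
    equalities being the constant case. The odds gamma_r / N_s replace zeta_r because their
    numerator and denominator are independent: with N_s frozen, moving s only changes the number by
    which a gamma variable is divided. In zeta_r the denominator gamma_tau mixes past and future. No
    density is used. A gamma variable X of parameter a enters through its Laplace transform (1 +
    lambda)^(-a) alone, and the identity 1 + theta + (1 + theta) mu = (1 + theta) (1 + mu) says that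
    tilting by exp(- theta X) divides X by 1 + theta in law. This one fact yields both Lukacs'
    theorem and the total variation bound. *)

Definition bmfun (f : T -> R) : Prop :=
  measurable_fun setT f /\ exists M, forall x, `|f x| <= M.

Notation ev f := (Rintegral P setT f).
Implicit Types (f g h : T -> R) (c M : R).

Lemma bmfun_cst c : bmfun (fun _ => c).
Proof. by split; [exact: measurable_cst | exists `|c|]. Qed.

Lemma bmfunD f g : bmfun f -> bmfun g -> bmfun (fun x => f x + g x).
Proof.
move=> [mf [M hM]] [mg [N hN]]; split; first exact: measurable_funD.
by exists (M + N) => x; rewrite (le_trans (ler_normD _ _))// lerD.
Qed.

Lemma bmfunN f : bmfun f -> bmfun (fun x => - f x).
Proof.
move=> [mf [M hM]]; split; first exact: measurable_funN.
by exists M => x; rewrite normrN.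
Qed.

Lemma bmfunB f g : bmfun f -> bmfun g -> bmfun (fun x => f x - g x).
Proof. by move=> bf bg; exact/bmfunD/bmfunN. Qed.

Lemma bmfunM f g : bmfun f -> bmfun g -> bmfun (fun x => f x * g x).
Proof.
move=> [mf [M hM]] [mg [N hN]]; split; first exact: measurable_funM.
by exists (M * N) => x; rewrite normrM ler_pM.
Qed.

Lemma bmfun_abs f : bmfun f -> bmfun (fun x => `|f x|).
Proof.
move=> [mf [M hM]]; split; last by exists M => x; rewrite normr_id.
exact: measurableT_comp.
Qed.

Lemma bmfun_indic (A : set T) : measurable A -> bmfun \1_A.
Proof.
move=> mA; split; first exact: measurable_indic.
by exists 1 => x; rewrite indicE; case: (x \in A); rewrite ?normr1 ?normr0.
Qed.

Lemma bmfun_indic_comp d' (U : measurableType d') (A : set U) (X : T -> U) :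
  measurable_fun setT X -> measurable A -> bmfun (fun x => \1_A (X x)).
Proof.
move=> mX mA; have mXA : measurable (X @^-1` A).
  by rewrite -[X in measurable X]setTI; exact: mX.
exact: (bmfun_indic mXA).
Qed.

Lemma bmfun_comp d' (U : measurableType d') (h : U -> R) (X : T -> U) :
  measurable_fun setT h -> (exists M, forall x, `|h x| <= M) ->
  measurable_fun setT X -> bmfun (fun x => h (X x)).
Proof.
move=> mh [M hM] mX; split; last by exists M.
exact: measurableT_comp.
Qed.

Lemma bmfun_integrable f : bmfun f -> P.-integrable setT (EFin \o f).
Proof.
move=> [mf [M hM]].
apply: (@le_integrable _ _ _ P _ measurableT _ (EFin \o cst M)).
- exact/measurable_EFinP.
- by move=> x _ /=; rewrite lee_fin (le_trans (hM x)) ?ler_norm.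
- exact: finite_measure_integrable_cst.
Qed.
Hint Resolve bmfun_integrable : core.

Lemma evD f g : bmfun f -> bmfun g ->
  ev (fun x => f x + g x) = ev f + ev g.
Proof. by move=> bf bg; rewrite RintegralD//; exact: bmfun_integrable. Qed.

Lemma evB f g : bmfun f -> bmfun g ->
  ev (fun x => f x - g x) = ev f - ev g.
Proof. by move=> bf bg; rewrite RintegralB//; exact: bmfun_integrable. Qed.

Lemma evZ f c : bmfun f -> ev (fun x => c * f x) = c * ev f.
Proof. by move=> bf; rewrite RintegralZl//; exact: bmfun_integrable. Qed.

Lemma evZr f c : bmfun f -> ev (fun x => f x * c) = ev f * c.
Proof. by move=> bf; rewrite RintegralZr//; exact: bmfun_integrable. Qed.

Lemma ev_cst c : ev (fun _ => c) = c.
Proof.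
rewrite Rintegral_cst// (_ : fine _ = 1) ?mulr1//.
by transitivity (fine (1%E : \bar R)) => //; congr fine; exact: (@probability_setT _ _ _ P).
Qed.

Lemma le_ev f g : bmfun f -> bmfun g -> (forall x, f x <= g x) -> ev f <= ev g.
Proof.
by move=> bf bg fg; apply: le_Rintegral => //; exact: bmfun_integrable.
Qed.

Lemma le_norm_ev f : bmfun f -> `|ev f| <= ev (fun x => `|f x|).
Proof. by move=> bf; apply: le_normr_Rintegral => //; exact: bmfun_integrable. Qed.

Lemma norm_ev_le f M : measurable_fun setT f -> (forall x, `|f x| <= M) ->
  `|ev f| <= M.
Proof.
move=> mf hM; have bf : bmfun f by split=> //; exists M.
rewrite (le_trans (le_norm_ev bf))// -[leRHS]ev_cst.
by apply: le_ev => //; [exact: bmfun_abs | exact: bmfun_cst].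
Qed.

Lemma eq_ev f g : (forall x, f x = g x) -> ev f = ev g.
Proof. by move=> fg; apply: eq_Rintegral => x _; exact: fg. Qed.

Lemma ev_indic (A : set T) : measurable A -> ev \1_A = fine (P A).
Proof.
by move=> mA; rewrite /Rintegral integral_indic// setIT.
Qed.

Lemma ae_eq_ev f g : measurable_fun setT f -> measurable_fun setT g ->
  {ae P, forall x, f x = g x} -> ev f = ev g.
Proof.
move=> mf mg fg; congr fine; apply: ae_eq_integral => //.
- exact/measurable_EFinP.
- exact/measurable_EFinP.
- by apply: filterS fg => x -> _.
Qed.

Lemma ev_cvg (f_ : nat -> T -> R) (f : T -> R) M :
  (forall n, measurable_fun setT (f_ n)) -> measurable_fun setT f ->
  (forall n x, `|f_ n x| <= M) ->
  {ae P, forall x, f_ ^~ x @ \oo --> f x} ->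
  (fun n => ev (f_ n)) @ \oo --> ev f.
Proof.
move=> mf_ mf hM cf.
have [] := @dominated_convergence _ _ _ P _ measurableT
  (fun n => EFin \o f_ n) (EFin \o f) (EFin \o cst M).
- by move=> n; exact/measurable_EFinP.
- exact/measurable_EFinP.
- by apply: filterS cf => x cfx _ /=; apply/fine_cvgP; split; [exact: nearW | exact: cfx].
- exact: finite_measure_integrable_cst.
- by apply: aeW => x n _ /=; rewrite lee_fin.
move=> fint _ cE; rewrite /Rintegral; apply: fine_cvg; rewrite fineK//.
exact: integrable_fin_num.
Qed.

End expectation.

(** * A Dynkin class argument for limits *)

Section monotone_class.
Context {d : measure_display} {T : measurableType d} {R : realType}.
Context (P : probability T R).
Notation ev f := (Rintegral P setT f).
Implicit Types (f g h : T -> R) (c M : R).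

Lemma indicU_disj (U : Type) (A B : set U) x : A `&` B = set0 ->
  \1_(A `|` B) x = \1_A x + \1_B x :> R.
Proof.
move=> AB; rewrite !indicE in_setU.
case: (boolP (x \in A)) => xA; case: (boolP (x \in B)) => xB //=; rewrite ?(addr0, add0r)//.
by have : (A `&` B) x by [split; exact: set_mem]; rewrite AB.
Qed.

(** The weights vary with [n] but the laws of [X] and [X'] do not: the functional at stage [n] is
    bounded by [M] times these laws, so the tails of a disjoint countable union are small uniformly
    in [n] and the limit passes through the union. *)
Lemma dynkin_cvg (U : Type) (Pi : set (set U)) (X X' : T -> U)
    (a b : nat -> T -> R) (M : R) :
  setI_closed Pi ->
  (forall n, measurable_fun setT (a n)) -> (forall n, measurable_fun setT (b n)) ->
  (forall n x, `|a n x| <= M) -> (forall n x, `|b n x| <= M) ->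
  (forall S, Pi S -> measurable (X @^-1` S) /\ measurable (X' @^-1` S)) ->
  (forall S, Pi S \/ S = setT -> (fun n => ev (fun x => a n x * \1_S (X x)) -
     ev (fun x => b n x * \1_S (X' x))) @ \oo --> (0 : R)) ->
  forall S, <<s Pi >> S ->
  [/\ measurable (X @^-1` S), measurable (X' @^-1` S) &
   (fun n => ev (fun x => a n x * \1_S (X x)) -
     ev (fun x => b n x * \1_S (X' x))) @ \oo --> (0 : R)].
Proof.
move=> PiI ma mb aM bM mPi cPi S.
rewrite -setI_closed_g_dynkin_g_sigma_algebra//.
pose L n S := ev (fun x => a n x * \1_S (X x)) - ev (fun x => b n x * \1_S (X' x)).
pose D := [set S | [/\ measurable (X @^-1` S), measurable (X' @^-1` S) &
   L ^~ S @ \oo --> (0 : R)]].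
suff : <<d Pi >> `<=` D by move=> /[apply].
have ba n : bmfun (a n) by split => //; exists M.
have bb n : bmfun (b n) by split => //; exists M.
have mD (Y : T -> U) A B : measurable (Y @^-1` A) -> measurable (Y @^-1` B) ->
    measurable (Y @^-1` (A `\` B)).
  by move=> mA mB; exact: (measurableD mA mB).
have bX (Y : T -> U) B (c : T -> R) : bmfun c -> measurable (Y @^-1` B) ->
    bmfun (fun x => c x * (\1_B (Y x) : R)).
  by move=> bc mB; apply: bmfunM => //; exact: (bmfun_indic mB).
have LU n A B : A `&` B = set0 -> measurable (X @^-1` A) -> measurable (X @^-1` B) ->
    measurable (X' @^-1` A) -> measurable (X' @^-1` B) ->
    L n (A `|` B) = L n A + L n B.
  move=> AB m1 m2 m3 m4; rewrite /L.
  under eq_ev do rewrite (indicU_disj _ AB) mulrDr.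
  rewrite evD; [|exact: bX..].
  under [X in _ - X]eq_ev do rewrite (indicU_disj _ AB) mulrDr.
  rewrite evD; [|exact: bX..].
  by ring.
apply: smallest_sub; last first.
  move=> A PiA; have [m1 m2] := mPi _ PiA; split => //.
  by apply: cPi; left.
split => //.
- by split; [exact: measurableT | exact: measurableT | apply: cPi; right].
- move=> A [m1 m2 cA]; split; [exact: measurableC | exact: measurableC |].
  have cT : L ^~ setT @ \oo --> (0 : R) by apply: cPi; right.
  have -> : L ^~ (~` A) = (fun n => L n setT - L n A).
    apply/funext => n; rewrite -(setUv A) LU ?setICr//.
    + by ring.
    + exact: measurableC.
    + exact: measurableC.
  by rewrite -[X in _ --> X](subr0 0); apply: cvgB.
- move=> F tF DF.
  have mX k : measurable (X @^-1` F k) by have [] := DF k.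
  have mX' k : measurable (X' @^-1` F k) by have [] := DF k.
  set S0 := \bigcup_k F k.
  have mS : measurable (X @^-1` S0).
    by rewrite preimage_bigcup; exact: bigcupT_measurable.
  have mS' : measurable (X' @^-1` S0).
    by rewrite preimage_bigcup; exact: bigcupT_measurable.
  split => //.
  (* Finite partial unions: on each the limit is 0 by additivity, and the remainder of [S0] is
     controlled uniformly in [n]. *)
  pose V m := \big[setU/set0]_(k < m) F k.
  have mV m : measurable (X @^-1` V m) /\ measurable (X' @^-1` V m).
    rewrite /V; elim: m => [|m [IH1 IH2]].
      by rewrite big_ord0 !preimage_set0; split; exact: measurable0.
    by rewrite big_ord_recr/= !preimage_setU; split; exact: measurableU.
  have VF m : V m `&` F m = set0.
    apply/seteqP; split => // y []; rewrite /V -bigcup_mkord => -[k /= km Fk] Fm.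
    by have E := tF k m I I (ex_intro _ y (conj Fk Fm)); rewrite E ltnn in km.
  have cV m : L ^~ (V m) @ \oo --> (0 : R).
    elim: m => [|m IH].
      rewrite /V big_ord0.
      have -> : L ^~ set0 = (fun=> 0); last exact: cvg_cst.
      apply/funext => n; rewrite /L.
      under eq_ev do rewrite indic0 mulr0.
      under [X in _ - X]eq_ev do rewrite indic0 mulr0.
      by rewrite !ev_cst subr0.
    have -> : L ^~ (V m.+1) = (fun n => L n (V m) + L n (F m)).
      apply/funext => n; have [mV1 mV2] := mV m.
      by rewrite -LU// /V big_ord_recr.
    by rewrite -[X in _ --> X](addr0 0); apply: cvgD => //; have [] := DF m.
  have tail (Y : T -> U) : measurable (Y @^-1` S0) ->
      (forall m, measurable (Y @^-1` V m)) ->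
      (fun m => ev (fun x => \1_(S0 `\` V m) (Y x))) @ \oo --> (0 : R).
    move=> mYS mYV; rewrite -[X in _ --> X](ev_cst P).
    apply: (@ev_cvg _ _ _ P _ _ 1).
    + move=> m; have : measurable (Y @^-1` (S0 `\` V m)).
        exact: mD.
      by move=> mm; exact: (proj1 (bmfun_indic mm)).
    + exact: measurable_cst.
    + by move=> m x; rewrite indicE; case: (_ \in _); rewrite ?normr1 ?normr0.
    + apply: aeW => x; have [[k _ Fk]|nS] := pselect (S0 (Y x)).
        apply: (@cvg_near_cst _ R); exists k.+1 => // m /= km.
        rewrite indicE memNset// => -[_]; apply.
        by rewrite /V -bigcup_mkord; exists k.
      apply: (@cvg_near_cst _ R); exists 0%N => // m _.
      by rewrite indicE memNset// => -[].
  have M0 : 0 <= M by rewrite (le_trans _ (aM 0%N point)).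
  have Lle n A : measurable (X @^-1` A) -> measurable (X' @^-1` A) ->
     `|L n A| <= M * ev (fun x => \1_A (X x)) + M * ev (fun x => \1_A (X' x)).
    move=> m1 m2; rewrite (le_trans (ler_normB _ _))//.
    have one (Y : T -> U) (c : T -> R) : bmfun c -> (forall x, `|c x| <= M) ->
        measurable (Y @^-1` A) ->
       `|ev (fun x => c x * \1_A (Y x))| <= M * ev (fun x => \1_A (Y x)).
      move=> bc cM mY; rewrite (le_trans (le_norm_ev P _))//; first exact: bX.
      rewrite -evZ; last exact: (bmfun_indic mY).
      apply: le_ev; first by apply: bmfun_abs; exact: bX.
        by apply: bmfunM; [exact: bmfun_cst | exact: (bmfun_indic mY)].
      by move=> x; rewrite normrM [X in _ * X]ger0_norm// ler_wpM2r.
    by apply: lerD; exact: one.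
  have tailL : (fun m => M * ev (fun x => \1_(S0 `\` V m) (X x)) +
                M * ev (fun x => \1_(S0 `\` V m) (X' x))) @ \oo --> (0 : R).
    rewrite [X in _ --> X](_ : 0 = M * 0 + M * 0); last by rewrite mulr0 addr0.
    apply: cvgD; apply: cvgM; try exact: cvg_cst.
    + by apply: tail => // m; have [] := mV m.
    + by apply: tail => // m; have [] := mV m.
  apply/cvgrPdist_lt => e e0.
  have e20 : 0 < e / 2 by rewrite divr_gt0.
  (* The tail bound fixes [m] before [n] goes to infinity. *)
  move/cvgrPdist_lt : tailL => /(_ _ e20) [m _ /(_ m (leqnn m))/=].
  rewrite sub0r normrN => hm.
  move/cvgrPdist_lt : (cV m) => /(_ _ e20); apply: filterS => n.
  rewrite !sub0r !normrN => hn.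
  have [mV1 mV2] := mV m.
  have VS : V m `<=` S0 by rewrite /V -bigcup_mkord => x [k _ Fk]; exists k.
  have -> : L n S0 = L n (V m) + L n (S0 `\` V m).
    rewrite -LU//; first by rewrite setDUK.
    + by rewrite setDE setICA setICr setI0.
    + exact: mD.
    + exact: mD.
  rewrite (le_lt_trans (ler_normD _ _))// [e]splitr ltrD//.
  rewrite (le_lt_trans (Lle _ _ _ _))//.
  + exact: mD.
  + exact: mD.
  + exact: le_lt_trans (ler_norm _) hm.
Qed.

End monotone_class.

(** * From a pi-system to bounded functions *)

Section sigma_extension.
Context {d : measure_display} {T : measurableType d} {R : realType}.
Context (P : probability T R).
Notation ev f := (Rintegral P setT f).

(** The sum counts the integers from 1 to [k] that do not exceed [y], hence is the integer part of
    [y]. *)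
Lemma floor_sum_dist (k : nat) (y : R) : 0 <= y <= k%:R ->
  `|y - \sum_(j < k) \1_[set z : R | j.+1%:R <= z] y| <= 1.
Proof.
elim: k => [|k IH] /andP[y0 yk].
  by rewrite big_ord0 subr0 ger0_norm//; lra.
rewrite big_ord_recr/=; have [yk1|ky] := leP y k%:R.
  have -> : \1_[set z : R | k.+1%:R <= z] y = 0 :> R.
    by rewrite indicE memNset//= -natr1 => h; lra.
  by rewrite addr0; apply: IH; rewrite y0.
rewrite (eq_bigr (fun _ => 1 : R)); last first.
  move=> j _; rewrite indicE mem_set//=.
  by rewrite (le_trans _ (ltW ky))// ler_nat.
rewrite sumr_const card_ord -[1 *+ k]/(k%:R).
rewrite -natr1 in yk; rewrite indicE.
by case: (_ \in _); rewrite ler_norml /=; apply/andP; split; lra.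
Qed.

(** Since [a n] need not converge, [f] is approximated uniformly, by a combination of indicators of
    its level sets; the error is then at most [M] times the mesh for all [n] at once. *)
Lemma sigma_cvg (Pi : set (set T)) (a : nat -> T -> R) (f : T -> R) (M : R) :
  setI_closed Pi -> Pi `<=` measurable ->
  (forall n, measurable_fun setT (a n)) -> (forall n x, `|a n x| <= M) ->
  (forall S, Pi S \/ S = setT -> (fun n => ev (fun x => a n x * \1_S x)) @ \oo --> (0 : R)) ->
  (forall B, measurable B -> <<s Pi >> (f @^-1` B)) ->
  (exists K, forall x, `|f x| <= K) ->
  (fun n => ev (fun x => a n x * f x)) @ \oo --> (0 : R).
Proof.
move=> PiI mPi ma aM cPi mf [K0 fK0].
have ba n : bmfun (a n) by split => //; exists M.
have ds S : <<s Pi >> S -> measurable S /\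
    (fun n => ev (fun x => a n x * \1_S x)) @ \oo --> (0 : R).
  have M0 : 0 <= M by rewrite (le_trans _ (aM 0%N point)).
  have eL S0 : (fun n => ev (fun x => a n x * \1_S0 x) - ev (fun x => 0 * \1_S0 x)) =
      (fun n => ev (fun x => a n x * \1_S0 x)).
    apply/funext => n; under [X in _ - X]eq_ev do rewrite mul0r.
    by rewrite ev_cst subr0.
  have b0M (n : nat) (x : T) : `|0 : R| <= M by rewrite normr0.
  have mI S0 : Pi S0 -> measurable (id @^-1` S0) /\ measurable (id @^-1` S0).
    by move=> PS; split; exact: mPi.
  move=> sS.
  have := @dynkin_cvg _ _ _ P _ Pi id id a (fun _ _ => 0) M PiI ma
    (fun _ => measurable_cst _) aM b0M mI _ S sS.
  rewrite eL => h; have [] // := h _ => S0 hS.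
  by rewrite eL; exact: cPi.
pose K := `|K0| + 1.
have K0' : 0 < K by rewrite /K ltr_wpDl.
have fK x : `|f x| <= K by rewrite (le_trans (fK0 x))// (le_trans (ler_norm _))// /K lerDl.
have M0 : 0 <= M by rewrite (le_trans _ (aM 0%N point)).
have mmf : measurable_fun setT f.
  by move=> _ B mB; rewrite setTI; have [] := ds _ (mf _ mB).
have bf : bmfun f by split => //; exists K.
(* Affine image of [f] in [[0, k]]: rounding it down costs at most 1, that is [2 * K / k] on the
   scale of [f]. *)
pose y k x := (f x + K) / (2 * K) * k%:R.
pose S k j := [set x | j.+1%:R <= y k x].
have mS k j : <<s Pi >> (S k j).
  have [->|k0] := posnP k.
    rewrite (_ : S 0%N j = set0); first exact: sigma_algebra0.
    apply/seteqP; split => // x; rewrite /S /y /= mulr0 => h.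
    by have := ltr0Sn R j; lra.
  rewrite (_ : S k j = f @^-1` `[j.+1%:R / k%:R * (2 * K) - K, +oo[); first exact: mf.
  apply/seteqP; split => x; rewrite /S /y /= in_itv /= andbT => h.
    rewrite lerBlDr -ler_pdivlMr ?mulr_gt0// ler_pdivrMr// ltr0n//.
  move: h; rewrite lerBlDr -ler_pdivlMr ?mulr_gt0// ler_pdivrMr// ltr0n//.
pose s k x := \sum_(j < k) (\1_(S k j) x : R).
have bs k : bmfun (s k).
  have : forall m, bmfun (fun x => \sum_(j < m) (\1_(S k j) x : R)).
    elim=> [|m IH].
      by under eq_fun do rewrite big_ord0; exact: bmfun_cst.
    under eq_fun do rewrite big_ord_recr/=.
    by apply: bmfunD => //; apply: bmfun_indic; have [] := ds _ (mS k m).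
  exact.
have cs k : (fun n => ev (fun x => a n x * s k x)) @ \oo --> (0 : R).
  have : forall m, bmfun (fun x => \sum_(j < m) (\1_(S k j) x : R)) /\
     (fun n => ev (fun x => a n x * \sum_(j < m) (\1_(S k j) x : R))) @ \oo --> (0 : R).
    elim=> [|m [IHb IH]].
      split; first by under eq_fun do rewrite big_ord0; exact: bmfun_cst.
      under eq_fun do under eq_ev do rewrite big_ord0 mulr0.
      by under eq_fun do rewrite ev_cst; exact: cvg_cst.
    have [mSk cSk] := ds _ (mS k m).
    split.
      by under eq_fun do rewrite big_ord_recr/=; apply: bmfunD => //; exact: bmfun_indic.
    have -> : (fun n => ev (fun x => a n x * \sum_(j < m.+1) (\1_(S k j) x : R))) =
      (fun n => ev (fun x => a n x * \sum_(j < m) (\1_(S k j) x : R)) + ev (fun x => a n x * \1_(S k m) x)).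
      apply/funext => n; rewrite -evD; last 2 first.
      - exact: bmfunM.
      - by apply: bmfunM => //; exact: bmfun_indic.
      by apply: eq_ev => x; rewrite big_ord_recr/= mulrDr.
    by rewrite -[X in _ --> X](addr0 0); apply: cvgD.
  by move=> /(_ k)[].
have ca : (fun n => ev (a n)) @ \oo --> (0 : R).
  have := cPi setT (or_intror erefl).
  by under eq_fun do under eq_ev do rewrite indicT mulr1.
have near_f k x : (0 < k)%N -> `|f x - (2 * K / k%:R * s k x - K)| <= 2 * K / k%:R.
  move=> k0; have kr : 0 < k%:R :> R by rewrite ltr0n.
  have -> : f x - (2 * K / k%:R * s k x - K) = 2 * K / k%:R * (y k x - s k x).
    by rewrite /y; field; rewrite !gt_eqF.
  have c0 : 0 <= 2 * K / k%:R by rewrite ltW// divr_gt0// mulr_gt0.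
  rewrite normrM (ger0_norm c0) -[leRHS]mulr1 ler_wpM2l//.
  have := @floor_sum_dist k (y k x); apply.
  have := fK x; rewrite ler_norml => /andP[f1 f2].
  have K20 : 0 < 2 * K by rewrite mulr_gt0.
  rewrite /y; apply/andP; split.
    by rewrite mulr_ge0// divr_ge0//; lra.
  by rewrite ler_piMl// ler_pdivrMr//; lra.
apply/cvgrPdist_lt => e e0.
have [k k0 ke] : exists2 k, (0 < k)%N & M * (2 * K / k%:R) < e / 2.
  have [m] : exists m : nat, M * (2 * K) / (e / 2) < m%:R.
    exists (Num.truncn (M * (2 * K) / (e / 2))).+1.
    exact: truncnS_gt.
  move=> hm; have c0 : 0 <= M * (2 * K) / (e / 2).
    by rewrite divr_ge0// ?mulr_ge0//; lra.
  have m0 : 0 < m%:R :> R by exact: le_lt_trans hm.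
  exists m; first by rewrite -(ltr0n R).
  rewrite mulrA ltr_pdivrMr//; move: hm; rewrite ltr_pdivrMr; last by lra.
  by rewrite (mulrC m%:R).
have cc : (fun n => 2 * K / k%:R * ev (fun x => a n x * s k x) - K * ev (a n)) @ \oo --> (0 : R).
  rewrite [X in _ --> X](_ : 0 = 2 * K / k%:R * 0 - K * 0); last by ring.
  by apply: cvgB; apply: cvgM => //; exact: cvg_cst.
have e20 : 0 < e / 2 by rewrite divr_gt0.
move/cvgrPdist_lt : cc => /(_ _ e20); apply: filterS => n.
rewrite !sub0r !normrN => hn.
have -> : ev (fun x => a n x * f x) =
   (2 * K / k%:R * ev (fun x => a n x * s k x) - K * ev (a n)) +
   ev (fun x => a n x * (f x - (2 * K / k%:R * s k x - K))).
  rewrite -!evZ//; last exact: bmfunM.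
  have b1 : bmfun (fun x => 2 * K / k%:R * (a n x * s k x)).
    by apply: bmfunM; [exact: bmfun_cst | exact: bmfunM].
  have b2 : bmfun (fun x => K * a n x) by apply: bmfunM => //; exact: bmfun_cst.
  have b3 : bmfun (fun x => 2 * K / k%:R * s k x - K).
    by apply: bmfunB; [apply: bmfunM => //; exact: bmfun_cst | exact: bmfun_cst].
  rewrite -evB// -evD//; last 2 first.
  - exact: bmfunB.
  - by apply: bmfunM => //; exact: bmfunB.
  by apply: eq_ev => x; ring.
rewrite (le_lt_trans (ler_normD _ _))// [e]splitr ltrD//.
rewrite (le_lt_trans _ ke)//; apply: norm_ev_le.
  apply: measurable_funM => //; apply: measurable_funB => //.
  have [] : bmfun (fun x => 2 * K / k%:R * s k x - K) => //.
  by apply: bmfunB; [apply: bmfunM => //; exact: bmfun_cst | exact: bmfun_cst].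
by move=> x; rewrite normrM ler_pM// near_f.
Qed.

Lemma sigma_eq0 (Pi : set (set T)) (a f : T -> R) :
  setI_closed Pi -> Pi `<=` measurable -> bmfun a ->
  (forall S, Pi S \/ S = setT -> ev (fun x => a x * \1_S x) = 0) ->
  (forall B, measurable B -> <<s Pi >> (f @^-1` B)) ->
  (exists K, forall x, `|f x| <= K) ->
  ev (fun x => a x * f x) = 0.
Proof.
move=> PiI mPi [ma [M aM]] a0 mf fK.
have : (fun n : nat => ev (fun x => a x * f x)) @ \oo --> (0 : R).
  apply: (@sigma_cvg Pi (fun _ => a) f M) => //.
  by move=> S hS; under eq_fun do rewrite a0//; exact: cvg_cst.
by move=> /cvg_lim <-//; rewrite lim_cst.
Qed.

Lemma dynkin_eq (U : Type) (Pi : set (set U)) (X X' : T -> U) (a b : T -> R) :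
  setI_closed Pi -> bmfun a -> bmfun b ->
  (forall S, Pi S -> measurable (X @^-1` S) /\ measurable (X' @^-1` S)) ->
  (forall S, Pi S \/ S = setT ->
     ev (fun x => a x * \1_S (X x)) = ev (fun x => b x * \1_S (X' x))) ->
  forall S, <<s Pi >> S ->
     ev (fun x => a x * \1_S (X x)) = ev (fun x => b x * \1_S (X' x)).
Proof.
move=> PiI [ma [M aM]] [mb [N bN]] mPi ePi S sS.
have aM' (n : nat) x : `|a x| <= Num.max M N by rewrite le_max aM.
have bM' (n : nat) x : `|b x| <= Num.max M N by rewrite le_max bN orbT.
have [] := @dynkin_cvg _ _ _ P _ Pi X X' (fun _ => a) (fun _ => b) (Num.max M N) PiI
  (fun _ => ma) (fun _ => mb) aM' bM' mPi _ S sS.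
  by move=> S0 hS; under eq_fun do rewrite ePi// subrr; exact: cvg_cst.
by move=> _ _ /cvg_lim h; apply/eqP; rewrite -subr_eq0 -h// lim_cst.
Qed.

End sigma_extension.

(** * Uniqueness of weighted Laplace transforms *)

Section laplace.
Context {d : measure_display} {T : measurableType d} {R : realType}.
Context (P : probability T R).
Notation ev f := (Rintegral P setT f).

Lemma cvg_eq (u v : nat -> R) (a b : R) : u @ \oo --> a -> v @ \oo --> b ->
  (forall n, u n = v n) -> a = b.
Proof.
move=> ua vb uv; have uE : u = v by apply/funext.
by rewrite uE in ua; exact: (cvg_unique _ ua vb).
Qed.

Lemma bmfun_expN (X : T -> R) (l : R) : 0 <= l -> measurable_fun setT X -> (forall x, 0 <= X x) ->
  bmfun (fun x => expR (- (l * X x))).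
Proof.
move=> l0 mX X0; split.
  apply: measurableT_comp => //; apply: measurable_funN; apply: measurable_funM => //.
by exists 1 => x; rewrite ger0_norm ?expR_ge0// -expR0 ler_expR oppr_le0 mulr_ge0.
Qed.

Lemma expR_ge_sqr (y : R) : 0 <= y -> y ^+ 2 / 4 <= expR y.
Proof.
move=> y0; rewrite [y in expR y]splitr expRD.
have h : 1 + y / 2 <= expR (y / 2) by exact: expR_ge1Dx.
have -> : y ^+ 2 / 4 = (y / 2) * (y / 2) by field.
by apply: ler_pM; lra.
Qed.

Lemma bernoulli_ineq (v : R) m : 0 <= v <= 1 -> 1 - m%:R * v <= (1 - v) ^+ m.
Proof.
move=> /andP[v0 v1]; elim: m => [|m IH]; first by rewrite expr0 mul0r subr0.
rewrite exprS -natr1.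
have := ler_wpM2l (_ : 0 <= 1 - v) IH; rewrite subr_ge0 => /(_ v1).
apply: le_trans; have : 0 <= m%:R * v * v by rewrite !mulr_ge0.
move=> h; rewrite (_ : (1 - v) * (1 - m%:R * v) = 1 - (m%:R + 1) * v + m%:R * v * v) ?lerDl//.
by ring.
Qed.

(* [(1 - 2^{-n x / x0}) ^ (n 2^n)] converges to the indicator of [x > x0],
   including at [x = x0], thanks to the extra factor [n] in the exponent. *)
Lemma cvg_ray_indic (x0 x : R) : 0 < x0 -> 0 <= x ->
  (fun n => (1 - expR (- (n%:R * ln 2 / x0 * x))) ^+ (n * 2 ^ n)) @ \oo -->
  (\1_[set z | x0 < z] x : R).
Proof.
move=> x00 x0'.
have ln20 : 0 < ln 2 :> R by rewrite ln_gt0// ltr1n.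
have vP n : 0 <= expR (- (n%:R * ln 2 / x0 * x)) <= 1.
  rewrite expR_ge0/= expR_le1 oppr_le0 mulr_ge0// divr_ge0//; last exact: ltW.
  by rewrite mulr_ge0// ltW.
have [xx|xx] := leP x x0.
  rewrite indicE memNset/=; last by apply/negP; rewrite -leNgt.
  have ce : (fun n : nat => expR (- 1) ^+ n) @ \oo --> (0 : R).
    by apply: cvg_expr; rewrite ger0_norm ?expR_ge0// expR_lt1; lra.
  apply: (@squeeze_cvgr _ _ _ _ (fun=> 0) (fun n => expR (- 1) ^+ n)) => //; last exact: cvg_cst.
  apply: nearW => n; have /andP[v0 v1] := vP n.
  rewrite exprn_ge0 ?subr_ge0//=.
  (* For [x <= x0] the exponential is at least [2^-n], so the power is at most [exp(- 2^-n)] raised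
     to [n 2^n], which is [exp(- n)]. *)
  have h1 : 1 - expR (- (n%:R * ln 2 / x0 * x)) <= expR (- expR (- (n%:R * ln 2))).
    apply: (@le_trans _ _ (1 - expR (- (n%:R * ln 2)))).
      rewrite lerB// ler_expR lerN2 -[leRHS]mulr1 -mulrA ler_wpM2l//; first by rewrite mulr_ge0// ltW.
      by rewrite mulrC ler_pdivrMr// mul1r.
    by have := expR_ge1Dx (- expR (- (n%:R * ln 2 : R))).
  apply: (le_trans (lerXn2r _ _ _ h1)); rewrite ?nnegrE ?subr_ge0 ?expR_ge0//.
  rewrite -!expRM_natl ler_expR !mulrN mulr1 lerN2 natrM -mulrA.
  rewrite natrX -[X in X ^+ n](@lnK R); last by rewrite posrE.
  by rewrite -expRM_natl -expRD subrr expR0 mulr1.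
rewrite indicE mem_set//.
(* For [x > x0] the exponential is [2^-n exp(- n dl)]. Bernoulli's inequality loses [n exp(- n dl)],
   which [expR_ge_sqr] bounds by [4 / (dl^2 n)]. *)
pose dl := ln 2 / x0 * x - ln 2.
have dl0 : 0 < dl by rewrite /dl subr_gt0 -mulrA ltr_pMr// mulrC ltr_pdivlMr// mul1r.
have c1 : (fun n : nat => 1 - 4 / dl ^+ 2 * n%:R^-1) @ \oo --> (1 : R).
  rewrite [X in _ --> X](_ : 1 = 1 - 4 / dl ^+ 2 * 0); last by rewrite mulr0 subr0.
  apply: cvgB; first exact: cvg_cst.
  by apply: cvgM; [exact: cvg_cst | apply/gtr0_cvgV0; [by exists 1%N => // n /= n0; rewrite ltr0n | exact: cvgr_idn]].
apply: (@squeeze_cvgr _ _ _ _ (fun n : nat => 1 - 4 / dl ^+ 2 * n%:R^-1) (fun=> 1)) => //; last exact: cvg_cst.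
exists 1%N => // n /= n0; have /andP[v0 v1] := vP n.
have nR : 0 < n%:R :> R by rewrite ltr0n.
apply/andP; split; last by rewrite exprn_ile1 ?subr_ge0// gerBl.
apply: le_trans (bernoulli_ineq _ (vP n)); rewrite lerB// natrM natrX.
rewrite -[X in X ^+ n](@lnK R) ?posrE// -expRM_natl -mulrA -expRD.
rewrite (_ : n%:R * ln 2 - _ = - (n%:R * dl)); last by rewrite /dl; ring.
rewrite expRN ler_pdivrMr ?expR_gt0//.
have h := @expR_ge_sqr (n%:R * dl) (ltW (mulr_gt0 nR dl0)).
have c0 : 0 <= 4 / dl ^+ 2 / n%:R by rewrite !divr_ge0// sqr_ge0.
apply: le_trans (ler_wpM2l c0 h).
by rewrite le_eqVlt; apply/orP; left; apply/eqP; field; rewrite !gt_eqF.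
Qed.

(** By induction on [m], an exponential times the [m]-th power of [1 - exp(- mu X)] has the same
    weighted expectation on both sides; [cvg_ray_indic] makes such powers converge boundedly to a
    ray. The weights [H] and [H'] let one statement serve for equality in law, independence and
    change of measure. *)
Lemma laplace_ray (X X' H H' : T -> R) :
  measurable_fun setT X -> measurable_fun setT X' ->
  (forall x, 0 <= X x) -> (forall x, 0 <= X' x) -> bmfun H -> bmfun H' ->
  (forall l, 0 <= l -> ev (fun x => H x * expR (- (l * X x))) =
                       ev (fun x => H' x * expR (- (l * X' x)))) ->
  forall x0, 0 < x0 -> ev (fun x => H x * \1_[set z | x0 < z] (X x)) =
             ev (fun x => H' x * \1_[set z | x0 < z] (X' x)).
Proof.
move=> mX mX' X0 X0' bH bH' hL x0 x00.
have b1 (Y : T -> R) mu m : 0 <= mu -> measurable_fun setT Y -> (forall x, 0 <= Y x) ->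
    bmfun (fun x => (1 - expR (- (mu * Y x))) ^+ m).
  move=> mu0 mY Y0; elim: m => [|m IH]; first exact: bmfun_cst.
  under eq_fun do rewrite exprS; apply: bmfunM => //.
  by apply: bmfunB; [exact: bmfun_cst | exact: bmfun_expN].
have b2 G (Y : T -> R) l mu m : bmfun G -> 0 <= l -> 0 <= mu -> measurable_fun setT Y ->
    (forall x, 0 <= Y x) ->
    bmfun (fun x => G x * expR (- (l * Y x)) * (1 - expR (- (mu * Y x))) ^+ m).
  move=> bG l0 mu0 mY Y0; apply: bmfunM; last exact: b1.
  by apply: bmfunM => //; exact: bmfun_expN.
have split G (Y : T -> R) l mu m : bmfun G -> 0 <= l -> 0 <= mu -> measurable_fun setT Y ->
    (forall x, 0 <= Y x) ->
  ev (fun x => G x * expR (- (l * Y x)) * (1 - expR (- (mu * Y x))) ^+ m.+1) =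
  ev (fun x => G x * expR (- (l * Y x)) * (1 - expR (- (mu * Y x))) ^+ m) -
  ev (fun x => G x * expR (- ((l + mu) * Y x)) * (1 - expR (- (mu * Y x))) ^+ m).
  move=> bG l0 mu0 mY Y0; rewrite -evB; last 2 first.
  - exact: b2.
  - by apply: b2 => //; exact: addr_ge0.
  apply: eq_ev => x; rewrite exprS.
  have -> : expR (- ((l + mu) * Y x)) = expR (- (l * Y x)) * expR (- (mu * Y x)).
    by rewrite -expRD; congr expR; ring.
  by ring.
(* The rate [l] stays quantified in the induction because each new factor shifts it to [l + mu]. *)
have e1 m : forall l mu, 0 <= l -> 0 <= mu ->
  ev (fun x => H x * expR (- (l * X x)) * (1 - expR (- (mu * X x))) ^+ m) =
  ev (fun x => H' x * expR (- (l * X' x)) * (1 - expR (- (mu * X' x))) ^+ m).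
  elim: m => [|m IH] l mu l0 mu0.
    under eq_ev do rewrite expr0 mulr1.
    under [RHS]eq_ev do rewrite expr0 mulr1.
    exact: hL.
  rewrite (split H X l mu m bH l0 mu0 mX X0) (split H' X' l mu m bH' l0 mu0 mX' X0').
  by rewrite (IH l mu l0 mu0) (IH (l + mu) mu (addr_ge0 l0 mu0) mu0).
have cv G (Y : T -> R) : bmfun G -> measurable_fun setT Y -> (forall x, 0 <= Y x) ->
  (fun n => ev (fun x => G x * expR (- (0 * Y x)) *
     (1 - expR (- (n%:R * ln 2 / x0 * Y x))) ^+ (n * 2 ^ n))) @ \oo -->
  ev (fun x => G x * \1_[set z | x0 < z] (Y x)).
  move=> bG mY Y0; have [mG [M GM]] := bG.
  have n0 n : 0 <= n%:R * ln 2 / x0 :> R.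
    by rewrite divr_ge0 ?mulr_ge0// ?ln_ge0 ?ler1n// ltW.
  apply: (@ev_cvg _ _ _ P _ _ M).
  - by move=> n; have [] := b2 G Y 0 (n%:R * ln 2 / x0) (n * 2 ^ n)%N bG (lexx 0) (n0 n) mY Y0.
  - apply: measurable_funM => //.
    have [] // : bmfun (fun x => (\1_[set z | x0 < z] (Y x) : R)).
    by apply: bmfun_indic_comp => //; rewrite -set_itvoy.
  - move=> n x; rewrite mul0r oppr0 expR0 mulr1 normrM -[leRHS]mulr1 ler_pM//.
    have v1 : 0 <= 1 - expR (- (n%:R * ln 2 / x0 * Y x)).
      by rewrite subr_ge0 expR_le1 oppr_le0 mulr_ge0.
    by rewrite normrX exprn_ile1// ger0_norm// gerBl expR_ge0.
  - apply: aeW => x; under eq_fun do rewrite mul0r oppr0 expR0 mulr1.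
    by apply: cvgM; [exact: cvg_cst | exact: cvg_ray_indic].
have c1 := cv H X bH mX X0; have c2 := cv H' X' bH' mX' X0'.
apply: (cvg_eq c1 c2) => n; apply: e1; first exact: lexx.
by rewrite divr_ge0 ?mulr_ge0// ?ln_ge0 ?ler1n// ltW.
Qed.

(** Open rays form a pi-system generating the Borel sets; those with a negative endpoint contain all
    values, since [X] and [X'] are nonnegative. *)
Lemma laplace_unique (X X' H H' : T -> R) :
  measurable_fun setT X -> measurable_fun setT X' ->
  (forall x, 0 <= X x) -> (forall x, 0 <= X' x) -> bmfun H -> bmfun H' ->
  (forall l, 0 <= l -> ev (fun x => H x * expR (- (l * X x))) =
                       ev (fun x => H' x * expR (- (l * X' x)))) ->
  forall B, measurable B -> ev (fun x => H x * \1_B (X x)) =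
             ev (fun x => H' x * \1_B (X' x)).
Proof.
move=> mX mX' X0 X0' bH bH' hL B mB.
have ray := laplace_ray mX mX' X0 X0' bH bH' hL.
have tot : ev H = ev H'.
  have := hL 0 (lexx 0).
  under eq_ev do rewrite mul0r oppr0 expR0 mulr1.
  by under [in RHS]eq_ev do rewrite mul0r oppr0 expR0 mulr1.
(* The ray at 0 escapes [laplace_ray], where the rate is divided by the endpoint; it is the
   increasing limit of the rays at [1 / (n + 1)]. *)
have ray0 : ev (fun x => H x * \1_[set z | 0 < z] (X x)) =
             ev (fun x => H' x * \1_[set z | 0 < z] (X' x)).
  have cv G (Y : T -> R) : bmfun G -> measurable_fun setT Y -> (forall x, 0 <= Y x) ->
    (fun n => ev (fun x => G x * \1_[set z | n.+1%:R^-1 < z] (Y x))) @ \oo -->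
    ev (fun x => G x * \1_[set z | 0 < z] (Y x)).
    move=> [mG [M GM]] mY Y0.
    have mi (z0 : R) : measurable_fun setT (fun x => (\1_[set z | z0 < z] (Y x) : R)).
      have [] // : bmfun (fun x => (\1_[set z | z0 < z] (Y x) : R)).
      by apply: bmfun_indic_comp => //; rewrite -set_itvoy.
    apply: (@ev_cvg _ _ _ P _ _ M).
    - by move=> n; exact: measurable_funM.
    - exact: measurable_funM.
    - by move=> n x; rewrite normrM -[leRHS]mulr1 ler_pM// ger0_norm.
    - apply: aeW => x; apply: cvgM; first exact: cvg_cst.
      have [Yx|Yx] := ltP 0 (Y x); last first.
        rewrite indicE memNset; last by apply/negP; rewrite -leNgt.
        apply: (@cvg_near_cst _ R); apply: nearW => n; rewrite indicE memNset//=.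
        by apply/negP; rewrite -leNgt (le_trans Yx).
      rewrite indicE mem_set//; apply: (@cvg_near_cst _ R).
      exists (Num.truncn (Y x)^-1).+1 => // n /= hn; rewrite indicE mem_set//=.
      rewrite invf_plt ?posrE//.
      by rewrite (lt_le_trans (truncnS_gt _))// ler_nat (leq_trans hn).
  have c1 := cv H X bH mX X0; have c2 := cv H' X' bH' mX' X0'.
  by apply: (cvg_eq c1 c2) => n; apply: ray.
have mB' : (@RGenOInfty.G R).-sigma.-measurable B.
  by rewrite -(RGenOInfty.measurableE R); exact: mB.
apply: (@dynkin_eq _ _ _ P _ (@RGenOInfty.G R)) mB' => //.
- move=> _ _ [x ->] [y ->]; exists (Num.max x y).
  by apply/seteqP; split => z /=; rewrite !in_itv /= !andbT gt_max => /andP.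
- move=> _ [x ->]; split; rewrite -[X in measurable X]setTI; [exact: mX | exact: mX'].
- move=> S [[x ->]|->]; last first.
    by under eq_ev do rewrite indicT mulr1; under [RHS]eq_ev do rewrite indicT mulr1.
  rewrite set_itvoy; have [x0|x0|<-//] := ltgtP 0 x; first exact: ray.
  under eq_ev do rewrite indicE mem_set/= ?mulr1 ?(lt_le_trans x0)//.
  by under [RHS]eq_ev do rewrite indicE mem_set/= ?mulr1 ?(lt_le_trans x0)//.
Qed.

(** One-dimensional uniqueness is applied once per coordinate, the exponential or the indicator of
    the other coordinate being absorbed into the weight; rectangles then generate. *)
Lemma laplace_unique2 (X Y X' Y' H H' : T -> R) :
  measurable_fun setT X -> measurable_fun setT X' ->
  measurable_fun setT Y -> measurable_fun setT Y' ->
  (forall x, 0 <= X x) -> (forall x, 0 <= X' x) ->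
  (forall x, 0 <= Y x) -> (forall x, 0 <= Y' x) -> bmfun H -> bmfun H' ->
  (forall l m, 0 <= l -> 0 <= m ->
     ev (fun x => H x * expR (- (l * X x)) * expR (- (m * Y x))) =
     ev (fun x => H' x * expR (- (l * X' x)) * expR (- (m * Y' x)))) ->
  forall B : set (R * R), measurable B -> ev (fun x => H x * \1_B (X x, Y x)) =
             ev (fun x => H' x * \1_B (X' x, Y' x)).
Proof.
move=> mX mX' mY mY' X0 X0' Y0 Y0' bH bH' hL B mB.
have rect A C : measurable A -> measurable C ->
   ev (fun x => H x * \1_A (X x) * \1_C (Y x)) =
   ev (fun x => H' x * \1_A (X' x) * \1_C (Y' x)).
  move=> mA mC.
  apply: (laplace_unique mY mY' Y0 Y0' _ _ _ mC).
  - by apply: bmfunM => //; exact: bmfun_indic_comp.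
  - by apply: bmfunM => //; exact: bmfun_indic_comp.
  move=> m m0.
  transitivity (ev (fun x => H x * expR (- (m * Y x)) * \1_A (X x))).
    by apply: eq_ev => x; ring.
  transitivity (ev (fun x => H' x * expR (- (m * Y' x)) * \1_A (X' x))); last first.
    by apply: eq_ev => x; ring.
  apply: (laplace_unique mX mX' X0 X0' _ _ _ mA).
  - by apply: bmfunM => //; exact: bmfun_expN.
  - by apply: bmfunM => //; exact: bmfun_expN.
  move=> l l0; transitivity (ev (fun x => H x * expR (- (l * X x)) * expR (- (m * Y x)))).
    by apply: eq_ev => x; ring.
  rewrite (hL l m l0 m0); apply: eq_ev => x; ring.
rewrite measurable_prod_measurableType in mB.
have Xm (Z : T -> R) A : measurable_fun setT Z -> measurable A -> measurable (Z @^-1` A).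
  by move=> mZ mA; rewrite -[X in measurable X]setTI; exact: mZ.
apply: (@dynkin_eq _ _ _ P _ _ (fun x => (X x, Y x)) (fun x => (X' x, Y' x))) mB => //.
- move=> _ _ [A1 mA1 [B1 mB1 <-]] [A2 mA2 [B2 mB2 <-]].
  exists (A1 `&` A2); first exact: measurableI.
  by exists (B1 `&` B2); [exact: measurableI | rewrite setXI].
- move=> _ [A mA [C mC <-]]; split.
    exact: (measurableI _ _ (Xm X A mX mA) (Xm Y C mY mC)).
  exact: (measurableI _ _ (Xm X' A mX' mA) (Xm Y' C mY' mC)).
- have iE (u v : R) A C : \1_(A `*` C) (u, v) = \1_A u * \1_C v :> R.
    by rewrite !indicE in_setX/= -natrM mulnb.
  move=> S [[A mA [C mC <-]]|->].
    under eq_ev do rewrite iE mulrA.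
    under [RHS]eq_ev do rewrite iE mulrA.
    exact: rect.
  have := rect setT setT measurableT measurableT.
  under eq_ev do rewrite !indicT !mulr1.
  under [in RHS]eq_ev do rewrite !indicT !mulr1.
  move=> h; under eq_ev do rewrite indicT mulr1.
  by under [RHS]eq_ev do rewrite indicT mulr1.
Qed.

End laplace.

(** With the generated sigma-algebra carried by an alias of [T], the closure properties of
    measurable functions apply to sub-sigma-algebras as they stand. *)
Notation gmeas C f := (measurable_fun (T := g_sigma_algebraType C) setT f).

(** The integral of the absolute value over [S] is that of [f], hence 0; so [f] vanishes almost
    everywhere on [S], which strict positivity forbids. *)
Lemma pos_null {d : measure_display} {T : measurableType d} {R : realType}
    (P : probability T R) (f : T -> R) (S : set T) : P.-integrable setT (EFin \o f) ->
  measurable S -> (forall x, S x -> 0 < f x) ->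
  (\int[P]_(x in S) (f x)%:E <= 0)%E -> P S = 0%E.
Proof.
move=> intf mS f0 le0.
have mf : measurable_fun S (EFin \o f).
  by apply: measurable_funTS; case/integrableP: intf.
have e0 : (\int[P]_(x in S) `|(EFin \o f) x| = 0)%E.
  apply/eqP; rewrite eq_le integral_ge0 ?andbT//.
  rewrite (le_trans _ le0)// le_eqVlt; apply/orP; left; apply/eqP.
  by apply: eq_integral => x /set_mem Sx /=; rewrite ger0_norm// ltW// f0.
have /(ae_eq_integral_abs P mS mf) [N [mN N0 sN]] := e0.
apply: (@subset_measure0 _ _ _ P S N) => // x Sx; apply: sN => /= h.
by have := h Sx; move=> [] fx0; have := f0 x Sx; rewrite fx0 ltxx.
Qed.

(** * Conditional expectations and independence *)

Section independence.
Context {d : measure_display} {T : measurableType d} {R : realType}.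
Context (P : probability T R).
Notation ev f := (Rintegral P setT f).

Lemma integral_indicM (f : T -> R) (S : set T) : measurable S -> bmfun f ->
  (\int[P]_(x in S) (f x)%:E = (ev (fun x => f x * \1_S x))%:E)%E.
Proof.
move=> mS bf; rewrite integral_mkcond /Rintegral fineK; last first.
  apply: integrable_fin_num => //; apply: bmfun_integrable.
  by apply: bmfunM => //; exact: bmfun_indic.
apply: eq_integral => x _; rewrite patchE indicE.
by case: ifPn => _; rewrite ?mulr1 ?mulr0.
Qed.

(** Radon-Nikodym derivative, with respect to the law of [Z], of the measure sending [B] to the
    expectation of [H] on [Z] in [B]. It is wanted as a function on all of [U] with values in
    [[0, 1]], because it is later evaluated at points that are not values of [Z]. *)
Lemma cond_exp_exists d' (U : measurableType d') (Z : T -> U) (H : T -> R) :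
  measurable_fun setT Z -> measurable_fun setT H -> (forall x, 0 <= H x <= 1) ->
  exists c : U -> R, [/\ measurable_fun setT c, (forall z, 0 <= c z <= 1) &
    forall B, measurable B -> ev (fun x => H x * \1_B (Z x)) =
                              ev (fun x => c (Z x) * \1_B (Z x))].
Proof.
move=> mZ mH H01.
have bH : bmfun H.
  by split => //; exists 1 => x; have /andP[? ?] := H01 x; rewrite ger0_norm.
have mZB B : measurable B -> measurable (Z @^-1` B).
  by move=> mB; rewrite -[X in measurable X]setTI; exact: mZ.
pose Zm : {mfun T >-> U} := HB.pack Z (isMeasurableFun.Build _ _ _ _ Z mZ).
pose mu := distribution P Zm.
pose nu0 := induced_charge (bmfun_integrable P bH).
have nuM : pushforward nu0 Z `<< mu.
  apply: (@dominates_pushforward _ _ _ _ _ P nu0 Z mZ).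
  apply/null_content_dominatesP => A mA PA0.
  by apply: null_set_integral => //; apply: measurable_funTS; exact/measurable_EFinP.
pose nu : {charge set U -> \bar R} :=
  @measure_function_pushforward__canonical__charge_Charge _ _ _ _ Z _ nu0 mZ.
have nuE B : nu B = (\int[P]_(x in Z @^-1` B) (H x)%:E)%E by [].
pose f := Radon_Nikodym nu mu.
have ffin z : f z \is a fin_num by exact: Radon_Nikodym_fin_num.
have intf : mu.-integrable setT f by exact: Radon_Nikodym_integrable.
have fE B : measurable B -> nu B = (\int[mu]_(z in B) f z)%E.
  by move=> mB; exact: Radon_Nikodym_integral.
pose r z := fine (f z).
have fr : f = EFin \o r by apply/funext => z; rewrite /= fineK.
have mr : measurable_fun setT r.
  by apply/measurable_EFinP; rewrite -/(EFin \o r) -fr; case/integrableP: intf.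
rewrite fr in intf fE.
have intr1 : mu.-integrable setT (EFin \o (fun z => r z - 1)).
  rewrite (_ : _ \o _ = (EFin \o r) \- (EFin \o cst 1%R))%E; last first.
    by apply/funext => z /=; rewrite EFinB.
  by apply: integrableB => //; exact: finite_measure_integrable_cst.
have intrN : mu.-integrable setT (EFin \o (fun z => - r z)).
  rewrite (_ : _ \o _ = \- (EFin \o r))%E; first exact: integrableN.
  by apply/funext => z /=; rewrite EFinN.
pose S1 := [set z | 1 < r z]; pose S2 := [set z | r z < 0].
have mS1 : measurable S1.
  rewrite (_ : S1 = setT `&` r @^-1` `]1, +oo[); first exact: mr.
  by rewrite setTI; apply/seteqP; split => z; rewrite /= in_itv/= andbT.
have mS2 : measurable S2.
  rewrite (_ : S2 = setT `&` r @^-1` `]-oo, 0[); first exact: mr.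
  by rewrite setTI; apply/seteqP; split => z; rewrite /= in_itv/=.
have S10 : mu S1 = 0%E.
  apply: (@pos_null _ U R mu (fun z => r z - 1)) => //.
    by move=> z; rewrite /S1 /= subr_gt0.
  have -> : (\int[mu]_(x in S1) (r x - 1)%:E = nu S1 - mu S1)%E.
    under eq_integral do rewrite EFinB.
    rewrite integralB_EFin//; last 2 first.
    - exact: (integrableS measurableT).
    - exact: finite_measure_integrable_cst.
    by rewrite -fE// integral_cst// mul1e.
  rewrite nuE; rewrite sube_le0; apply: (@le_trans _ _ (\int[P]_(x in Z @^-1` S1) cst 1%:E x)%E).
    apply: ge0_le_integral => //.
    - exact: mZB.
    - by move=> x _; rewrite lee_fin; have /andP[] := H01 x.
    - by apply: measurable_funTS; exact/measurable_EFinP.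
    - by move=> x _; rewrite lee_fin; have /andP[] := H01 x.
  by rewrite integral_cst ?mul1e//; exact: mZB.
have S20 : mu S2 = 0%E.
  apply: (@pos_null _ U R mu (fun z => - r z)) => //.
    by move=> z; rewrite /S2 /= oppr_gt0.
  have -> : (\int[mu]_(x in S2) (- r x)%:E = - nu S2)%E.
    under eq_integral do rewrite EFinN.
    rewrite integralN ?fE//; apply: integrable_add_def => //.
    exact: (integrableS measurableT mS2 (@subsetT _ _) intf).
  rewrite oppe_le0 nuE; apply: integral_ge0 => x _.
  by rewrite lee_fin; have /andP[] := H01 x.
(* Truncation alters the derivative only on [S1] and [S2], both null for the law of [Z]. *)
pose c z := Num.min (Num.max (r z) 0) 1.
have c01 z : 0 <= c z <= 1.
  by rewrite /c ge_min lexx orbT andbT le_min le_max lexx orbT ler01.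
have mc : measurable_fun setT c.
  by apply: measurable_minr => //; exact: measurable_maxr.
exists c; split => // B mB.
have bc : bmfun (fun x => c (Z x)).
  apply: bmfun_comp => //; exists 1 => z.
  by have /andP[? ?] := c01 z; rewrite ger0_norm.
apply: EFin_inj.
rewrite -(integral_indicM (mZB _ mB) bH) -(integral_indicM (mZB _ mB) bc).
rewrite -nuE fE//.
transitivity (\int[mu]_(z in B) (c z)%:E)%E.
  apply: ae_eq_integral => //.
  - by apply: measurable_funTS; exact/measurable_EFinP.
  - by apply: measurable_funTS; exact/measurable_EFinP.
  exists (S1 `|` S2); split; first exact: measurableU.
    apply/eqP; rewrite eq_le measure_ge0 andbT.
    have e0 : (mu S1 + mu S2 <= 0)%E by rewrite S10 S20 adde0.
    exact: (le_trans (measureU2 _ mS1 mS2) e0).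
  move=> z /=; apply: contra_notP => /not_orP[]; rewrite /S1 /S2 /=.
  move=> /negP; rewrite -leNgt => r1 /negP; rewrite -leNgt => r0 _.
  by rewrite /c max_l// min_l.
rewrite ge0_integral_pushforward//.
- by apply: measurable_funTS; exact/measurable_EFinP.
- by move=> z _; rewrite lee_fin; have /andP[] := c01 z.
Qed.

(** Conditioning inside [D] without dividing by its probability, which may be 0: [Z] is paired with
    the indicator of [D], and the second coordinate is then frozen at 1. *)
Lemma cond_exp_exists_on d' (U : measurableType d') (Z : T -> U) (H : T -> R) (D : set T) :
  measurable_fun setT Z -> measurable_fun setT H -> (forall x, 0 <= H x <= 1) ->
  measurable D ->
  exists c : U -> R, [/\ measurable_fun setT c, (forall z, 0 <= c z <= 1) &
    forall B, measurable B -> ev (fun x => H x * \1_D x * \1_B (Z x)) =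
                              ev (fun x => c (Z x) * \1_D x * \1_B (Z x))].
Proof.
move=> mZ mH H01 mD.
have mZ' : measurable_fun setT (fun x => (Z x, \1_D x : R)).
  by apply/measurable_fun_pairP; split => //; exact: measurable_indic.
have mHD : measurable_fun setT (fun x => H x * \1_D x).
  by apply: measurable_funM => //; exact: measurable_indic.
have HD01 x : 0 <= H x * \1_D x <= 1.
  have /andP[h0 h1] := H01 x.
  by rewrite indicE; case: (_ \in _); rewrite ?mulr1 ?mulr0 ?h0 ?h1 ?lexx ?ler01.
have [c [mc c01 cE]] := cond_exp_exists mZ' mHD HD01.
exists (fun z => c (z, 1)); split => //.
  by apply: measurableT_comp => //; exact: measurable_pair2.
move=> B mB; have := cE (B `*` [set 1]) (measurableX mB (measurable_set1 1)).
have iE x : \1_(B `*` [set 1]) (Z x, \1_D x : R) = \1_B (Z x) * \1_D x :> R.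
  rewrite !indicE in_setX/= -natrM mulnb; congr (_%:R); congr (_ && _).
  case: (x \in D) => /=; first by rewrite mem_set.
  by apply/negbTE/negP => /set_mem /=; move/eqP; rewrite eq_sym oner_eq0.
under eq_ev do rewrite iE.
under [X in _ = X -> _]eq_ev do rewrite iE.
move=> h; transitivity (ev (fun x => H x * \1_D x * (\1_B (Z x) * \1_D x))).
  by apply: eq_ev => x; rewrite (indicE R D); case: (x \in D); rewrite ?(mulr1, mulr0, mul0r).
by rewrite h; apply: eq_ev => x; rewrite (indicE R D); case: (x \in D); rewrite ?(mulr1, mulr0, mul0r).
Qed.

(** The joint law agrees with the product law on rectangles, hence everywhere, and Tonelli's theorem
    applies. The measurability of the partial expectation is exported because it makes the
    integrated kernels usable as test functions. *)
Lemma indep_fubini d1 d2 (U1 : measurableType d1) (U2 : measurableType d2)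
    (X : T -> U1) (Z : T -> U2) (F : U1 * U2 -> R) :
  measurable_fun setT X -> measurable_fun setT Z ->
  (forall A B, measurable A -> measurable B ->
     P (X @^-1` A `&` Z @^-1` B) = (P (X @^-1` A) * P (Z @^-1` B))%E) ->
  measurable_fun setT F -> (forall z, 0 <= F z <= 1) ->
  measurable_fun setT (fun z => ev (fun x => F (X x, z))) /\
  ev (fun x => F (X x, Z x)) = ev (fun y => ev (fun x => F (X x, Z y))).
Proof.
move=> mX mZ indep mF F01.
have F0 z : (0 <= (EFin \o F) z)%E by rewrite /= lee_fin; have /andP[] := F01 z.
have mEF : measurable_fun setT (EFin \o F) by exact/measurable_EFinP.
have mXZ : measurable_fun setT (fun x => (X x, Z x)).
  by apply/measurable_fun_pairP; split.
pose Xm : {mfun T >-> U1} := HB.pack X (isMeasurableFun.Build _ _ _ _ X mX).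
pose Zm : {mfun T >-> U2} := HB.pack Z (isMeasurableFun.Build _ _ _ _ Z mZ).
pose XZm : {mfun T >-> (U1 * U2)%type} := HB.pack (fun x => (X x, Z x)) (isMeasurableFun.Build _ _ _ _ (fun x => (X x, Z x)) mXZ).
pose m1 := distribution P Xm; pose m2 := distribution P Zm.
pose m := distribution P XZm.
have mE : forall S, measurable S -> (m1 \x m2)%E S = m S.
  apply: product_measure_unique => A B mA mB; exact: indep.
have bF z : bmfun (fun x => F (X x, z)).
  have mp : measurable_fun setT (fun x => (X x, z)).
    by apply/measurable_fun_pairP; split; [exact: mX | exact: measurable_cst].
  split; first exact: (measurableT_comp mF mp).
  by exists 1 => x; have /andP[? ?] := F01 (X x, z); rewrite ger0_norm.
pose G := fubini_G m1 (EFin \o F).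
have GE z : G z = (ev (fun x => F (X x, z)))%:E.
  rewrite /G /fubini_G ge0_integral_pushforward//; last first.
    by apply: measurableT_comp => //; exact: measurable_pair2.
  rewrite /Rintegral fineK ?preimage_setT//.
  by apply: integrable_fin_num => //; exact: bmfun_integrable (bF z).
have mG : measurable_fun setT G by exact: measurable_fun_fubini_tonelli_G.
have mq : measurable_fun setT (fun z => ev (fun x => F (X x, z))).
  by apply/measurable_EFinP; rewrite (_ : _ \o _ = G)//; apply/funext => z /=.
split => //; congr fine.
transitivity (\int[m]_z (EFin \o F) z)%E.
  by rewrite ge0_integral_pushforward.
transitivity (\int[(m1 \x m2)%E]_z (EFin \o F) z)%E.
  by apply: eq_measure_integral => S mS _; ((exact: mE) || (apply/esym; exact: mE)).
rewrite fubini_tonelli2// -/G.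
rewrite ge0_integral_pushforward//.
  by apply: eq_integral => y _ /=; rewrite GE.
by move=> z _; rewrite GE lee_fin Rintegral_ge0// => x _; have /andP[] := F01 (X x, z).
Qed.

(** The centred variable [a x - ev a] is orthogonal to the sets of [Pi], hence to every bounded
    function measurable for the generated sigma-algebra. *)
Lemma indep_fun (Pi : set (set T)) (a f : T -> R) :
  setI_closed Pi -> Pi `<=` measurable -> bmfun a ->
  (forall S, Pi S -> ev (fun x => a x * \1_S x) = ev a * ev \1_S) ->
  (forall B, measurable B -> <<s Pi >> (f @^-1` B)) -> bmfun f ->
  ev (fun x => a x * f x) = ev a * ev f.
Proof.
move=> PiI mPi ba hS mf bf.
have ba' : bmfun (fun x => a x - ev a) by apply: bmfunB => //; exact: bmfun_cst.
have h : ev (fun x => (a x - ev a) * f x) = 0.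
  apply: (sigma_eq0 PiI mPi ba') => //; last by case: bf.
  move=> S [PS|->].
    have bS : bmfun (\1_S : T -> R) by apply: bmfun_indic; exact: mPi.
    under eq_ev do rewrite mulrBl.
    rewrite evB; [|exact: bmfunM|by apply: bmfunM => //; exact: bmfun_cst].
    by rewrite evZ// hS// subrr.
  under eq_ev do rewrite indicT mulr1.
  by rewrite evB// ?ev_cst ?subrr//; exact: bmfun_cst.
move: h; under eq_ev do rewrite mulrBl.
rewrite evB; [|exact: bmfunM|by apply: bmfunM => //; exact: bmfun_cst].
by rewrite evZ// => /eqP; rewrite subr_eq0 => /eqP.
Qed.

Lemma sigma_setI_closed (C : set (set T)) : setI_closed <<s C >>.
Proof.
move=> A B sA sB; exact: (@measurableI _ (g_sigma_algebraType C) A B sA sB).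
Qed.

Lemma sub_sigma_measurable (C : set (set T)) : C `<=` measurable -> <<s C >> `<=` measurable.
Proof. by move=> mC; apply: smallest_sub => //; exact: sigma_algebra_measurable. Qed.

Lemma gmeas_preimage (C : set (set T)) d' (U : measurableType d') (f : T -> U) :
  gmeas C f -> forall B, measurable B -> <<s C >> (f @^-1` B).
Proof.
by move=> mf B mB; have := mf measurableT B mB; rewrite setTI.
Qed.

Lemma gmeas_measurable (C : set (set T)) d' (U : measurableType d') (f : T -> U) :
  C `<=` measurable -> gmeas C f -> measurable_fun setT f.
Proof.
move=> mC mf _ B mB; rewrite setTI; apply: (sub_sigma_measurable mC).
exact: gmeas_preimage mf B mB.
Qed.

Lemma ev_setI (A B : set T) : measurable A -> measurable B ->
  ev (fun x => \1_A x * \1_B x) = fine (P (A `&` B)).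
Proof.
move=> mA mB; rewrite -ev_indic; last exact: measurableI.
by apply: eq_ev => x; rewrite indicI.
Qed.

Lemma indep_evP (A B : set T) : measurable A -> measurable B ->
  P (A `&` B) = (P A * P B)%E <-> ev (fun x => \1_A x * \1_B x) = ev \1_A * ev \1_B.
Proof.
move=> mA mB; rewrite ev_setI// !ev_indic//; split => [->|h].
  by rewrite fineM// fin_num_measure.
rewrite -(fineK (fin_num_measure P A mA)) -(fineK (fin_num_measure P B mB)).
rewrite -EFinM -h fineK// fin_num_measure//; exact: measurableI.
Qed.

Lemma indep_ev (C1 C2 : set (set T)) (f g : T -> R) :
  C1 `<=` measurable -> C2 `<=` measurable ->
  (forall A B, <<s C1 >> A -> <<s C2 >> B -> P (A `&` B) = (P A * P B)%E) ->
  gmeas C1 f -> gmeas C2 g -> bmfun f -> bmfun g ->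
  ev (fun x => f x * g x) = ev f * ev g.
Proof.
move=> m1 m2 ind mf mg bf bg.
have sm1 := sub_sigma_measurable m1; have sm2 := sub_sigma_measurable m2.
have fB B : <<s C2 >> B -> ev (fun x => f x * \1_B x) = ev f * ev \1_B.
  move=> sB; have mB := sm2 _ sB.
  transitivity (ev (fun x => \1_B x * f x)); first by apply: eq_ev => x; rewrite mulrC.
  rewrite [RHS]mulrC; apply: (indep_fun (@sigma_setI_closed C1) sm1) => //.
  - exact: bmfun_indic.
  - move=> S sS; have mS := sm1 _ sS; rewrite [RHS]mulrC.
    transitivity (ev (fun x => \1_S x * \1_B x)); first by apply: eq_ev => x; rewrite mulrC.
    by apply/indep_evP => //; exact: ind.
  - by move=> A mA; apply: sub_sigma_algebra; exact: gmeas_preimage mf A mA.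
apply: (indep_fun (@sigma_setI_closed C2) sm2) => //.
by move=> A mA; apply: sub_sigma_algebra; exact: gmeas_preimage mg A mA.
Qed.

Lemma indep_pi (Pi : set (set T)) (A : set T) : setI_closed Pi -> Pi `<=` measurable ->
  measurable A -> (forall S, Pi S -> P (A `&` S) = (P A * P S)%E) ->
  forall S, <<s Pi >> S -> P (A `&` S) = (P A * P S)%E.
Proof.
move=> PiI mPi mA h S sS; have mS := sub_sigma_measurable mPi sS.
apply/indep_evP => //; apply: (indep_fun PiI mPi) => //.
- exact: bmfun_indic.
- by move=> S' PS'; apply/indep_evP; [|exact: mPi|exact: h].
- by move=> B mB; apply: (@gmeas_preimage Pi _ R \1_S).
- exact: bmfun_indic.
Qed.

Lemma cond_exp_fun d' (U : measurableType d') (Z : T -> U) (H : T -> R) (f : U -> R) :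
  measurable_fun setT Z -> bmfun H -> measurable_fun setT f -> (exists K, forall z, `|f z| <= K) ->
  (forall B, measurable B -> ev (fun x => H x * \1_B (Z x)) = 0) ->
  ev (fun x => H x * f (Z x)) = 0.
Proof.
move=> mZ bH mf [K fK] hB.
pose Pi := [set S | exists2 B, measurable B & S = Z @^-1` B].
apply: (@sigma_eq0 _ _ _ P Pi H (fun x => f (Z x))) => //.
- move=> _ _ [B mB ->] [B' mB' ->]; exists (B `&` B'); first exact: measurableI.
  by rewrite preimage_setI.
- by move=> _ [B mB ->]; rewrite -[X in measurable X]setTI; exact: mZ.
- move=> S [[B mB ->]|->]; first exact: hB.
  by rewrite -[RHS](hB setT measurableT); apply: eq_ev => x; rewrite !indicE !in_setT.
- move=> B mB; apply: sub_sigma_algebra; exists (f @^-1` B) => //.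
  by have := mf measurableT B mB; rewrite setTI.
- by exists K => x.
Qed.

End independence.

(** * Generating classes and evaluation at random times *)

Section generators.
Context {d : measure_display} {T : measurableType d} {R : realType}.

(** Finite intersections in right-nested form: an induction removes one generator at a time, which
    lets its indicator be traded for an exponential weight. *)
Inductive piclos (C : set (set T)) : set (set T) :=
| piclosT : piclos C setT
| piclosI A B : C A -> piclos C B -> piclos C (A `&` B).

Lemma piclos_setI_closed (C : set (set T)) : setI_closed (piclos C).
Proof.
move=> A B; elim=> [|A1 A2 CA1 _ IH] pB; first by rewrite setTI.
by rewrite -setIA; apply: piclosI => //; exact: IH.
Qed.

Lemma sub_piclos (C : set (set T)) : C `<=` piclos C.
Proof. by move=> A CA; rewrite -(setIT A); apply: piclosI => //; exact: piclosT. Qed.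

Lemma piclos_sigma (C : set (set T)) : piclos C `<=` <<s C >>.
Proof.
move=> A; elim=> [|A1 A2 CA1 _ IH].
  exact: (@measurableT _ (g_sigma_algebraType C)).
by apply: sigma_setI_closed => //; exact: sub_sigma_algebra.
Qed.

Lemma sigma_piclos (C : set (set T)) : <<s C >> `<=` <<s piclos C >>.
Proof. by apply: sub_smallest2r; [exact: smallest_sigma_algebra | exact: sub_piclos]. Qed.

(** The class inside [gen_sigma], before closure: [gen_sigma J X] unfolds to the sigma-algebra
    generated by [gen J X]. *)
Definition gen (I : Type) (J : set I) (X : I -> T -> R) : set (set T) :=
  [set A | exists i, J i /\ exists B : set R, measurable B /\ A = X i @^-1` B].

Lemma gen_measurable (I : Type) (J : set I) (X : I -> T -> R) :
  (forall i, J i -> measurable_fun setT (X i)) -> gen J X `<=` measurable.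
Proof.
move=> mX _ [i [Ji [B [mB ->]]]]; rewrite -[X in measurable X]setTI.
exact: mX.
Qed.

Lemma gmeas_gen (I : Type) (J : set I) (X : I -> T -> R) i : J i -> gmeas (gen J X) (X i).
Proof.
move=> Ji _ B mB; rewrite setTI; apply: sub_sigma_algebra.
by exists i; split => //; exists B.
Qed.

Lemma gmeas_sub (C C' : set (set T)) d' (U : measurableType d') (f : T -> U) :
  C `<=` <<s C' >> -> gmeas C f -> gmeas C' f.
Proof.
move=> CC' mf _ B mB; rewrite setTI.
have := gmeas_preimage mf mB; apply: smallest_sub => //.
exact: smallest_sigma_algebra.
Qed.

Lemma gmeas_indic_comp (C : set (set T)) d' (U : measurableType d') (X : T -> U) (B : set U) :
  gmeas C X -> measurable B -> gmeas C (fun x => (\1_B (X x) : R)).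
Proof.
move=> mX mB; exact: (proj1 (@bmfun_indic_comp _ (g_sigma_algebraType C) R _ U B X mX mB)).
Qed.

(** The inverse is [x] times [|x|^-2], the latter written with [expR] and [ln]; at 0 both sides are
    0 by the convention for the inverse. *)
Lemma measurable_inv : measurable_fun setT (fun x : R => x^-1).
Proof.
have -> : (fun x : R => x^-1) = (fun x => x * expR (- (2 * ln `|x|))).
  apply/funext => x; have [->|x0] := eqVneq x 0; first by rewrite mul0r invr0.
  have ax : 0 < `|x| by rewrite normr_gt0.
  rewrite expRN mulr_natl mulr2n expRD lnK ?posrE// -[`|x| * `|x|]expr2 real_normK ?num_real//.
  by field.
apply: measurable_funM => //; apply: measurableT_comp => //.
apply: measurable_funN; apply: measurable_funM => //.
by apply: measurableT_comp; [exact: measurable_ln|exact: normr_measurable].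
Qed.

Lemma measurable_fun_div d' (U : measurableType d') (f g : U -> R) :
  measurable_fun setT f -> measurable_fun setT g ->
  measurable_fun setT (fun x => f x / g x).
Proof.
move=> mf mg; apply: measurable_funM => //.
exact: (measurableT_comp measurable_inv).
Qed.

(** The random time is approximated by times with countably many values, where measurability is
    checked piece by piece. Only times from [s] on are evaluated, so the sigma-algebra on [U] may be
    one that sees nothing but increments after [s]. *)
Lemma measurable_right_cont d' (U : measurableType d') (X : R -> U -> R) (s : R) (rho : U -> R) :
  (forall v, s <= v -> measurable_fun setT (X v)) ->
  (forall w v, s <= v -> X r w @[r --> v^'+] --> X v w) ->
  measurable_fun setT rho -> (forall w, s <= rho w) ->
  measurable_fun setT (fun w => X (rho w) w).
Proof.
move=> mX rcX mrho srho.
pose y (n : nat) w := n.+1%:R * (rho w - s).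
have y0 n w : 0 <= y n w by rewrite mulr_ge0// subr_ge0.
(* The successor puts the grid time strictly above [rho w], as the limit from the right requires,
   and within one mesh of it. *)
pose r n w := s + (Num.truncn (y n w)).+1%:R / n.+1%:R.
have r_gt n w : rho w < r n w.
  rewrite /r -ltrBlDl ltr_pdivlMr// mulrC; exact: truncnS_gt.
have r_le n w : r n w <= rho w + n.+1%:R^-1.
  rewrite /r -natr1 mulrDl mul1r addrA lerD2r -lerBrDl ler_pdivrMr// mulrC.
  by rewrite truncn_le.
apply: (@measurable_fun_cvg _ U R setT (fun n w => X (r n w) w)).
  move=> n _ B mB; rewrite setTI.
  have my : measurable_fun setT (y n).
    by apply: measurable_funM => //; exact: measurable_funB.
  have -> : (fun w => X (r n w) w) @^-1` B =
    \bigcup_k ((y n @^-1` `[k%:R, k.+1%:R[) `&` (X (s + k.+1%:R / n.+1%:R) @^-1` B)).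
    apply/seteqP; split => w /=.
      move=> Bw; exists (Num.truncn (y n w)) => //; split => //=.
      by rewrite in_itv/=; exact: truncn_itv.
    move=> [k _ [/=]]; rewrite in_itv/= => kk.
    by rewrite /r (truncn_def kk).
  apply: bigcupT_measurable => k; apply: measurableI.
    by rewrite -[X in measurable X]setTI; exact: my.
  rewrite -[X in measurable X]setTI; apply: mX => //.
  by rewrite lerDl divr_ge0.
move=> w _; have := rcX w (rho w) (srho w).
move=> /cvg_at_rightP /(_ (fun n => r n w)); apply; split; first by move=> n; exact: r_gt.
apply: (@squeeze_cvgr _ _ _ _ (fun=> rho w) (fun n => rho w + n.+1%:R^-1)).
- by apply: nearW => n; rewrite (ltW (r_gt _ _)) r_le.
- exact: cvg_cst.
- rewrite -[X in _ --> X]addr0; apply: cvgD; first exact: cvg_cst.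
  exact: cvg_harmonic.
Qed.

End generators.

(** * Total variation cost of rescaling a gamma variable *)

Section gamma_scaling.
Context {d : measure_display} {T : measurableType d} {R : realType}.
Context (P : probability T R).
Notation ev f := (Rintegral P setT f).

(** A function with values in [[0, 1]] is, up to [1 / k], the average of the indicators of [k] of
    its level sets, so it separates two laws no better than sets do. *)
Lemma level_set_bound (X X' : T -> R) (Psi : R -> R) (dl : R) :
  measurable_fun setT X -> measurable_fun setT X' -> measurable_fun setT Psi ->
  (forall x, 0 <= Psi x <= 1) ->
  (forall B, measurable B -> `|ev (fun x => \1_B (X x)) - ev (fun x => \1_B (X' x))| <= dl) ->
  `|ev (fun x => Psi (X x)) - ev (fun x => Psi (X' x))| <= dl.
Proof.
move=> mX mX' mPsi Psi01 hB.
have bP (Y : T -> R) : measurable_fun setT Y -> bmfun (fun x => Psi (Y x)).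
  move=> mY; apply: bmfun_comp => //; exists 1 => x.
  by have /andP[? ?] := Psi01 x; rewrite ger0_norm.
pose S k j := [set x | j.+1%:R <= Psi x * k%:R].
have mS k j : measurable (S k j).
  have mk : measurable_fun setT (fun x => Psi x * k%:R).
    by apply: measurable_funM => //; exact: measurable_cst.
  have := mk measurableT _ (measurable_itv `[j.+1%:R, +oo[); rewrite setTI.
  by rewrite (_ : _ @^-1` _ = S k j)//; apply/seteqP; split => x; rewrite /S /= in_itv/= andbT.
pose s k m x := \sum_(j < m) (\1_(S k j) x : R).
have bs (Y : T -> R) k m : measurable_fun setT Y -> bmfun (fun x => s k m (Y x)).
  move=> mY; rewrite /s; elim: m => [|m IH].
    by under eq_fun do rewrite big_ord0; exact: bmfun_cst.
  by under eq_fun do rewrite big_ord_recr/=; apply: bmfunD => //; exact: bmfun_indic_comp.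
have hs k m : `|ev (fun x => s k m (X x)) - ev (fun x => s k m (X' x))| <= m%:R * dl.
  elim: m => [|m IH].
    rewrite /s; under eq_ev do rewrite big_ord0.
    under [X in _ - X]eq_ev do rewrite big_ord0.
    by rewrite subrr normr0 mul0r.
  have E (Y : T -> R) : measurable_fun setT Y ->
     ev (fun x => s k m.+1 (Y x)) = ev (fun x => s k m (Y x)) + ev (fun x => \1_(S k m) (Y x)).
    move=> mY; rewrite -evD; [|exact: bs|exact: bmfun_indic_comp].
    by apply: eq_ev => x; rewrite /s big_ord_recr.
  rewrite !E// -natr1 mulrDl mul1r.
  rewrite (_ : _ - _ = (ev (fun x => s k m (X x)) - ev (fun x => s k m (X' x))) +
    (ev (fun x => \1_(S k m) (X x)) - ev (fun x => \1_(S k m) (X' x)))); last by ring.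
  by rewrite (le_trans (ler_normD _ _))// lerD// hB.
have key k : (0 < k)%N -> `|ev (fun x => Psi (X x)) - ev (fun x => Psi (X' x))| <= dl + 2 / k%:R.
  move=> k0; have kR : 0 < k%:R :> R by rewrite ltr0n.
  have near1 (Y : T -> R) : measurable_fun setT Y ->
      `|k%:R * ev (fun x => Psi (Y x)) - ev (fun x => s k k (Y x))| <= 1.
    move=> mY; rewrite -evZ; last exact: bP.
    have b1 : bmfun (fun x => k%:R * Psi (Y x)) by apply: bmfunM; [exact: bmfun_cst | exact: bP].
    rewrite -evB//; last exact: bs.
    apply: norm_ev_le; first by have [] := bmfunB b1 (bs Y k k mY).
    move=> x; rewrite mulrC; apply: (@floor_sum_dist R).
    have /andP[p0 p1] := Psi01 (Y x).
    by rewrite mulr_ge0//= ler_piMl.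
  rewrite -(ler_pM2l kR) -[k%:R in leLHS]gtr0_norm// -normrM [leRHS]mulrDr.
  rewrite (_ : k%:R * (2 / k%:R) = 2); last by field; rewrite gt_eqF.
  rewrite mulrBr (_ : _ - _ =
     (k%:R * ev (fun x => Psi (X x)) - ev (fun x => s k k (X x))) -
     (k%:R * ev (fun x => Psi (X' x)) - ev (fun x => s k k (X' x))) +
     (ev (fun x => s k k (X x)) - ev (fun x => s k k (X' x)))); last by ring.
  rewrite (le_trans (ler_normD _ _))// addrC lerD//.
  by rewrite (le_trans (ler_normB _ _))// (_ : 2 = 1 + 1)// lerD// near1.
apply/ler_addgt0Pr => e e0.
have [k k0 ke] : exists2 k, (0 < k)%N & 2 / k%:R <= e.
  exists (Num.truncn (2 / e)).+1 => //.
  by rewrite ler_pdivrMr// mulrC -ler_pdivrMr// ltW// truncnS_gt.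
by rewrite (le_trans (key k k0))// lerD2l.
Qed.

(* The Esscher density of X / C with respect to X is C^a exp(-(C - 1) X) <= C^a. *)
Lemma gamma_scale_bound (X : T -> R) (a C : R) (Psi : R -> R) :
  measurable_fun setT X -> (forall x, 0 <= X x) -> 0 <= a -> 1 <= C ->
  (forall l, 0 <= l -> ev (fun x => expR (- (l * X x))) = (1 + l) `^ (- a)) ->
  measurable_fun setT Psi -> (forall x, 0 <= Psi x <= 1) ->
  `|ev (fun x => Psi (X x / C)) - ev (fun x => Psi (X x))| <= C `^ a - 1.
Proof.
move=> mX X0 a0 C1 hL mPsi Psi01.
have C0 : 0 < C by lra.
have mXC : measurable_fun setT (fun x => X x / C).
  by apply: measurable_funM => //; exact: measurable_cst.
have Ca : 1 <= C `^ a by rewrite -(powRr0 C) ler_powR.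
have esscher B : measurable B -> ev (fun x => 1 * \1_B (X x / C)) =
    ev (fun x => C `^ a * expR (- ((C - 1) * X x)) * \1_B (X x)).
  move=> mB.
  have be := bmfun_expN (_ : 0 <= C - 1) mX X0.
  apply: (laplace_unique mXC mX _ X0 _ _ _ mB).
  - by move=> x; rewrite divr_ge0// ltW.
  - exact: bmfun_cst.
  - by apply: bmfunM; [exact: bmfun_cst | apply: be; lra].
  move=> l l0.
  transitivity (ev (fun x => expR (- (l / C * X x)))).
    by apply: eq_ev => x; rewrite mul1r; congr (expR (- _)); ring.
  transitivity (ev (fun x => C `^ a * expR (- ((C - 1 + l) * X x)))); last first.
    apply: eq_ev => x; rewrite -mulrA -expRD; congr (_ * expR _); ring.
  rewrite evZ; last by apply: bmfun_expN => //; lra.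
  rewrite !hL; [|lra|by rewrite divr_ge0// ltW].
  (* This factorisation identifies the Laplace transform of [X / C] with that of the tilted law. *)
  rewrite (_ : 1 + (C - 1 + l) = C * (1 + l / C)); last by field; rewrite gt_eqF.
  rewrite powRM; [|lra|by rewrite addr_ge0// divr_ge0// ltW].
  by rewrite mulrA -powRD ?subrr ?powRr0 ?mul1r//; apply/implyP => _; rewrite gt_eqF.
apply: level_set_bound => // B mB.
have le1 A : measurable A -> ev (fun x => \1_A (X x / C)) <= C `^ a * ev (fun x => \1_A (X x)).
  move=> mA; have := esscher A mA; under eq_ev do rewrite mul1r.
  move=> ->; rewrite -evZ; last exact: bmfun_indic_comp.
  apply: le_ev.
  - apply: bmfunM; last exact: bmfun_indic_comp.
    by apply: bmfunM; [exact: bmfun_cst | apply: bmfun_expN => //; lra].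
  - by apply: bmfunM; [exact: bmfun_cst | exact: bmfun_indic_comp].
  - move=> x; apply: ler_wpM2r => //; rewrite ler_piMr ?powR_ge0//.
    by rewrite expR_le1 oppr_le0 mulr_ge0// subr_ge0.
have compl (Y : T -> R) A : measurable_fun setT Y -> measurable A ->
    ev (fun x => \1_(~` A) (Y x)) = 1 - ev (fun x => \1_A (Y x)).
  move=> mY mA; rewrite -[1](ev_cst P) -evB; [|exact: bmfun_cst|exact: bmfun_indic_comp].
  by apply: eq_ev => x; rewrite !indicE in_setC; case: (_ \in _); rewrite /= ?subrr ?subr0.
have p1 (Y : T -> R) A : measurable_fun setT Y -> measurable A -> ev (fun x => \1_A (Y x)) <= 1.
  move=> mY mA; rewrite -[leRHS](ev_cst P); apply: le_ev; [exact: bmfun_indic_comp|exact: bmfun_cst|].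
  by move=> x; rewrite indicE; case: (_ \in _).
(* The density bound is one-sided; applied to the complement of [B] it gives the other side. *)
have h1 := le1 B mB; have h2 := le1 _ (measurableC mB).
rewrite !compl// in h2.
have q1 := p1 _ _ mX mB.
have q0 : 0 <= ev (fun x => \1_B (X x)) by apply: Rintegral_ge0 => x _.
rewrite ler_norml; apply/andP; split; nra.
Qed.

(** For [n < 1] the roles are exchanged: the bound with factor [n^-1] is applied to [Psi]
    precomposed with division by [n]. *)
Lemma gamma_scale_bound2 (X : T -> R) (a n : R) (Psi : R -> R) :
  measurable_fun setT X -> (forall x, 0 <= X x) -> 0 <= a -> 0 < n ->
  (forall l, 0 <= l -> ev (fun x => expR (- (l * X x))) = (1 + l) `^ (- a)) ->
  measurable_fun setT Psi -> (forall x, 0 <= Psi x <= 1) ->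
  `|ev (fun x => Psi (X x / n)) - ev (fun x => Psi (X x))| <=
    Num.max n n^-1 `^ a - 1.
Proof.
move=> mX X0 a0 n0 hL mPsi Psi01.
have [n1|n1] := leP 1 n.
  have -> : Num.max n n^-1 = n by apply: max_l; rewrite (le_trans _ n1)// invf_le1.
  exact: gamma_scale_bound.
have -> : Num.max n n^-1 = n^-1 by apply: max_r; rewrite (le_trans (ltW n1))// invf_ge1// ltW.
have mPn : measurable_fun setT (fun y : R => Psi (y / n)).
  by apply: measurableT_comp => //; apply: measurable_funM => //; exact: measurable_cst.
have n1' : 1 <= n^-1 by rewrite invf_ge1// ltW.
have := gamma_scale_bound mX X0 a0 n1' hL mPn (fun y : R => Psi01 (y / n)).
rewrite distrC; apply: le_trans; rewrite le_eqVlt; apply/orP; left; apply/eqP.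
congr (`|_ - _|); apply: eq_ev => x; congr Psi.
by rewrite invrK mulfK// gt_eqF.
Qed.

End gamma_scaling.

(** * Values in the unit interval and limits of ray indicators *)

Section unit_interval.
Context {R : realType}.

(** [indep_fubini] wants integrands in [[0, 1]] on the whole product space; clamping a coordinate
    achieves this and is the identity on the values actually taken. *)
Definition clamp01 (k : R) : R := Num.min (Num.max k 0) 1.

Lemma clamp01_itv (k : R) : 0 <= clamp01 k <= 1.
Proof. by rewrite /clamp01 ge_min lexx orbT andbT le_min le_max lexx orbT ler01. Qed.

Lemma clamp01E (k : R) : 0 <= k <= 1 -> clamp01 k = k.
Proof. by move=> /andP[k0 k1]; rewrite /clamp01 max_l// min_l. Qed.

Lemma measurable_clamp01 : measurable_fun setT clamp01.
Proof.
by apply: measurable_minr => //; apply: measurable_maxr => //; exact: measurable_id.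
Qed.

Lemma mul01 (a b : R) : 0 <= a <= 1 -> 0 <= b <= 1 -> 0 <= a * b <= 1.
Proof. by move=> /andP[a0 a1] /andP[b0 b1]; rewrite mulr_ge0//= mulr_ile1. Qed.

Lemma indic01 (U : Type) (A : set U) x : 0 <= (\1_A x : R) <= 1.
Proof. by rewrite indicE; case: (_ \in _); rewrite ?lexx ?ler01. Qed.

Lemma dist01 (a b : R) : 0 <= a <= 1 -> 0 <= b <= 1 -> `|a - b| <= 1.
Proof. by move=> /andP[? ?] /andP[? ?]; rewrite ler_norml; apply/andP; split; lra. Qed.

Lemma norm_err (c D : R) : 0 <= c -> 0 <= D <= 1 -> `|D * Num.min 1 (c - 1)| <= 1.
Proof.
move=> c0 /andP[D0 D1]; rewrite normrM mulr_ile1//; first by rewrite ger0_norm.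
rewrite ler_norml le_min ge_min lexx /= andbT; lra.
Qed.

Lemma powR_ge1 (c a : R) : 1 <= c -> 0 <= a -> 1 <= c `^ a.
Proof.
move=> c1 a0; have c0 : 0 <= c by exact: le_trans c1.
have := @ge0_ler_powR R a a0 1 c; rewrite !nnegrE ler01 powR1.
by move=> /(_ isT c0 c1).
Qed.

Lemma cvg_near_eq (x y : nat -> R) (l : R) :
  (\forall n \near \oo, x n = y n) -> y @ \oo --> l -> x @ \oo --> l.
Proof.
move=> xy yl; apply: cvg_trans yl; apply: near_eq_cvg.
by apply: filterS xy => n ->.
Qed.

(* One-sided approach keeps the indicator continuous even when the limit is the endpoint. *)
Lemma indic_lt_cvg (xn : nat -> R) (l x : R) : xn @ \oo --> l ->
  (\forall n \near \oo, l <= xn n) ->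
  (fun n => \1_[set z | z < x] (xn n) : R) @ \oo --> (\1_[set z | z < x] l : R).
Proof.
move=> xl lx; rewrite [X in _ --> X]indicE; have [lt|ge] := ltP l x.
  rewrite mem_set//; apply: (@cvg_near_eq _ (fun=> 1)); last exact: cvg_cst.
  have h : \forall n \near \oo, xn n < x by apply: (cvgr_lt _ xl).
  by apply: filterS h => n hn; rewrite indicE mem_set.
rewrite memNset; last by move=> /=; rewrite ltNge ge.
apply: (@cvg_near_eq _ (fun=> 0)); last exact: cvg_cst.
apply: filterS lx => n hn; rewrite indicE memNset//= ltNge.
by rewrite (le_trans ge hn).
Qed.

Lemma indic_gt_cvg (xn : nat -> R) (l x : R) : xn @ \oo --> l ->
  (\forall n \near \oo, xn n <= l) ->
  (fun n => \1_[set z | x < z] (xn n) : R) @ \oo --> (\1_[set z | x < z] l : R).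
Proof.
move=> xl lx; rewrite [X in _ --> X]indicE; have [lt|ge] := ltP x l.
  rewrite mem_set//; apply: (@cvg_near_eq _ (fun=> 1)); last exact: cvg_cst.
  have h : \forall n \near \oo, x < xn n by apply: (cvgr_gt _ xl).
  by apply: filterS h => n hn; rewrite indicE mem_set.
rewrite memNset; last by move=> /=; rewrite ltNge ge.
apply: (@cvg_near_eq _ (fun=> 0)); last exact: cvg_cst.
apply: filterS lx => n hn; rewrite indicE memNset//= ltNge.
by rewrite (le_trans hn ge).
Qed.

End unit_interval.

(** * The gamma process: independence of past and future *)

Section gamma_process.
Context {d : measure_display} {T : measurableType d} {R : realType}.
Context (P : probability T R) (gamma : R -> T -> R) (tau : T -> R).
Notation ev f := (Rintegral P setT f).
Implicit Types (s t v r th : R) (l : seq (R * R)).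

Context (mg : forall t, 0 <= t -> measurable_fun setT (gamma t)).
Context (g0 : forall w, gamma 0 w = 0).
Context (gmono : forall w s t, 0 <= s <= t -> gamma s w <= gamma t w).
Context (gind : forall s t, 0 <= s <= t ->
     indep_sigma P (gen_sigma [set r | 0 <= r <= s] gamma)
                   (gen_sigma [set tt] (fun _ x => gamma t x - gamma s x))).
Context (glap : forall s t lam, 0 <= s <= t -> 0 <= lam ->
     (\int[P]_x (expR (- (lam * (gamma t x - gamma s x))))%:E
      = ((1 + lam) `^ (- (t - s)))%:E)%E).
Context (mtau : measurable_fun setT tau).
Context (tind : indep_sigma P (gen_sigma [set tt] (fun _ => tau))
                (gen_sigma [set r | 0 <= r] gamma)).

Definition past (s : R) : set (set T) := gen [set r | 0 <= r <= s] gamma.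

(** The index [None] stands for [tau]: the lifetime is counted in the future at every [s], so that
    increments stopped at [tau] are functions of the future. *)
Definition future (s : R) : set (set T) :=
  gen [set i | if i is Some v then s <= v else True]
      (fun i w => if i is Some v then gamma v w - gamma s w else tau w).

Lemma incr_ge0 s t w : 0 <= s <= t -> 0 <= gamma t w - gamma s w.
Proof. by move=> st; rewrite subr_ge0 gmono. Qed.

Lemma gamma_ge0 t w : 0 <= t -> 0 <= gamma t w.
Proof. by move=> t0; rewrite -(g0 w) gmono// lexx. Qed.

Lemma measurable_incr s t : 0 <= s -> 0 <= t ->
  measurable_fun setT (fun x => gamma t x - gamma s x).
Proof. by move=> s0 t0; apply: measurable_funB; exact: mg. Qed.

Lemma ev_lap s t lam : 0 <= s <= t -> 0 <= lam ->
  ev (fun x => expR (- (lam * (gamma t x - gamma s x)))) = (1 + lam) `^ (- (t - s)).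
Proof. by move=> st l0; rewrite /Rintegral glap. Qed.

Lemma past_measurable s : past s `<=` measurable.
Proof. by apply: gen_measurable => r /= /andP[r0 _]; exact: mg. Qed.

Lemma future_measurable s : 0 <= s -> future s `<=` measurable.
Proof.
move=> s0; apply: gen_measurable => -[v|]//= sv.
by apply: measurable_incr => //; exact: le_trans sv.
Qed.

Lemma gmeas_past s r : 0 <= r <= s -> gmeas (past s) (gamma r).
Proof. by move=> rs; exact: (@gmeas_gen _ _ _ _ [set r | 0 <= r <= s] gamma r). Qed.

Lemma past_sub s s' : s <= s' -> past s `<=` <<s past s' >>.
Proof.
move=> ss' _ [r [/= /andP[r0 rs] [B [mB ->]]]]; apply: sub_sigma_algebra.
by exists r; split => /=; [rewrite r0 (le_trans rs) | exists B].
Qed.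

Lemma gmeas_future_incr s v : s <= v -> gmeas (future s) (fun w => gamma v w - gamma s w).
Proof.
move=> sv; exact: (@gmeas_gen _ _ _ _ [set i | if i is Some v then s <= v else True]
  (fun i w => if i is Some v then gamma v w - gamma s w else tau w) (Some v)).
Qed.

Lemma gmeas_future_tau s : gmeas (future s) tau.
Proof.
exact: (@gmeas_gen _ _ _ _ [set i | if i is Some v then s <= v else True]
  (fun i w => if i is Some v then gamma v w - gamma s w else tau w) None I).
Qed.

Lemma lap_peel s v th (Y : T -> R) : 0 <= s <= v -> 0 <= th ->
  gmeas (past s) Y -> bmfun Y ->
  ev (fun x => Y x * expR (- (th * (gamma v x - gamma s x)))) =
  ev Y * (1 + th) `^ (- (v - s)).
Proof.
move=> sv th0 mY bY; have /andP[s0 sv'] := sv.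
have v0 : 0 <= v by exact: le_trans sv'.
rewrite -(ev_lap sv th0).
pose C2 := gen [set tt] (fun _ x => gamma v x - gamma s x).
have mC2 : C2 `<=` measurable by apply: gen_measurable => _ _; exact: measurable_incr.
apply: (indep_ev (@past_measurable s) mC2 (gind sv)) => //.
- apply: measurableT_comp => //; apply: measurable_funN; apply: measurable_funM => //.
  exact: (@gmeas_gen _ _ _ _ [set tt] (fun _ x => gamma v x - gamma s x) tt).
- by apply: bmfun_expN => //; [exact: measurable_incr | move=> x; exact: incr_ge0].
Qed.

Definition Lap (s : R) (l : seq (R * R)) (w : T) : R :=
  expR (- \sum_(p <- l) p.2 * (gamma p.1 w - gamma s w)).

Fixpoint chain (s v : R) (l : seq (R * R)) : bool :=
  if l is p :: l' then [&& p.1 <= v, 0 <= p.2 & chain s p.1 l'] else s <= v.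

(* [lapK s th v l] is the value of E exp(- th (gamma v - gamma s)) [Lap s l] along
   a list of times decreasing from [v] to [s]: the weights accumulate in [th]. *)
Fixpoint lapK (s th v : R) (l : seq (R * R)) : R :=
  if l is p :: l' then (1 + th) `^ (- (v - p.1)) * lapK s (th + p.2) p.1 l'
  else (1 + th) `^ (- (v - s)).

Lemma Lap_nil s w : Lap s [::] w = 1.
Proof. by rewrite /Lap big_nil oppr0 expR0. Qed.

Lemma Lap_cons s p l w :
  Lap s (p :: l) w = expR (- (p.2 * (gamma p.1 w - gamma s w))) * Lap s l w.
Proof. by rewrite /Lap big_cons opprD expRD. Qed.

Lemma Lap_perm s l l' w : perm_eq l l' -> Lap s l w = Lap s l' w.
Proof. by move=> ll'; rewrite /Lap (perm_big _ ll'). Qed.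

Lemma chain_le s v l : chain s v l -> s <= v.
Proof.
elim: l v => [//|p l IH] v /= /and3P[pv _ /IH sp]; exact: le_trans pv.
Qed.

Lemma chain_all s v l : chain s v l ->
  all (fun p => [&& s <= p.1, p.1 <= v & 0 <= p.2]) l.
Proof.
elim: l v => [//|p l IH] v /= /and3P[pv p0 c]; rewrite (chain_le c) pv p0 /=.
by apply: sub_all (IH _ c) => q /and3P[-> qp ->]; rewrite (le_trans qp).
Qed.

Lemma sorted_chain s v l : s <= v ->
  sorted (fun a b : R * R => b.1 <= a.1) l ->
  all (fun p => [&& s <= p.1, p.1 <= v & 0 <= p.2]) l -> chain s v l.
Proof.
elim: l v => [//|p l IH] v sv /= pl /andP[/and3P[sp pv p0] al].
rewrite pv p0/=; apply: IH => //; first exact: path_sorted pl.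
have tr : transitive (fun a b : R * R => b.1 <= a.1).
  by move=> a b c ab bc; exact: le_trans bc ab.
have /allP pm := order_path_min tr pl.
apply/allP => q ql; have /and3P[-> _ ->] := allP al _ ql.
by rewrite (pm _ ql).
Qed.

Lemma chain_sort s v l : s <= v ->
  all (fun p => [&& s <= p.1, p.1 <= v & 0 <= p.2]) l ->
  chain s v (sort (fun a b : R * R => b.1 <= a.1) l).
Proof.
move=> sv al; apply: sorted_chain => //; last by rewrite all_sort.
by apply: sort_sorted => a b; exact: le_total.
Qed.

Lemma gmeas_Lap s v l : 0 <= s <= v ->
  all (fun p => [&& s <= p.1, p.1 <= v & 0 <= p.2]) l -> gmeas (past v) (Lap s l).
Proof.
move=> /andP[s0 sv]; elim: l => [_|p l IH /= /andP[/and3P[sp pv p0] al]].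
  by rewrite (_ : Lap s [::] = fun=> 1)//; apply/funext => w; exact: Lap_nil.
rewrite (_ : Lap s (p :: l) = (fun w => expR (- (p.2 * (gamma p.1 w - gamma s w))) * Lap s l w)); last first.
  by apply/funext => w; exact: Lap_cons.
apply: measurable_funM; last exact: IH.
apply: measurableT_comp => //; apply: measurable_funN; apply: measurable_funM => //.
apply: measurable_funB; apply: gmeas_past; last by rewrite s0.
by rewrite pv (le_trans s0).
Qed.

Lemma bmfun_Lap s l : 0 <= s ->
  all (fun p => (s <= p.1) && (0 <= p.2)) l -> bmfun (Lap s l).
Proof.
move=> s0; elim: l => [_|p l IH /= /andP[/andP[sp p0] al]].
  by rewrite (_ : Lap s [::] = fun=> 1); [exact: bmfun_cst|apply/funext => w; exact: Lap_nil].
rewrite (_ : Lap s (p :: l) = (fun w => expR (- (p.2 * (gamma p.1 w - gamma s w))) * Lap s l w)); last first.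
  by apply/funext => w; exact: Lap_cons.
apply: bmfunM; last exact: IH.
apply: bmfun_expN => //.
  by apply: measurable_incr => //; exact: le_trans sp.
by move=> x; apply: incr_ge0; rewrite s0.
Qed.

Lemma all_weak s v (l : seq (R * R)) : all (fun p => [&& s <= p.1, p.1 <= v & 0 <= p.2]) l ->
  all (fun p => (s <= p.1) && (0 <= p.2)) l.
Proof. by apply: sub_all => p /and3P[-> _ ->]. Qed.

(** The increment from the latest listed time [p.1] to [v] is independent of the other factors,
    which are known at [p.1]; integrating it out leaves the weight [th + p.2] on the next
    stretch. *)
Lemma ev_past_Lap s th v l (Y : T -> R) : 0 <= s -> chain s v l -> 0 <= th ->
  gmeas (past s) Y -> bmfun Y ->
  ev (fun x => Y x * expR (- (th * (gamma v x - gamma s x))) * Lap s l x) =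
  ev Y * lapK s th v l.
Proof.
move=> s0; elim: l th v => [|p l IH] th v.
  move=> /= sv th0 mY bY; have sv' : 0 <= s <= v by rewrite s0.
  rewrite -(lap_peel sv' th0 mY bY).
  by apply: eq_ev => x; rewrite Lap_nil mulr1.
move=> /= /and3P[pv p0 c] th0 mY bY.
have sp := chain_le c; have p10 : 0 <= p.1 by exact: le_trans sp.
have thp : 0 <= th + p.2 by rewrite addr_ge0.
have al := chain_all c.
pose Z x := Y x * expR (- ((th + p.2) * (gamma p.1 x - gamma s x))) * Lap s l x.
transitivity (ev (fun x => Z x * expR (- (th * (gamma v x - gamma p.1 x))))).
  apply: eq_ev => x; rewrite Lap_cons /Z.
  have e : expR (- (th * (gamma v x - gamma s x))) * expR (- (p.2 * (gamma p.1 x - gamma s x))) =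
    expR (- ((th + p.2) * (gamma p.1 x - gamma s x))) * expR (- (th * (gamma v x - gamma p.1 x))).
    by rewrite -!expRD; congr expR; ring.
  by rewrite mulrA -[Y x * _ * _]mulrA e; ring.
have pv' : 0 <= p.1 <= v by rewrite p10.
rewrite (lap_peel pv' th0); last 2 first.
- apply: measurable_funM; last by apply: gmeas_Lap => //; rewrite s0.
  apply: measurable_funM; first exact: gmeas_sub (past_sub sp) mY.
  apply: measurableT_comp => //; apply: measurable_funN; apply: measurable_funM => //.
  by apply: measurable_funB; apply: gmeas_past; rewrite ?s0 ?p10 ?lexx.
- apply: bmfunM; last by apply: bmfun_Lap => //; exact: all_weak al.
  apply: bmfunM => //; apply: bmfun_expN => //; first exact: measurable_incr.
  by move=> x; apply: incr_ge0; rewrite s0.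
by rewrite /Z (IH _ _ c thp mY bY) mulrAC mulrA.
Qed.

(** The constant is chosen before [Y]: this is independence from the past at the level of Laplace
    functionals. Sorting the list reduces to a chain, since [Lap] is symmetric in it. *)
Lemma ev_past_Lap_fact s l : 0 <= s -> all (fun p => (s <= p.1) && (0 <= p.2)) l ->
  exists k, forall Y : T -> R, gmeas (past s) Y -> bmfun Y ->
    ev (fun x => Y x * Lap s l x) = ev Y * k.
Proof.
move=> s0 al.
have [v sv alv] : exists2 v, s <= v & all (fun p => [&& s <= p.1, p.1 <= v & 0 <= p.2]) l.
  elim: l al => [|p l IH] /=; first by exists s.
  move=> /andP[/andP[sp p0] /IH[v sv av]]; exists (Num.max v p.1).
    by rewrite le_max sv.
  rewrite sp p0 le_max lexx orbT /=; apply: sub_all av => q /and3P[-> qv ->].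
  by rewrite le_max qv.
exists (lapK s 0 v (sort (fun a b : R * R => b.1 <= a.1) l)) => Y mY bY.
rewrite -(ev_past_Lap s0 (chain_sort sv alv) (lexx 0) mY bY).
apply: eq_ev => x; rewrite mul0r oppr0 expR0 mulr1; congr (_ * _).
by apply: Lap_perm; rewrite perm_sym perm_sort.
Qed.

Lemma gmeas_all s l : 0 <= s -> all (fun p => (s <= p.1) && (0 <= p.2)) l ->
  gmeas (gen [set r | 0 <= r] gamma) (Lap s l).
Proof.
move=> s0; elim: l => [_|p l IH /= /andP[/andP[sp p0] al]].
  by rewrite (_ : Lap s [::] = fun=> 1)//; apply/funext => w; exact: Lap_nil.
rewrite (_ : Lap s (p :: l) = (fun w => expR (- (p.2 * (gamma p.1 w - gamma s w))) * Lap s l w)); last first.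
  by apply/funext => w; exact: Lap_cons.
apply: measurable_funM; last exact: IH.
apply: measurableT_comp => //; apply: measurable_funN; apply: measurable_funM => //.
by apply: measurable_funB; apply: gmeas_gen => //=; exact: le_trans sp.
Qed.

Lemma tau_indep (B : set R) (Y : T -> R) : measurable B ->
  gmeas (gen [set r | 0 <= r] gamma) Y -> bmfun Y ->
  ev (fun x => \1_B (tau x) * Y x) = ev (fun x => \1_B (tau x)) * ev Y.
Proof.
move=> mB mY bY.
have m1 : gen [set tt] (fun _ => tau) `<=` measurable by apply: gen_measurable.
have m2 : gen [set r | 0 <= r] gamma `<=` measurable by apply: gen_measurable => r; exact: mg.
apply: (indep_ev m1 m2 tind) => //; last exact: bmfun_indic_comp.
apply: (@measurableT_comp _ _ _ (g_sigma_algebraType (gen [set tt] (fun=> tau))) R R (\1_B) _ tau) => //.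
exact: (@gmeas_gen _ _ _ _ [set tt] (fun _ => tau) tt).
Qed.

Lemma past_sub_all s : past s `<=` <<s gen [set r | 0 <= r] gamma >>.
Proof.
move=> _ [r [/= /andP[r0 rs] [B [mB ->]]]]; apply: sub_sigma_algebra.
by exists r; split => //; exists B.
Qed.

(** Induction over the generators of [e], with [B0] and [l] as accumulators. The indicator of an
    increment is recovered by [laplace_unique] from exponential weights, which are pushed onto [l];
    an indicator of [tau] is merged into [B0]. In the base case [tau_indep] and [ev_past_Lap_fact]
    factor everything. *)
Lemma past_future_lap s A (B0 : set R) l e : 0 <= s -> <<s past s >> A -> measurable B0 ->
  piclos (future s) e -> all (fun p => (s <= p.1) && (0 <= p.2)) l ->
  ev (fun x => \1_A x * (\1_B0 (tau x) * \1_e x * Lap s l x)) =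
  ev (fun x => ev \1_A * (\1_B0 (tau x) * \1_e x * Lap s l x)).
Proof.
move=> s0 sA mB0 pe; have mA : measurable A by exact: sub_sigma_measurable (@past_measurable s) _ sA.
have me e' : piclos (future s) e' -> measurable e'.
  move=> /piclos_sigma; exact: sub_sigma_measurable (future_measurable s0) _.
elim: pe B0 mB0 l => [|A1 A2 [[v|] /= [sv [B [mB ->]]]] pA2 IH] B0 mB0 l al.
- have bL := bmfun_Lap s0 al; have mL := @gmeas_all s l s0 al.
  have [k hk] := ev_past_Lap_fact s0 al.
  have gA : gmeas (past s) (\1_A : T -> R).
    exact: (@measurable_indic _ (g_sigma_algebraType (past s)) R setT A sA).
  have bA : bmfun (\1_A : T -> R) by exact: bmfun_indic.
  rewrite evZ; last first.
    apply: bmfunM => //; apply: bmfunM; first exact: bmfun_indic_comp.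
    exact: bmfun_indic.
  under eq_ev do rewrite indicT mulr1 mulrCA.
  under [X in _ * X]eq_ev do rewrite indicT mulr1.
  rewrite !tau_indep//; last 2 first.
  - apply: measurable_funM => //; exact: gmeas_sub (@past_sub_all s) gA.
  - exact: bmfunM.
  have h1 := hk _ gA bA.
  have := hk (fun _ => 1) (measurable_cst _) (bmfun_cst 1).
  under eq_ev do rewrite mul1r.
  by rewrite ev_cst mul1r => ->; rewrite h1; ring.
- have mX : measurable_fun setT (fun w => gamma v w - gamma s w).
    by apply: measurable_incr => //; exact: le_trans sv.
  have X0 w : 0 <= gamma v w - gamma s w by apply: incr_ge0; rewrite s0.
  have bL := bmfun_Lap s0 al.
  have b0 : bmfun (fun x => \1_B0 (tau x) * \1_A2 x * Lap s l x).
    apply: bmfunM => //; apply: bmfunM; first exact: bmfun_indic_comp.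
    by apply: bmfun_indic; exact: me.
  have h : forall th, 0 <= th ->
    ev (fun x => \1_A x * (\1_B0 (tau x) * \1_A2 x * Lap s l x) * expR (- (th * (gamma v x - gamma s x)))) =
    ev (fun x => ev \1_A * (\1_B0 (tau x) * \1_A2 x * Lap s l x) * expR (- (th * (gamma v x - gamma s x)))).
    move=> th th0; have al' : all (fun p => (s <= p.1) && (0 <= p.2)) ((v, th) :: l).
      by rewrite /= sv th0.
    have := IH B0 mB0 _ al'.
    under eq_ev do rewrite Lap_cons /= [X in _ * (_ * X)]mulrC !mulrA.
    under [X in _ = X -> _]eq_ev do rewrite Lap_cons /= [X in _ * (_ * X)]mulrC !mulrA.
    under [X in _ -> X = _]eq_ev do rewrite !mulrA.
    by under [X in _ -> _ = X]eq_ev do rewrite !mulrA.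
  have bA : bmfun (\1_A : T -> R) by exact: bmfun_indic.
  have b1 : bmfun (fun x => \1_A x * (\1_B0 (tau x) * \1_A2 x * Lap s l x)) by exact: bmfunM.
  have b2 : bmfun (fun x => ev \1_A * (\1_B0 (tau x) * \1_A2 x * Lap s l x)).
    by apply: bmfunM => //; exact: bmfun_cst.
  have := laplace_unique mX mX X0 X0 b1 b2 h mB.
  have iE x : \1_((fun w => gamma v w - gamma s w) @^-1` B `&` A2) x =
     \1_B (gamma v x - gamma s x) * \1_A2 x :> R by rewrite indicI.
  move=> e1; transitivity (ev (fun x => \1_A x * (\1_B0 (tau x) * \1_A2 x * Lap s l x) * \1_B (gamma v x - gamma s x))).
    by apply: eq_ev => x; rewrite iE; ring.
  by rewrite e1; apply: eq_ev => x; rewrite iE; ring.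
- have iE x : \1_(tau @^-1` B `&` A2) x = \1_B (tau x) * \1_A2 x :> R by rewrite indicI.
  have jE x : \1_(B0 `&` B) (tau x) = \1_B0 (tau x) * \1_B (tau x) :> R by rewrite indicI.
  have := IH (B0 `&` B) (measurableI _ _ mB0 mB) l al.
  move=> e1; transitivity (ev (fun x => \1_A x * (\1_(B0 `&` B) (tau x) * \1_A2 x * Lap s l x))).
    by apply: eq_ev => x; rewrite iE jE; ring.
  by rewrite e1; apply: eq_ev => x; rewrite iE jE; ring.
Qed.

Lemma past_future_indep s A e : 0 <= s -> <<s past s >> A -> <<s future s >> e ->
  P (A `&` e) = (P A * P e)%E.
Proof.
move=> s0 sA se; have mA : measurable A by exact: sub_sigma_measurable (@past_measurable s) _ sA.
have me e' : piclos (future s) e' -> measurable e'.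
  move=> /piclos_sigma; exact: sub_sigma_measurable (future_measurable s0) _.
apply: (indep_pi (@piclos_setI_closed _ _ (future s)) me mA _ (sigma_piclos se)).
move=> S pS; apply/indep_evP => //; first exact: me.
have := @past_future_lap s A setT [::] S s0 sA measurableT pS erefl.
under eq_ev do rewrite indicT mul1r Lap_nil mulr1.
under [X in _ = X -> _]eq_ev do rewrite indicT mul1r Lap_nil mulr1.
by move=> ->; rewrite evZ//; apply: bmfun_indic; exact: me.
Qed.

(** * Lukacs' theorem for the ratios *)

Definition scale th l : seq (R * R) := [seq (p.1, p.2 / (1 + th)) | p <- l].

(** Each stage of [lapK] releases a power of [1 + th], by
    [1 + th + (1 + th) mu = (1 + th) (1 + mu)], and the exponents telescope to [- v]. *)
Lemma lapK_scale th mu v l : 0 <= th -> 0 <= mu -> chain 0 v l ->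
  lapK 0 (th + (1 + th) * mu) v l = (1 + th) `^ (- v) * lapK 0 mu v (scale th l).
Proof.
move=> th0; have th1 : 0 < 1 + th by lra.
have powD (x y : R) : (1 + th) `^ (x + y) = (1 + th) `^ x * (1 + th) `^ y.
  by rewrite powRD//; apply/implyP => _; rewrite gt_eqF.
have e m : 1 + (th + (1 + th) * m) = (1 + th) * (1 + m) by ring.
elim: l mu v => [|p l IH] mu v mu0 /=.
  move=> v0; rewrite subr0 e powRM//; [lra|lra].
move=> /and3P[pv p0 c].
have p20 : 0 <= p.2 / (1 + th) by rewrite divr_ge0// ltW.
rewrite (_ : th + (1 + th) * mu + p.2 = th + (1 + th) * (mu + p.2 / (1 + th))); last first.
  by field; rewrite gt_eqF.
rewrite IH//; last by rewrite addr_ge0.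
rewrite e powRM; [|lra|lra].
rewrite (_ : - v = - (v - p.1) + - p.1); last by ring.
by rewrite powD; ring.
Qed.

Lemma scale_perm th l l' : perm_eq l l' -> perm_eq (scale th l) (scale th l').
Proof. exact: perm_map. Qed.

(* Tilting by exp(- th gamma_s) amounts to replacing gamma by gamma / (1 + th) on [0, s];
   ratios gamma_r / gamma_s are blind to this, which gives Lukacs' theorem below. *)
Lemma esscher_lap s th l : 0 <= s -> 0 <= th ->
  all (fun p => [&& 0 <= p.1, p.1 <= s & 0 <= p.2]) l ->
  ev (fun x => expR (- (th * gamma s x)) * Lap 0 l x) =
  (1 + th) `^ (- s) * ev (Lap 0 (scale th l)).
Proof.
move=> s0 th0 al; set l' := sort (fun a b : R * R => b.1 <= a.1) l.
have th1 : 0 < 1 + th by lra.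
have c : chain 0 s l' by exact: chain_sort.
have al' : all (fun p => [&& 0 <= p.1, p.1 <= s & 0 <= p.2]) (scale th l).
  rewrite all_map; apply: sub_all al => p /= /and3P[-> -> p0] /=.
  by rewrite divr_ge0// ltW.
have c' : chain 0 s (scale th l').
  have : forall v m, chain 0 v m -> chain 0 v (scale th m).
    move=> v m; elim: m v => [//|p m IH] v /= /and3P[-> p0 /IH ->].
    by rewrite divr_ge0// ltW.
  by apply.
have ll' : perm_eq l l' by rewrite perm_sym perm_sort.
have m1 : gmeas (past 0) (fun _ : T => 1 : R) by exact: measurable_cst.
have h1 := ev_past_Lap (lexx 0) c th0 m1 (bmfun_cst 1).
have h2 := ev_past_Lap (lexx 0) c' (lexx 0) m1 (bmfun_cst 1).
rewrite ev_cst !mul1r in h1 h2.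
have := lapK_scale th0 (lexx 0) c; rewrite mulr0 addr0 => hK.
transitivity (lapK 0 th s l').
  rewrite -h1; apply: eq_ev => x; rewrite g0 subr0 mul1r; congr (_ * _).
  exact: Lap_perm.
rewrite hK -h2; congr (_ * _); apply: eq_ev => x.
rewrite mul0r oppr0 expR0 !mul1r; apply/esym; apply: Lap_perm.
exact: scale_perm.
Qed.

Definition dratio s : set (set T) :=
  gen [set r | 0 <= r <= s] (fun r w => gamma r w / gamma s w).

Lemma gmeas_ratio s r : 0 <= r <= s -> gmeas (past s) (fun w => gamma r w / gamma s w).
Proof.
move=> rs; have /andP[r0 rs'] := rs; apply: measurable_fun_div; apply: gmeas_past => //.
by rewrite lexx (le_trans r0).
Qed.

Lemma dratio_past s : dratio s `<=` <<s past s >>.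
Proof.
move=> _ [r [/= rs [B [mB ->]]]].
by have := gmeas_preimage (gmeas_ratio rs) mB.
Qed.

Lemma dratio_measurable s : dratio s `<=` measurable.
Proof.
by move=> A /dratio_past; exact: sub_sigma_measurable (@past_measurable s) _.
Qed.

(** Same accumulator scheme: an event on [gamma r / gamma s] is an event on the pair, recovered by
    [laplace_unique2] from two weights pushed onto [l]. On the right both coordinates are divided by
    [1 + th], which the ratio does not see. *)
Lemma lukacs_lap s th e l : 0 <= s -> 0 <= th -> piclos (dratio s) e ->
  all (fun p => [&& 0 <= p.1, p.1 <= s & 0 <= p.2]) l ->
  ev (fun x => expR (- (th * gamma s x)) * \1_e x * Lap 0 l x) =
  ev (fun x => (1 + th) `^ (- s) * (\1_e x * Lap 0 (scale th l) x)).
Proof.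
move=> s0 th0 pe.
have th1 : 0 < 1 + th by lra.
have me e' : piclos (dratio s) e' -> measurable e'.
  move=> /piclos_sigma; exact: sub_sigma_measurable (@dratio_measurable s) _.
have bE : bmfun (fun x => expR (- (th * gamma s x))).
  by apply: bmfun_expN => //; [exact: mg | move=> x; exact: gamma_ge0].
have bLap m : all (fun p => [&& 0 <= p.1, p.1 <= s & 0 <= p.2]) m -> bmfun (Lap 0 m).
  by move=> am; apply: bmfun_Lap => //; exact: all_weak am.
have al' m : all (fun p => [&& 0 <= p.1, p.1 <= s & 0 <= p.2]) m ->
    all (fun p => [&& 0 <= p.1, p.1 <= s & 0 <= p.2]) (scale th m).
  move=> am; rewrite all_map; apply: sub_all am => p /= /and3P[-> -> p0] /=.
  by rewrite divr_ge0// ltW.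
elim: pe l => [|A1 A2 [r [/= rs [B [mB ->]]]] pA2 IH] l al.
  under eq_ev do rewrite indicT mulr1.
  under [RHS]eq_ev do rewrite indicT mul1r.
  rewrite evZ; first exact: esscher_lap.
  exact/bLap/al'.
have /andP[r0 rs'] := rs.
have bA2 : bmfun (\1_A2 : T -> R) by apply: bmfun_indic; exact: me.
have mX := mg r0; have mY := mg s0.
have X0 x : 0 <= gamma r x by exact: gamma_ge0.
have Y0 x : 0 <= gamma s x by exact: gamma_ge0.
have mX' : measurable_fun setT (fun x => gamma r x / (1 + th)).
  by apply: measurable_funM => //; exact: measurable_cst.
have mY' : measurable_fun setT (fun x => gamma s x / (1 + th)).
  by apply: measurable_funM => //; exact: measurable_cst.
have X0' x : 0 <= gamma r x / (1 + th) by rewrite divr_ge0// ltW.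
have Y0' x : 0 <= gamma s x / (1 + th) by rewrite divr_ge0// ltW.
have b1 : bmfun (fun x => expR (- (th * gamma s x)) * \1_A2 x * Lap 0 l x).
  by apply: bmfunM; [exact: bmfunM | exact: bLap].
have b2 : bmfun (fun x => (1 + th) `^ (- s) * (\1_A2 x * Lap 0 (scale th l) x)).
  apply: bmfunM; first exact: bmfun_cst.
  by apply: bmfunM => //; exact/bLap/al'.
pose B' := [set z : R * R | B (z.1 / z.2)].
have mB' : measurable B'.
  have md : measurable_fun setT (fun z : R * R => z.1 / z.2).
    by apply: measurable_fun_div; [exact: measurable_fst | exact: measurable_snd].
  by have := md measurableT B mB; rewrite setTI.
have h a b : 0 <= a -> 0 <= b ->
  ev (fun x => expR (- (th * gamma s x)) * \1_A2 x * Lap 0 l x * expR (- (a * gamma r x)) * expR (- (b * gamma s x))) =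
  ev (fun x => (1 + th) `^ (- s) * (\1_A2 x * Lap 0 (scale th l) x) * expR (- (a * (gamma r x / (1 + th)))) * expR (- (b * (gamma s x / (1 + th))))).
  move=> a0 b0; have am : all (fun p => [&& 0 <= p.1, p.1 <= s & 0 <= p.2]) ((r, a) :: (s, b) :: l).
    by rewrite /= r0 rs' a0 s0 b0 lexx.
  have := IH _ am => e1.
  transitivity (ev (fun x => expR (- (th * gamma s x)) * \1_A2 x * Lap 0 ((r, a) :: (s, b) :: l) x)).
    by apply: eq_ev => x; rewrite !Lap_cons /= g0 !subr0; ring.
  rewrite e1; apply: eq_ev => x; rewrite /scale /= !Lap_cons /= g0 !subr0.
  rewrite (_ : a / (1 + th) * gamma r x = a * (gamma r x / (1 + th))); last by ring.
  rewrite (_ : b / (1 + th) * gamma s x = b * (gamma s x / (1 + th))); last by ring.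
  by rewrite -/(scale th l); ring.
have := laplace_unique2 mX mX' mY mY' X0 X0' Y0 Y0' b1 b2 h mB'.
have iE x : \1_((fun w => gamma r w / gamma s w) @^-1` B `&` A2) x =
     \1_B (gamma r x / gamma s x) * \1_A2 x :> R by rewrite indicI.
have jE x : \1_B' (gamma r x, gamma s x) = \1_B (gamma r x / gamma s x) :> R by [].
have kE x : \1_B' (gamma r x / (1 + th), gamma s x / (1 + th)) = \1_B (gamma r x / gamma s x) :> R.
  rewrite (_ : \1_B' _ = \1_B (gamma r x / (1 + th) / (gamma s x / (1 + th))))//.
  (* If [gamma s x] is 0, both ratios are 0 by the convention for division; elsewhere the factor
     cancels. *)
  congr (\1_B _); have [->|y0] := eqVneq (gamma s x) 0; first by rewrite mul0r invr0 !mulr0.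
  by field; rewrite y0 gt_eqF.
move=> e1; transitivity (ev (fun x => expR (- (th * gamma s x)) * \1_A2 x * Lap 0 l x * \1_B' (gamma r x, gamma s x))).
  by apply: eq_ev => x; rewrite iE jE; ring.
by rewrite e1; apply: eq_ev => x; rewrite iE kE; ring.
Qed.

(** With an empty list, [lukacs_lap] says that the indicator of [e] factors out of the Laplace
    transform of [gamma s]. *)
Lemma lukacs1 s e B : 0 <= s -> piclos (dratio s) e -> measurable B ->
  P (e `&` gamma s @^-1` B) = (P e * P (gamma s @^-1` B))%E.
Proof.
move=> s0 pe mB.
have me : measurable e.
  move/piclos_sigma : pe; exact: sub_sigma_measurable (@dratio_measurable s) _.
have mY := mg s0; have Y0 x : 0 <= gamma s x by exact: gamma_ge0.
have mBs : measurable (gamma s @^-1` B).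
  by rewrite -[X in measurable X]setTI; exact: mY.
apply/indep_evP => //; rewrite -evZ; last exact: bmfun_indic.
apply: (laplace_unique mY mY Y0 Y0 _ _ _ mB); first exact: bmfun_indic.
  exact: bmfun_cst.
move=> th th0.
have be := @bmfun_expN _ _ R _ _ th0 mY Y0.
have := lukacs_lap s0 th0 pe (erefl : all _ [::]).
under eq_ev do rewrite Lap_nil mulr1 mulrC.
under [X in _ = X -> _]eq_ev do rewrite Lap_nil mulr1.
move=> ->; rewrite !evZ//; last exact: bmfun_indic.
have -> : ev (fun x => expR (- (th * gamma s x))) = (1 + th) `^ (- s).
  have := @ev_lap 0 s th; rewrite lexx s0 subr0 => /(_ isT th0) <-.
  by apply: eq_ev => x; rewrite g0 subr0.
by rewrite mulrC.
Qed.

(** Two times are kept apart so that the increment between [t] and [s] is left out: the class is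
    then independent of it, which is [incr_indep]. The case [t = s] is the one of Lukacs'
    theorem. *)
Definition pres_future t s : set (set T) :=
  [set A | exists B Q, [/\ measurable B, <<s future s >> Q & A = gamma t @^-1` B `&` Q]].

Lemma pres_future_setI_closed t s : setI_closed (pres_future t s).
Proof.
move=> _ _ [B1 [Q1 [mB1 sQ1 ->]]] [B2 [Q2 [mB2 sQ2 ->]]].
exists (B1 `&` B2), (Q1 `&` Q2); split; [exact: measurableI | exact: sigma_setI_closed|].
by rewrite preimage_setI setIACA.
Qed.

Lemma pres_future_measurable t s : 0 <= t -> 0 <= s -> pres_future t s `<=` measurable.
Proof.
move=> t0 s0 _ [B [Q [mB sQ ->]]]; apply: measurableI.
  by rewrite -[X in measurable X]setTI; exact: mg.
exact: sub_sigma_measurable (future_measurable s0) _ sQ.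
Qed.

Lemma gmeas_pres_future_gamma t s : gmeas (pres_future t s) (gamma t).
Proof.
move=> _ B mB; rewrite setTI; apply: sub_sigma_algebra.
exists B, setT; split => //; last by rewrite setIT.
exact: (@measurableT _ (g_sigma_algebraType (future s))).
Qed.

Lemma gmeas_pres_future_future t s d' (U : measurableType d') (f : T -> U) :
  gmeas (future s) f -> gmeas (pres_future t s) f.
Proof.
apply: gmeas_sub => Q fQ; apply: sub_sigma_algebra.
exists setT, Q; split => //; last by rewrite preimage_setT setTI.
exact: sub_sigma_algebra.
Qed.

(** Both [e] and [gamma t] are known at [s], hence jointly independent of the future after [s]; only
    the independence of [e] from [gamma t] has to be supplied. *)
Lemma past_pres_future_indep t s e q : 0 <= t <= s -> <<s past s >> e ->
  (forall B, measurable B -> P (e `&` gamma t @^-1` B) = (P e * P (gamma t @^-1` B))%E) ->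
  <<s pres_future t s >> q -> P (e `&` q) = (P e * P q)%E.
Proof.
move=> ts se hB sq; have /andP[t0 ts'] := ts; have s0 : 0 <= s by exact: le_trans ts'.
have me : measurable e by exact: sub_sigma_measurable (@past_measurable s) _ se.
apply: (indep_pi (@pres_future_setI_closed t s) (pres_future_measurable t0 s0) me _ sq).
move=> _ [B [Q [mB sQ ->]]].
have pB : <<s past s >> (gamma t @^-1` B) by exact: (gmeas_preimage (gmeas_past ts) mB).
rewrite setIA (past_future_indep s0)//; last exact: sigma_setI_closed.
by rewrite hB// (past_future_indep s0)// muleA.
Qed.

Lemma lukacs s e q : 0 <= s -> <<s dratio s >> e -> <<s pres_future s s >> q ->
  P (q `&` e) = (P q * P e)%E.
Proof.
move=> s0 se sq.
have mq : measurable q by exact: sub_sigma_measurable (pres_future_measurable s0 s0) _ sq.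
have me e' : piclos (dratio s) e' -> measurable e'.
  move=> /piclos_sigma; exact: sub_sigma_measurable (@dratio_measurable s) _.
apply: (indep_pi (@piclos_setI_closed _ _ (dratio s)) me mq _ (sigma_piclos se)).
move=> S pS; rewrite setIC muleC; apply: (@past_pres_future_indep s s) => //; first by rewrite s0 lexx.
  move/piclos_sigma : pS; apply: smallest_sub; last exact: dratio_past.
  exact: smallest_sigma_algebra.
by move=> B mB; exact: lukacs1.
Qed.

Lemma incr_indep t s B q : 0 <= t <= s -> measurable B -> <<s pres_future t s >> q ->
  P ((fun w => gamma s w - gamma t w) @^-1` B `&` q) =
  (P ((fun w => gamma s w - gamma t w)%R @^-1` B) * P q)%E.
Proof.
move=> ts mB sq; have /andP[t0 ts'] := ts; have s0 : 0 <= s by exact: le_trans ts'.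
apply: (past_pres_future_indep ts) sq => //.
  have mi : gmeas (past s) (fun w => gamma s w - gamma t w).
    by apply: measurable_funB; apply: gmeas_past => //; rewrite s0 lexx.
  exact: (gmeas_preimage mi mB).
move=> B' mB'; rewrite setIC muleC; apply: (gind ts).
  apply: (@gmeas_preimage _ _ (past t) _ _ (gamma t)) => //.
  by apply: gmeas_past; rewrite t0 lexx.
apply: sub_sigma_algebra; exists tt; split => //; by exists B.
Qed.

(** The indicator of a vanishing increment is below its exponential [exp(- lam X)] for every
    [lam >= 0], and the Laplace transform tends to 0 as [lam] grows. *)
Lemma incr_pos t s : 0 <= t -> t < s -> P [set w | gamma s w - gamma t w = 0] = 0%E.
Proof.
move=> t0 ts; have s0 : 0 <= s by exact: le_trans (ltW ts).
have ts' : 0 <= t <= s by rewrite t0 ltW.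
have mi := measurable_incr t0 s0.
set S := [set w | _]; have mS : measurable S.
  by have := mi measurableT _ (measurable_set1 0); rewrite setTI.
have bS : bmfun (\1_S : T -> R) by exact: bmfun_indic.
have le (lam : R) : 0 <= lam -> ev \1_S <= (1 + lam) `^ (- (s - t)).
  move=> l0; rewrite -(ev_lap ts' l0); apply: le_ev => //.
    by apply: bmfun_expN => // x; exact: incr_ge0.
  move=> x; rewrite indicE; have [/set_mem Sx|_] := boolP (x \in S).
    by rewrite Sx mulr0 oppr0 expR0.
  by rewrite expR_ge0.
have p0 : 0 <= ev \1_S by apply: Rintegral_ge0 => x _.
suff : ev \1_S = 0.
  by rewrite ev_indic// => h; rewrite -(fineK (fin_num_measure P S mS)) h.
apply/eqP; rewrite eq_le p0 andbT leNgt; apply/negP => pgt.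
have p1 : ev \1_S <= 1 by rewrite -(ev_cst P 1); apply: le_ev => //; exact: bmfun_cst.
set p := ev \1_S in p0 pgt p1 le.
have a0 : 0 < s - t by rewrite subr_gt0.
have q0 : 0 < p / 2 by rewrite divr_gt0.
(* With this value for [lam] the bound reads [p <= p / 2]. *)
have l0 : 0 <= (p / 2) `^ (- (s - t)^-1) - 1.
  rewrite subr_ge0 powRN -[leLHS]invr1 lef_pV2 ?posrE ?powR_gt0//.
  rewrite -[leRHS](powRr0 (p / 2)); apply: ger_powR; last by rewrite invr_ge0 ltW.
  by rewrite q0 /=; lra.
have := le _ l0; rewrite addrC subrK -powRrM mulrNN mulVf ?gt_eqF// powRr1; last exact: ltW.
by move=> h; lra.
Qed.

(** * The process stopped at the lifetime *)

Context (grc : forall w t, 0 <= t -> gamma s w @[s --> t^'+] --> gamma t w).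
Context (tau_gt0 : forall w, 0 < tau w).
Context (Pcomplete : measure_is_complete P).

(* [rest s] and [stopinc s u] are gamma_tau - gamma_s and gamma_(u /\ tau) - gamma_s
   on {s < tau}, and 0 elsewhere. *)
Definition rest s w := gamma (Num.max s (tau w)) w - gamma s w.

Definition stopinc s u w := gamma (Num.max s (Num.min u (tau w))) w - gamma s w.

Definition alive s : set T := [set w | s < tau w].

(** The maximum with [s] keeps the evaluation time after [s], hence the increment in the future
    sigma-algebra, even where [rho] is smaller. *)
Lemma gmeas_future_stop s (rho : T -> R) : 0 <= s -> gmeas (future s) rho ->
  gmeas (future s) (fun w => gamma (Num.max s (rho w)) w - gamma s w).
Proof.
move=> s0 mrho.
apply: (@measurable_right_cont R _ (g_sigma_algebraType (future s))
   (fun v w => gamma v w - gamma s w) s (fun w => Num.max s (rho w))).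
- by move=> v sv; exact: gmeas_future_incr.
- move=> w v sv; apply: cvgB; last exact: cvg_cst.
  by apply: grc; exact: le_trans sv.
- by apply: measurable_maxr => //; exact: measurable_cst.
- by move=> w; rewrite le_max lexx.
Qed.

Lemma gmeas_rest s : 0 <= s -> gmeas (future s) (rest s).
Proof. by move=> s0; apply: gmeas_future_stop => //; exact: gmeas_future_tau. Qed.

Lemma gmeas_stopinc s u : 0 <= s -> gmeas (future s) (stopinc s u).
Proof.
move=> s0; apply: (@gmeas_future_stop s (fun w => Num.min u (tau w))) => //.
by apply: measurable_minr; [exact: measurable_cst | exact: gmeas_future_tau].
Qed.

Lemma alive_future s : <<s future s >> (alive s).
Proof.
have := gmeas_preimage (@gmeas_future_tau s) (measurable_itv `]s, +oo[).
by rewrite (_ : _ @^-1` _ = alive s)//; apply/seteqP; split => w; rewrite /alive /= in_itv/= andbT.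
Qed.

Lemma alive_measurable s : measurable (alive s).
Proof.
have := mtau measurableT (measurable_itv `]s, +oo[); rewrite setTI.
by rewrite (_ : _ @^-1` _ = alive s)//; apply/seteqP; split => w; rewrite /alive /= in_itv/= andbT.
Qed.

Lemma rest_ge0 s w : 0 <= s -> 0 <= rest s w.
Proof. by move=> s0; apply: incr_ge0; rewrite s0 le_max lexx. Qed.

(** Monotonicity reduces the claim to the countably many increments from [s] to [s + 1 / (n + 1)],
    each almost surely positive by [incr_pos]. *)
Lemma rest_pos s : 0 <= s -> {ae P, forall w, s < tau w -> 0 < rest s w}.
Proof.
move=> s0.
have : {ae P, forall w (n : nat), 0 < gamma (s + n.+1%:R^-1) w - gamma s w}.
  apply: ae_foralln => n.
  have sn : s < s + n.+1%:R^-1 by rewrite ltrDl invr_gt0.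
  have sn0 : 0 <= s + n.+1%:R^-1 by rewrite (le_trans s0)// ltW.
  exists [set w | gamma (s + n.+1%:R^-1) w - gamma s w = 0]; split.
  - have := measurable_incr s0 sn0 measurableT (measurable_set1 0).
    by rewrite setTI.
  - exact: incr_pos.
  - move=> w /= /negP; rewrite -leNgt => le0; apply/eqP; rewrite eq_le le0 /=.
    by apply: incr_ge0; rewrite s0 ltW.
apply: filterS => w h st.
have st0 : 0 < tau w - s by rewrite subr_gt0.
pose n := Num.truncn (tau w - s)^-1.
apply: lt_le_trans (h n) _; rewrite /rest lerD2r (max_r (ltW st)).
apply: gmono; apply/andP; split; first by rewrite addr_ge0.
rewrite -lerBrDl invf_ple ?posrE// ltW//; exact: truncnS_gt.
Qed.

Lemma gamma_tau s w : s < tau w -> gamma (tau w) w = gamma s w + rest s w.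
Proof. by move=> st; rewrite /rest max_r ?ltW// addrC subrK. Qed.

Lemma zeta_alive s r w : r <= s -> s < tau w ->
  zeta gamma tau r w = gamma r w / (gamma s w + rest s w).
Proof.
move=> rs st; rewrite /zeta -gamma_tau// min_l//.
by rewrite ltW// (le_lt_trans rs).
Qed.

(* On {s < tau} both sides are 0 when the denominators vanish. *)
Lemma zeta_odds s r w : 0 <= r <= s -> s < tau w ->
  zeta gamma tau r w / (1 - zeta gamma tau s w) = gamma r w / rest s w.
Proof.
move=> /andP[r0 rs] st; have s0 : 0 <= s by exact: le_trans rs.
rewrite (zeta_alive rs st) (zeta_alive (lexx s) st).
have gs := gamma_ge0 w s0; have Ns := rest_ge0 w s0.
have gr : gamma r w <= gamma s w by apply: gmono; rewrite r0.
have gr0 := gamma_ge0 w r0.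
have [z|nz] := eqVneq (gamma s w + rest s w) 0.
  have -> : gamma r w = 0 by lra.
  by rewrite !mul0r.
have -> : 1 - gamma s w / (gamma s w + rest s w) = rest s w / (gamma s w + rest s w).
  by field.
have [->|Nnz] := eqVneq (rest s w) 0; first by rewrite mul0r invr0 !mulr0.
by field; rewrite Nnz nz.
Qed.

(** * The Markov property at a fixed time *)

Lemma measurable_zeta r : 0 <= r -> measurable_fun setT (zeta gamma tau r).
Proof.
move=> r0; apply: measurable_fun_div.
  apply: (@measurable_right_cont R _ T gamma 0 (fun w => Num.min r (tau w))) => //.
  - by apply: measurable_minr => //; exact: measurable_cst.
  - by move=> w; rewrite le_min r0 ltW.
apply: (@measurable_right_cont R _ T gamma 0 tau) => // w.
exact: ltW.
Qed.

Lemma Fzc_measurable s : Fzc P gamma tau s `<=` measurable.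
Proof.
apply: sub_sigma_measurable => A [|]; last exact: Pcomplete.
apply: sub_sigma_measurable; apply: gen_measurable => r /= /andP[r0 _].
exact: measurable_zeta.
Qed.

(* The past of [zeta] up to [s], on survival, is generated up to null sets by
   [gamma s / rest s] and the ratios [gamma r / gamma s], and the latter are
   independent of everything that determines the future of [zeta]. *)
Lemma markov_at s u (g : R -> R) : 0 <= s ->
  measurable_fun setT g -> (forall x, 0 <= g x <= 1) ->
  exists c : R -> R, [/\ measurable_fun setT c, (forall x, 0 <= c x <= 1) &
    forall F : T -> R, bmfun F ->
      (forall B, measurable B -> Fzc P gamma tau s (F @^-1` B)) ->
      ev (fun x => (g (stopinc s u x / rest s x) - c (gamma s x / rest s x)) * \1_(alive s) x * F x) = 0].
Proof.
move=> s0 mgg g01.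
have mfut := future_measurable s0; have mpf := pres_future_measurable s0 s0.
have gW : gmeas (future s) (fun x => stopinc s u x / rest s x).
  by apply: measurable_fun_div; [exact: gmeas_stopinc | exact: gmeas_rest].
have gX : gmeas (pres_future s s) (fun x => gamma s x / rest s x).
  apply: measurable_fun_div; first exact: gmeas_pres_future_gamma.
  by apply: gmeas_pres_future_future; exact: gmeas_rest.
have mX : measurable_fun setT (fun x => gamma s x / rest s x) by exact: gmeas_measurable gX.
have mW : measurable_fun setT (fun x => stopinc s u x / rest s x) by exact: gmeas_measurable gW.
have mH : measurable_fun setT (fun x => g (stopinc s u x / rest s x)) by exact: measurableT_comp.
(* On survival, [c] is the conditional expectation given [gamma s / rest s] alone; what follows
   shows that it serves for the whole past. *)
have [c [mc c01 cE]] := cond_exp_exists_on P mX mH (fun x => g01 _) (@alive_measurable s).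
exists c; split => // F bF mF.
pose H x := (g (stopinc s u x / rest s x) - c (gamma s x / rest s x)) * \1_(alive s) x.
have bg : bmfun (fun x => g (stopinc s u x / rest s x)).
  by apply: bmfun_comp => //; exists 1 => x; have /andP[? ?] := g01 x; rewrite ger0_norm.
have bc : bmfun (fun x => c (gamma s x / rest s x)).
  by apply: bmfun_comp => //; exists 1 => x; have /andP[? ?] := c01 x; rewrite ger0_norm.
have bD : bmfun (\1_(alive s) : T -> R) by apply: bmfun_indic; exact: alive_measurable.
have bH : bmfun H by apply: bmfunM => //; exact: bmfunB.
have gH : gmeas (pres_future s s) H.
  apply: measurable_funM.
    apply: measurable_funB; last exact: measurableT_comp.
    by apply: gmeas_pres_future_future; exact: measurableT_comp.
  apply: gmeas_pres_future_future.
  exact: (@measurable_indic _ (g_sigma_algebraType (future s)) R setT _ (@alive_future s)).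
(* Pi-system for the odds and the ratios together; on it [lukacs] splits the expectation into the
   defining relation of [c] and a probability. *)
pose GG := [set A | exists B E, [/\ measurable B, <<s dratio s >> E &
   A = (fun x => gamma s x / rest s x) @^-1` B `&` E]].
have mdr := @dratio_measurable s.
have mGG : GG `<=` measurable.
  move=> _ [B [E [mB sE ->]]]; apply: measurableI.
    by rewrite -[X in measurable X]setTI; exact: mX.
  exact: sub_sigma_measurable mdr _ sE.
have GGI : setI_closed GG.
  move=> _ _ [B1 [E1 [mB1 sE1 ->]]] [B2 [E2 [mB2 sE2 ->]]].
  exists (B1 `&` B2), (E1 `&` E2); split; [exact: measurableI | exact: sigma_setI_closed|].
  by rewrite preimage_setI setIACA.
have HBE B E : measurable B -> <<s dratio s >> E ->
    ev (fun x => H x * (\1_B (gamma s x / rest s x) * \1_E x)) = 0.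
  move=> mB sE.
  have bB : bmfun (fun x => (\1_B (gamma s x / rest s x) : R)) by exact: bmfun_indic_comp.
  transitivity (ev (fun x => H x * \1_B (gamma s x / rest s x)) * ev \1_E).
    transitivity (ev (fun x => H x * \1_B (gamma s x / rest s x) * \1_E x)).
      by apply: eq_ev => x; rewrite mulrA.
    apply: (indep_ev mpf mdr (fun A e sA se => lukacs s0 se sA)).
    - apply: measurable_funM => //.
      exact: gmeas_indic_comp.
    - exact: (@measurable_indic _ (g_sigma_algebraType (dratio s)) R setT _ sE).
    - exact: bmfunM.
    - by apply: bmfun_indic; exact: sub_sigma_measurable mdr _ sE.
  rewrite (_ : ev (fun x => H x * \1_B (gamma s x / rest s x)) = 0) ?mul0r//.
  under eq_ev do rewrite /H mulrBl mulrBl.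
  by rewrite evB ?cE ?subrr//; apply: bmfunM => //; exact: bmfunM.
have HGG A : <<s GG >> A -> ev (fun x => H x * \1_A x) = 0.
  move=> sA; apply: (sigma_eq0 GGI mGG bH).
  - move=> S [[B [E [mB sE ->]]]|->].
      by rewrite -[RHS](HBE B E mB sE); apply: eq_ev => x; rewrite indicI.
    rewrite -[RHS](HBE setT setT measurableT); last first.
      exact: (@measurableT _ (g_sigma_algebraType (dratio s))).
    by apply: eq_ev => x; rewrite !indicE !in_setT !mulr1.
  - by move=> B mB; apply: (@gmeas_preimage _ _ GG _ R (\1_A)).
  - by exists 1 => x; rewrite ger0_norm.
(* Sets agreeing almost surely, on survival, with a set generated by [GG]. They form a
   sigma-algebra, so it is enough to place the generators of the completed filtration in it. *)
pose CC := [set e | exists2 A, <<s GG >> A & {ae P, forall x, alive s x -> (e x <-> A x)}].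
have gGX : gmeas GG (fun x => gamma s x / rest s x).
  move=> _ B mB; rewrite setTI; apply: sub_sigma_algebra.
  exists B, setT; split => //; last by rewrite setIT.
  exact: (@measurableT _ (g_sigma_algebraType (dratio s))).
have gGd r : 0 <= r <= s -> gmeas GG (fun x => gamma r x / gamma s x).
  move=> rs; have : gmeas (dratio s) (fun x => gamma r x / gamma s x).
    exact: (@gmeas_gen _ _ _ _ [set r | 0 <= r <= s] (fun r w => gamma r w / gamma s w)).
  apply: gmeas_sub => E sE; apply: sub_sigma_algebra.
  exists setT, E; split => //; last by rewrite preimage_setT setTI.
  exact: sub_sigma_algebra.
have CCs : sigma_algebra setT CC.
  split.
  - exists set0; first exact: sigma_algebra0.
    by apply: aeW.
  - move=> e [A sA h]; exists (~` A); first exact: (@measurableC _ (g_sigma_algebraType GG)).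
    apply: filterS h => x /= h Dx; have [h1 h2] := h Dx.
    by split => [[_ ne] /h2//|nA]; split => // /h1.
  - move=> e /= he.
    have /choice[A hA] : forall n, exists A, <<s GG >> A /\ {ae P, forall x, alive s x -> (e n x <-> A x)}.
      by move=> n; have [A ? ?] := he n; exists A.
    exists (\bigcup_n A n).
      by apply: (@bigcupT_measurable _ (g_sigma_algebraType GG)) => n; have [] := hA n.
    have : {ae P, forall x n, alive s x -> (e n x <-> A n x)}.
      by apply: ae_foralln => n; have [] := hA n.
    apply: filterS => x h Dx; split => -[n _ hx]; exists n => //; exact/(h n Dx).
have FCC e : Fzc P gamma tau s e -> CC e.
  apply: smallest_sub => // {}e [|ne]; last first.
    exists set0; first exact: sigma_algebra0.
    have : {ae P, forall x, ~ e x}.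
      by apply: (negligibleS _ ne) => x /=; exact: contrapT.
    by apply: filterS => x nex _; split.
  apply: smallest_sub => // {}e [r [/= rs [B [mB ->]]]].
  (* With [X = gamma s / rest s], on survival [zeta s] is [X / (1 + X)], and [zeta r] is that times
     the ratio [gamma r / gamma s]. *)
  pose f x := (gamma s x / rest s x) / (1 + gamma s x / rest s x) * (gamma r x / gamma s x).
  have gf : gmeas GG f.
    apply: measurable_funM; last exact: gGd.
    apply: measurable_fun_div => //; apply: measurable_funD => //; exact: measurable_cst.
  exists (f @^-1` B); first exact: (gmeas_preimage gf mB).
  apply: filterS (rest_pos s0) => x hN Dx.
  have {}hN := hN Dx; have /andP[r0 rs'] := rs.
  suff fz : f x = zeta gamma tau r x by rewrite /preimage /= fz.
  rewrite (zeta_alive rs' Dx) /f.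
  have gs := gamma_ge0 x s0; have gr0 := gamma_ge0 x r0.
  have gr : gamma r x <= gamma s x by exact: gmono.
  have [z|nz] := eqVneq (gamma s x) 0.
    by have -> : gamma r x = 0 by [lra]; rewrite !mul0r mulr0.
  by field; rewrite nz !gt_eqF//; lra.
apply: (@sigma_eq0 _ _ _ P (Fzc P gamma tau s) H F) => //.
- exact: sigma_setI_closed.
- exact: Fzc_measurable.
- move=> S hS; have sS : Fzc P gamma tau s S.
    by case: hS => [//|->]; exact: (@measurableT _ (g_sigma_algebraType _)).
  have [A sA h] := FCC _ sS; rewrite -[RHS](HGG A sA).
  have mS := Fzc_measurable sS; have mA := sub_sigma_measurable mGG sA.
  apply: ae_eq_ev.
  + by apply: measurable_funM; [case: bH | exact: measurable_indic].
  + by apply: measurable_funM; [case: bH | exact: measurable_indic].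
  apply: filterS h => x h.
  have [Dx|nDx] := pselect (alive s x); last by rewrite /H indicE memNset// !mulr0 !mul0r.
  congr (_ * _); rewrite !indicE; congr (_%:R); congr nat_of_bool.
  by apply/idP/idP => /set_mem ?; apply/mem_set; exact/(h Dx).
- by move=> B mB; apply: sub_sigma_algebra; exact: mF.
- by case: bF.
Qed.

(** * Projecting an event known at time s onto time t *)

Lemma bmfun01 (f : T -> R) : measurable_fun setT f -> (forall x, 0 <= f x <= 1) -> bmfun f.
Proof.
by move=> mf f01; split => //; exists 1 => x; have /andP[? ?] := f01 x; rewrite ger0_norm.
Qed.

Lemma future_sub t s : t <= s -> future s `<=` <<s future t >>.
Proof.
move=> ts _ [[v|] /= [sv [B [mB ->]]]]; last exact: (gmeas_preimage (@gmeas_future_tau t) mB).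
have tv : t <= v by exact: le_trans sv.
have : gmeas (future t) (fun w => gamma v w - gamma s w).
  rewrite (_ : (fun w => _) = (fun w => (gamma v w - gamma t w) - (gamma s w - gamma t w))); last first.
    by apply/funext => w; ring.
  by apply: measurable_funB; exact: gmeas_future_incr.
by move=> h; exact: (gmeas_preimage h mB).
Qed.

(** Almost surely the same event as [alive s], but [rest s] can be divided by at every point of
    it. *)
Definition live s : set T := alive s `&` [set w | 0 < rest s w].

Lemma live_future s : 0 <= s -> <<s future s >> (live s).
Proof.
move=> s0; apply: sigma_setI_closed; first exact: alive_future.
have := gmeas_preimage (gmeas_rest s0) (measurable_itv `]0, +oo[).
by rewrite (_ : _ @^-1` _ = [set w | 0 < rest s w])//; apply/seteqP; split => w; rewrite /= in_itv/= andbT.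
Qed.

Lemma gmeas_live s : 0 <= s -> gmeas (future s) (\1_(live s) : T -> R).
Proof.
move=> s0; exact: (@measurable_indic _ (g_sigma_algebraType (future s)) R setT _ (live_future s0)).
Qed.

Lemma live_measurable s : 0 <= s -> measurable (live s).
Proof.
by move=> s0; exact: (sub_sigma_measurable (future_measurable s0) (live_future s0)).
Qed.

Lemma alive_live s : 0 <= s -> {ae P, forall x, \1_(alive s) x = \1_(live s) x :> R}.
Proof.
move=> s0; apply: filterS (rest_pos s0) => x h; rewrite !indicE; congr (_%:R); congr nat_of_bool.
apply/idP/idP => /set_mem; last by move=> [ax _]; apply/mem_set.
by move=> ax; apply/mem_set; split => //; exact: h.
Qed.

Lemma lap_gamma t (lam : R) : 0 <= t -> 0 <= lam ->
  ev (fun x => expR (- (lam * gamma t x))) = (1 + lam) `^ (- t).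
Proof.
move=> t0 l0; have := @ev_lap 0 t lam; rewrite lexx t0 subr0 => /(_ isT l0) <-.
by apply: eq_ev => x; rewrite g0 subr0.
Qed.

(** Two orthogonality relations add up: by [markov_at], [h - c] kills everything known at [s]; by
    the choice of [psi], the difference between the indicator of [A] and [psi] kills [f c], a
    function of the conditioning pair. *)
Lemma filtration_step1 t s u A (psi : R * R -> R) (f h : R -> R) :
  0 <= t <= s -> Fzc P gamma tau s A ->
  measurable_fun setT psi -> (forall z, 0 <= psi z <= 1) ->
  (forall B, measurable B -> ev (fun x => \1_A x * \1_(live s) x * \1_B (gamma t x / rest s x, gamma s x / rest s x)) =
     ev (fun x => psi (gamma t x / rest s x, gamma s x / rest s x) * \1_(live s) x *
       \1_B (gamma t x / rest s x, gamma s x / rest s x))) ->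
  measurable_fun setT f -> (forall x, 0 <= f x <= 1) ->
  measurable_fun setT h -> (forall x, 0 <= h x <= 1) ->
  ev (fun x => \1_A x * (f (gamma t x / rest s x) * h (stopinc s u x / rest s x) * \1_(live s) x)) =
  ev (fun x => psi (gamma t x / rest s x, gamma s x / rest s x) *
     (f (gamma t x / rest s x) * h (stopinc s u x / rest s x) * \1_(live s) x)).
Proof.
move=> ts sA mpsi psi01 psiE mf f01 mh h01; have /andP[t0 ts'] := ts.
have s0 : 0 <= s by exact: le_trans ts'.
have mA := Fzc_measurable sA; have mD := live_measurable s0.
have mfut := future_measurable s0.
have mN : measurable_fun setT (rest s) by exact: gmeas_measurable (gmeas_rest s0).
have mXt : measurable_fun setT (fun x => gamma t x / rest s x).
  by apply: measurable_fun_div => //; exact: mg.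
have mXs : measurable_fun setT (fun x => gamma s x / rest s x).
  by apply: measurable_fun_div => //; exact: mg.
have mW : measurable_fun setT (fun x => stopinc s u x / rest s x).
  by apply: measurable_fun_div => //; exact: gmeas_measurable (gmeas_stopinc u s0).
have mZ : measurable_fun setT (fun x => (gamma t x / rest s x, gamma s x / rest s x)).
  by apply/measurable_fun_pairP; split.
have [c [mc c01 cE]] := markov_at u s0 mh h01.
have bA : bmfun (\1_A : T -> R) by exact: bmfun_indic.
have bD : bmfun (\1_(live s) : T -> R) by exact: bmfun_indic.
have bp : bmfun (fun x => psi (gamma t x / rest s x, gamma s x / rest s x)).
  by apply: bmfun01 => //; exact: measurableT_comp.
have bf : bmfun (fun x => f (gamma t x / rest s x)) by apply: bmfun01 => //; exact: measurableT_comp.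
have bh : bmfun (fun x => h (stopinc s u x / rest s x)) by apply: bmfun01 => //; exact: measurableT_comp.
have bc : bmfun (fun x => c (gamma s x / rest s x)) by apply: bmfun01 => //; exact: measurableT_comp.
pose zt x := zeta gamma tau t x / (1 - zeta gamma tau s x).
pose zs x := zeta gamma tau s x / (1 - zeta gamma tau s x).
pose CF := gen_sigma [set r | 0 <= r <= s] (zeta gamma tau) `|` null_sets P.
have gz r : 0 <= r <= s -> gmeas CF (zeta gamma tau r).
  move=> rs _ B mB; rewrite setTI; apply: sub_sigma_algebra; left.
  by apply: sub_sigma_algebra; exists r; split => //; exists B.
have gzs : gmeas CF (zeta gamma tau s) by apply: gz; rewrite s0 lexx.
have g1z : gmeas CF (fun x => 1 - zeta gamma tau s x).
  by apply: measurable_funB => //; exact: measurable_cst.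
have gzt : gmeas CF zt by apply: measurable_fun_div => //; exact: gz.
have gzs' : gmeas CF zs by exact: measurable_fun_div.
(* Written with the odds of [zeta], so as to be measurable for the filtration at [s]; on [live s]
   these odds are the ratios over [rest s]. *)
pose F x := (\1_A x - psi (zt x, zs x)) * f (zt x).
have gA : gmeas CF (\1_A : T -> R).
  exact: (@measurable_indic _ (g_sigma_algebraType CF) R setT A sA).
have gF : gmeas CF F.
  apply: measurable_funM; last exact: measurableT_comp.
  apply: measurable_funB => //.
  have gp : gmeas CF (fun x => (zt x, zs x)) by apply/measurable_fun_pairP; split.
  exact: (measurableT_comp mpsi gp).
have bF : bmfun F.
  have mCF : CF `<=` measurable.
    by move=> S hS; apply: (@Fzc_measurable s); exact: sub_sigma_algebra.
  split; first exact: (gmeas_measurable mCF gF).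
  exists 1 => x; have /andP[a0 a1] := @indic01 R _ A x; have /andP[b0 b1] := psi01 (zt x, zs x).
  have /andP[f0 f1] := f01 (zt x).
  rewrite /F normrM (ger0_norm f0) mulr_ile1// ler_norml; lra.
have e1 := cE F bF (gmeas_preimage gF).
have Fx x : \1_(live s) x * F x =
   \1_(live s) x * ((\1_A x - psi (gamma t x / rest s x, gamma s x / rest s x)) * f (gamma t x / rest s x)).
  rewrite indicE; have [/set_mem [ax _]|_] := boolP (x \in live s); last by rewrite !mul0r.
  by rewrite /F /zt /zs zeta_odds// zeta_odds// s0 lexx.
have e2 : ev (fun x => (h (stopinc s u x / rest s x) - c (gamma s x / rest s x)) * (\1_(live s) x *
   ((\1_A x - psi (gamma t x / rest s x, gamma s x / rest s x)) * f (gamma t x / rest s x)))) = 0.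
  rewrite -[RHS]e1; apply: ae_eq_ev.
  - have [] // : bmfun (fun x => (h (stopinc s u x / rest s x) - c (gamma s x / rest s x)) * (\1_(live s) x *
     ((\1_A x - psi (gamma t x / rest s x, gamma s x / rest s x)) * f (gamma t x / rest s x)))).
    apply: bmfunM; first exact: bmfunB.
    apply: bmfunM => //; apply: bmfunM => //; exact: bmfunB.
  - have [] // : bmfun (fun x => (h (stopinc s u x / rest s x) - c (gamma s x / rest s x)) * \1_(alive s) x * F x).
    apply: bmfunM => //; apply: bmfunM; first exact: bmfunB.
    by apply: bmfun_indic; exact: alive_measurable.
  - by apply: filterS (alive_live s0) => x aE; rewrite aE -Fx mulrA.
have e3 : ev (fun x => (\1_A x - psi (gamma t x / rest s x, gamma s x / rest s x)) * \1_(live s) x *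
    (f (gamma t x / rest s x) * c (gamma s x / rest s x))) = 0.
  apply: (@cond_exp_fun _ _ _ P _ _ (fun x => (gamma t x / rest s x, gamma s x / rest s x))
    (fun x => (\1_A x - psi (gamma t x / rest s x, gamma s x / rest s x)) * \1_(live s) x)
    (fun z => f z.1 * c z.2)) => //.
  - by apply: bmfunM => //; exact: bmfunB.
  - apply: measurable_funM.
      by apply: (measurableT_comp mf); exact: measurable_fst.
    by apply: (measurableT_comp mc); exact: measurable_snd.
  - by exists 1 => z; have /andP[? ?] := mul01 (f01 z.1) (c01 z.2); rewrite ger0_norm.
  - move=> B mB; under eq_ev do rewrite mulrBl mulrBl.
    have bB : bmfun (fun x => (\1_B (gamma t x / rest s x, gamma s x / rest s x) : R)).
      exact: bmfun_indic_comp mZ mB.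
    by rewrite evB ?psiE ?subrr//; apply: bmfunM => //; exact: bmfunM.
apply/eqP; rewrite -subr_eq0 -evB; last 2 first.
- by apply: bmfunM => //; apply: bmfunM => //; exact: bmfunM.
- by apply: bmfunM => //; apply: bmfunM => //; exact: bmfunM.
rewrite -[X in _ == X](addr0 0) -{1}e2 -e3 -evD; last 2 first.
- apply: bmfunM; first exact: bmfunB.
  apply: bmfunM => //; apply: bmfunM => //; exact: bmfunB.
- apply: bmfunM; last exact: bmfunM.
  apply: bmfunM => //; exact: bmfunB.
by apply/eqP; apply: eq_ev => x; ring.
Qed.

(* The two errors committed when shrinking s to t: replacing (gamma_s - gamma_t) / rest s
   by gamma_s - gamma_t, and gamma_t / rest s by gamma_t / rest t; see [gamma_scale_bound]. *)
Definition err1 t s x : R :=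
  \1_(live s) x * Num.min 1 (Num.max (rest s x) (rest s x)^-1 `^ (s - t) - 1).

Definition err2 t s x : R :=
  \1_(live s) x * Num.min 1 ((rest t x / rest s x) `^ t - 1).

Lemma measurable_rest s : 0 <= s -> measurable_fun setT (rest s).
Proof. by move=> s0; exact: (gmeas_measurable (future_measurable s0) (gmeas_rest s0)). Qed.

Lemma measurable_stopinc s u : 0 <= s -> measurable_fun setT (stopinc s u).
Proof. by move=> s0; exact: (gmeas_measurable (future_measurable s0) (gmeas_stopinc u s0)). Qed.

Lemma bmfun_err1 t s : 0 <= s -> bmfun (err1 t s).
Proof.
move=> s0; split; last first.
  by exists 1 => x; apply: norm_err; [exact: powR_ge0 | exact: indic01].
apply: measurable_funM; first by apply: measurable_indic; exact: live_measurable.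
apply: measurable_minr; first exact: measurable_cst.
apply: measurable_funB; last exact: measurable_cst.
apply: (measurableT_comp (measurable_powR _)).
apply: measurable_maxr; first exact: measurable_rest.
by apply: (measurableT_comp measurable_inv); exact: measurable_rest.
Qed.

Lemma bmfun_err2 t s : 0 <= t -> 0 <= s -> bmfun (err2 t s).
Proof.
move=> t0 s0; split; last first.
  by exists 1 => x; apply: norm_err; [exact: powR_ge0 | exact: indic01].
apply: measurable_funM; first by apply: measurable_indic; exact: live_measurable.
apply: measurable_minr; first exact: measurable_cst.
apply: measurable_funB; last exact: measurable_cst.
apply: (measurableT_comp (measurable_powR _)).
by apply: measurable_fun_div; exact: measurable_rest.
Qed.

Lemma ev01 (f : T -> R) : measurable_fun setT f -> (forall x, 0 <= f x <= 1) -> 0 <= ev f <= 1.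
Proof.
move=> mf f01; apply/andP; split.
  by apply: Rintegral_ge0 => x _; have /andP[] := f01 x.
rewrite -[leRHS](ev_cst P); apply: le_ev; [exact: bmfun01 | exact: bmfun_cst|].
by move=> x; have /andP[] := f01 x.
Qed.

(** Here [gamma s / rest s] is [gamma t / rest s] plus the increment over [rest s]. The increment
    has parameter [s - t] and is independent of all other variables involved; with these frozen,
    dropping its divisor costs at most the bound of [gamma_scale_bound2], and the resulting kernel
    [p] depends on [gamma t / rest s] only. *)
Lemma esscher_incr t s u (psi : R * R -> R) (f h : R -> R) :
  0 <= t <= s -> measurable_fun setT psi -> (forall z, 0 <= psi z <= 1) ->
  measurable_fun setT f -> (forall x, 0 <= f x <= 1) ->
  measurable_fun setT h -> (forall x, 0 <= h x <= 1) ->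
  let p x := ev (fun y => psi (x, x + (gamma s y - gamma t y))) in
  [/\ measurable_fun setT p, (forall x, 0 <= p x <= 1) &
  `|ev (fun x => psi (gamma t x / rest s x, gamma s x / rest s x) *
     (f (gamma t x / rest s x) * h (stopinc s u x / rest s x) * \1_(live s) x)) -
    ev (fun x => p (gamma t x / rest s x) *
     (f (gamma t x / rest s x) * h (stopinc s u x / rest s x) * \1_(live s) x))| <= ev (err1 t s)].
Proof.
move=> ts mpsi psi01 mf f01 mh h01 p; have /andP[t0 ts'] := ts.
have s0 : 0 <= s by exact: le_trans ts'.
have mY := measurable_incr t0 s0.
have mpft := pres_future_measurable t0 s0.
pose k x := f (gamma t x / rest s x) * h (stopinc s u x / rest s x) * \1_(live s) x.
have k01 x : 0 <= k x <= 1.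
  by apply: mul01; [exact: mul01 | exact: indic01].
have gN : gmeas (pres_future t s) (rest s) by apply: gmeas_pres_future_future; exact: gmeas_rest.
have gX : gmeas (pres_future t s) (fun x => gamma t x / rest s x).
  by apply: measurable_fun_div => //; exact: gmeas_pres_future_gamma.
have gk : gmeas (pres_future t s) k.
  apply: measurable_funM; last by apply: gmeas_pres_future_future; exact: gmeas_live.
  apply: measurable_funM; first exact: measurableT_comp.
  apply: (measurableT_comp mh); apply: measurable_fun_div => //.
  by apply: gmeas_pres_future_future; exact: gmeas_stopinc.
pose Z x := (gamma t x / rest s x, (rest s x, k x)).
have gZ : gmeas (pres_future t s) Z.
  by apply/measurable_fun_pairP; split => //; apply/measurable_fun_pairP; split.
have mZ : measurable_fun setT Z by exact: (gmeas_measurable mpft gZ).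
have ind A B : measurable A -> measurable B ->
    P ((fun x => gamma s x - gamma t x) @^-1` A `&` Z @^-1` B) =
    (P ((fun x => gamma s x - gamma t x)%R @^-1` A) * P (Z @^-1` B))%E.
  by move=> mA mB; apply: incr_indep => //; exact: (gmeas_preimage gZ mB).
pose F1 (q : R * (R * (R * R))) := psi (q.2.1, q.2.1 + q.1 / q.2.2.1) * clamp01 q.2.2.2.
pose F2 (q : R * (R * (R * R))) := psi (q.2.1, q.2.1 + q.1) * clamp01 q.2.2.2.
have m1 : measurable_fun setT (fun q : R * (R * (R * R)) => q.1) by exact: measurable_fst.
have m2 : measurable_fun setT (fun q : R * (R * (R * R)) => q.2) by exact: measurable_snd.
have m21 : measurable_fun setT (fun q : R * (R * (R * R)) => q.2.1).
  exact: (measurableT_comp measurable_fst m2).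
have m22 : measurable_fun setT (fun q : R * (R * (R * R)) => q.2.2).
  exact: (measurableT_comp measurable_snd m2).
have m221 : measurable_fun setT (fun q : R * (R * (R * R)) => q.2.2.1).
  exact: (measurableT_comp measurable_fst m22).
have m222 : measurable_fun setT (fun q : R * (R * (R * R)) => q.2.2.2).
  exact: (measurableT_comp measurable_snd m22).
have mcl : measurable_fun setT (fun q : R * (R * (R * R)) => clamp01 q.2.2.2).
  exact: (measurableT_comp measurable_clamp01 m222).
have mF1 : measurable_fun setT F1.
  apply: measurable_funM => //; apply: (measurableT_comp mpsi).
  apply/measurable_fun_pairP; split => //; apply: measurable_funD => //.
  exact: measurable_fun_div.
have mF2 : measurable_fun setT F2.
  apply: measurable_funM => //; apply: (measurableT_comp mpsi).
  by apply/measurable_fun_pairP; split => //; exact: measurable_funD.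
have F101 q : 0 <= F1 q <= 1 by apply: mul01 => //; exact: clamp01_itv.
have F201 q : 0 <= F2 q <= 1 by apply: mul01 => //; exact: clamp01_itv.
have [mq1 E1] := indep_fubini mY mZ ind mF1 F101.
have [mq2 E2] := indep_fubini mY mZ ind mF2 F201.
have p01 x : 0 <= p x <= 1.
  apply: ev01 => // ; apply: (measurableT_comp mpsi).
  apply/measurable_fun_pairP; split; first exact: measurable_cst.
  by apply: measurable_funD => //; exact: measurable_cst.
(* Read off from the partial expectation of [F2], with the value 1 put in the remaining
   coordinates. *)
have mp : measurable_fun setT p.
  have mc : measurable_fun setT (fun x : R => (x, (1 : R, 1 : R))).
    apply/measurable_fun_pairP; split; first exact: measurable_id.
    exact: measurable_cst.
  have := measurableT_comp mq2 mc; apply: eq_measurable_fun => x _ /=.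
  apply: eq_ev => y; rewrite /F2 /= clamp01E ?mulr1// ?lexx ?ler01//.
split => //.
have mpsi2 (x : R) : measurable_fun setT (fun y : R => psi (x, x + y)).
  apply: (measurableT_comp mpsi); apply/measurable_fun_pairP; split; first exact: measurable_cst.
  by apply: measurable_funD; [exact: measurable_cst | exact: measurable_id].
rewrite (_ : ev (fun x => psi (gamma t x / rest s x, gamma s x / rest s x) * _) =
    ev (fun x => F1 (gamma s x - gamma t x, Z x))); last first.
  apply: eq_ev => x; rewrite /F1 /Z /= clamp01E//; congr (psi (_, _) * _).
  by rewrite -mulrDl addrC subrK.
rewrite E1 (_ : ev (fun x => p (gamma t x / rest s x) * _) =
    ev (fun y => ev (fun x => F2 (gamma s x - gamma t x, Z y)))); last first.
  apply: eq_ev => y; rewrite /F2 /Z /= clamp01E// evZr//.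
  by apply: bmfun01 => //; exact: (measurableT_comp (mpsi2 _) mY).
have bq (F : R * (R * (R * R)) -> R) : measurable_fun setT F -> (forall q, 0 <= F q <= 1) ->
    measurable_fun setT (fun z => ev (fun x => F (gamma s x - gamma t x, z))) ->
    bmfun (fun y => ev (fun x => F (gamma s x - gamma t x, Z y))).
  move=> mF F01 mq; apply: bmfun01; first exact: (measurableT_comp mq mZ).
  move=> y; apply: ev01 => //; apply: (measurableT_comp mF).
  by apply/measurable_fun_pairP; split => //; exact: measurable_cst.
have b1 := bq _ mF1 F101 mq1; have b2 := bq _ mF2 F201 mq2.
rewrite -evB//; apply: (le_trans (le_norm_ev P _)); first exact: bmfunB.
apply: le_ev; [by apply: bmfun_abs; exact: bmfunB | exact: bmfun_err1|].
move=> y.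
have mpsin (x n : R) : measurable_fun setT (fun z => psi (x, x + (gamma s z - gamma t z) / n)).
  apply: (measurableT_comp (mpsi2 x)); apply: measurable_funM => //; exact: measurable_cst.
rewrite (_ : ev (fun x => F1 (gamma s x - gamma t x, Z y)) =
   ev (fun z => psi (gamma t y / rest s y, gamma t y / rest s y + (gamma s z - gamma t z) / rest s y)) * k y); last first.
  rewrite -evZr; first by apply: eq_ev => z; rewrite /F1 /Z /= clamp01E.
  exact: bmfun01.
rewrite (_ : ev (fun x => F2 (gamma s x - gamma t x, Z y)) =
   ev (fun z => psi (gamma t y / rest s y, gamma t y / rest s y + (gamma s z - gamma t z))) * k y); last first.
  rewrite -evZr; first by apply: eq_ev => z; rewrite /F2 /Z /= clamp01E.
  by apply: bmfun01 => //; exact: (measurableT_comp (mpsi2 _) mY).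
rewrite -mulrBl normrM /err1.
have [Dy|nDy] := pselect (live s y); last first.
  by rewrite /k !(indicE _ (live s)) memNset// mulr0 normr0 mulr0 mul0r.
have [_ N0] := Dy; rewrite (indicE _ (live s)) mem_set// mul1r.
have /andP[k0 k1] := k01 y; rewrite (ger0_norm k0).
apply: le_trans (ler_piMr _ k1) _ => //; rewrite le_min; apply/andP; split.
  apply: dist01; apply: ev01 => //.
  exact: (measurableT_comp (mpsi2 _) mY).
apply: (@gamma_scale_bound2 _ _ _ P (fun z => gamma s z - gamma t z) (s - t) (rest s y)
  (fun z => psi (gamma t y / rest s y, gamma t y / rest s y + z))) => //.
- by move=> x; exact: incr_ge0.
- by rewrite subr_ge0.
- by move=> l l0; exact: ev_lap.
Qed.

Lemma rest_le t s x : 0 <= t <= s -> alive s x -> rest s x <= rest t x.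
Proof.
move=> ts sx; have tx : t < tau x by apply: le_lt_trans sx; case/andP : ts.
by rewrite /rest (max_r (ltW sx)) (max_r (ltW tx)) lerD2l lerN2 gmono.
Qed.

(** [gamma t] is independent of the future after [t], which contains [rest s], [rest t] and the
    remaining factors. With these frozen, the two arguments of [q] differ by the factor
    [rest t / rest s >= 1] on [live s], and [gamma_scale_bound] applies with parameter [t]. *)
Lemma esscher_past t s u (q h : R -> R) :
  0 <= t <= s -> measurable_fun setT q -> (forall x, 0 <= q x <= 1) ->
  measurable_fun setT h -> (forall x, 0 <= h x <= 1) ->
  `|ev (fun x => q (gamma t x / rest s x) * (h (stopinc s u x / rest s x) * \1_(live s) x)) -
    ev (fun x => q (gamma t x / rest t x) * (h (stopinc s u x / rest s x) * \1_(live s) x))| <= ev (err2 t s).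
Proof.
move=> ts mq q01 mh h01; have /andP[t0 ts'] := ts.
have s0 : 0 <= s by exact: le_trans ts'.
have mY := mg t0.
pose k x := h (stopinc s u x / rest s x) * \1_(live s) x.
have k01 x : 0 <= k x <= 1 by apply: mul01 => //; exact: indic01.
have gk : gmeas (future s) k.
  apply: measurable_funM; last exact: gmeas_live.
  apply: (measurableT_comp mh); apply: measurable_fun_div; [exact: gmeas_stopinc | exact: gmeas_rest].
pose Z x := (rest s x, (rest t x, k x)).
have gZ : gmeas (future t) Z.
  apply/measurable_fun_pairP; split; first exact: gmeas_sub (future_sub ts') (gmeas_rest s0).
  apply/measurable_fun_pairP; split; first exact: gmeas_rest.
  exact: gmeas_sub (future_sub ts') gk.
have mZ : measurable_fun setT Z by exact: (gmeas_measurable (future_measurable t0) gZ).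
have ind A B : measurable A -> measurable B ->
    P (gamma t @^-1` A `&` Z @^-1` B) = (P (gamma t @^-1` A) * P (Z @^-1` B))%E.
  move=> mA mB; apply: (past_future_indep t0); last exact: (gmeas_preimage gZ mB).
  by apply: (gmeas_preimage (gmeas_past _) mA); rewrite t0 lexx.
pose F1 (z : R * (R * (R * R))) := q (z.1 / z.2.1) * clamp01 z.2.2.2.
pose F2 (z : R * (R * (R * R))) := q (z.1 / z.2.2.1) * clamp01 z.2.2.2.
have m1 : measurable_fun setT (fun q : R * (R * (R * R)) => q.1) by exact: measurable_fst.
have m2 : measurable_fun setT (fun q : R * (R * (R * R)) => q.2) by exact: measurable_snd.
have m21 : measurable_fun setT (fun q : R * (R * (R * R)) => q.2.1).
  exact: (measurableT_comp measurable_fst m2).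
have m22 : measurable_fun setT (fun q : R * (R * (R * R)) => q.2.2).
  exact: (measurableT_comp measurable_snd m2).
have m221 : measurable_fun setT (fun q : R * (R * (R * R)) => q.2.2.1).
  exact: (measurableT_comp measurable_fst m22).
have m222 : measurable_fun setT (fun q : R * (R * (R * R)) => q.2.2.2).
  exact: (measurableT_comp measurable_snd m22).
have mcl : measurable_fun setT (fun q : R * (R * (R * R)) => clamp01 q.2.2.2).
  exact: (measurableT_comp measurable_clamp01 m222).
have mF1 : measurable_fun setT F1.
  by apply: measurable_funM => //; apply: (measurableT_comp mq); exact: measurable_fun_div.
have mF2 : measurable_fun setT F2.
  by apply: measurable_funM => //; apply: (measurableT_comp mq); exact: measurable_fun_div.
have F101 z : 0 <= F1 z <= 1 by apply: mul01 => //; exact: clamp01_itv.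
have F201 z : 0 <= F2 z <= 1 by apply: mul01 => //; exact: clamp01_itv.
have [mq1 E1] := indep_fubini mY mZ ind mF1 F101.
have [mq2 E2] := indep_fubini mY mZ ind mF2 F201.
rewrite (_ : ev (fun x => q (gamma t x / rest s x) * _) = ev (fun x => F1 (gamma t x, Z x))); last first.
  by apply: eq_ev => x; rewrite /F1 /Z /= clamp01E.
rewrite (_ : ev (fun x => q (gamma t x / rest t x) * _) = ev (fun x => F2 (gamma t x, Z x))); last first.
  by apply: eq_ev => x; rewrite /F2 /Z /= clamp01E.
rewrite E1 E2.
have bq (F : R * (R * (R * R)) -> R) : measurable_fun setT F -> (forall q, 0 <= F q <= 1) ->
    measurable_fun setT (fun z => ev (fun x => F (gamma t x, z))) ->
    bmfun (fun y => ev (fun x => F (gamma t x, Z y))).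
  move=> mF F01 mq'; apply: bmfun01; first exact: (measurableT_comp mq' mZ).
  move=> y; apply: ev01 => //; apply: (measurableT_comp mF).
  by apply/measurable_fun_pairP; split => //; exact: measurable_cst.
have b1 := bq _ mF1 F101 mq1; have b2 := bq _ mF2 F201 mq2.
rewrite -evB//; apply: (le_trans (le_norm_ev P _)); first exact: bmfunB.
apply: le_ev; [by apply: bmfun_abs; exact: bmfunB | exact: bmfun_err2|].
move=> y.
have mqn (n : R) : measurable_fun setT (fun z => q (gamma t z / n)).
  by apply: (measurableT_comp mq); apply: measurable_funM => //; exact: measurable_cst.
rewrite (_ : ev (fun x => F1 (gamma t x, Z y)) = ev (fun z => q (gamma t z / rest s y)) * k y); last first.
  rewrite -evZr; first by apply: eq_ev => z; rewrite /F1 /Z /= clamp01E.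
  exact: bmfun01.
rewrite (_ : ev (fun x => F2 (gamma t x, Z y)) = ev (fun z => q (gamma t z / rest t y)) * k y); last first.
  rewrite -evZr; first by apply: eq_ev => z; rewrite /F2 /Z /= clamp01E.
  exact: bmfun01.
rewrite -mulrBl normrM /err2.
have [Dy|nDy] := pselect (live s y); last first.
  by rewrite /k !(indicE _ (live s)) memNset// mulr0 normr0 mulr0 mul0r.
have [ay N0] := Dy; rewrite (indicE _ (live s)) mem_set// mul1r.
have /andP[k0 k1] := k01 y; rewrite (ger0_norm k0).
apply: le_trans (ler_piMr _ k1) _ => //; rewrite le_min; apply/andP; split.
  by apply: dist01; apply: ev01.
have Nle := rest_le ts ay.
have Nt0 : 0 < rest t y by exact: lt_le_trans Nle.
have C1 : 1 <= rest t y / rest s y by rewrite ler_pdivlMr// mul1r.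
have mqs : measurable_fun setT (fun z : R => q (z / rest s y)).
  by apply: (measurableT_comp mq); apply: measurable_funM => //; exact: measurable_cst.
have := @gamma_scale_bound _ _ _ P (gamma t) t (rest t y / rest s y) (fun z => q (z / rest s y))
  mY (fun x => gamma_ge0 x t0) t0 C1 (fun lam => lap_gamma t0) mqs (fun x => q01 _).
rewrite distrC; apply: le_trans; rewrite le_eqVlt; apply/orP; left; apply/eqP.
congr (`|_ - _|); apply: eq_ev => x; congr q.
by field; rewrite !gt_eqF.
Qed.

(** One [p] serves for all [f] and [h]; the monotone class argument on the test functions depends on
    this uniformity. *)
Lemma filtration_step t s u A : 0 <= t <= s -> Fzc P gamma tau s A ->
  exists p : R -> R, [/\ measurable_fun setT p, (forall x, 0 <= p x <= 1) &
  forall f h : R -> R, measurable_fun setT f -> (forall x, 0 <= f x <= 1) ->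
  measurable_fun setT h -> (forall x, 0 <= h x <= 1) ->
  `|ev (fun x => \1_A x * (f (gamma t x / rest s x) * h (stopinc s u x / rest s x) * \1_(live s) x)) -
    ev (fun x => p (gamma t x / rest t x) * (f (gamma t x / rest t x) * (h (stopinc s u x / rest s x) * \1_(live s) x)))|
  <= ev (err1 t s) + ev (err2 t s)].
Proof.
move=> ts sA; have /andP[t0 ts'] := ts.
have s0 : 0 <= s by exact: le_trans ts'.
have mN := measurable_rest s0.
have mZ : measurable_fun setT (fun x => (gamma t x / rest s x, gamma s x / rest s x)).
  by apply/measurable_fun_pairP; split; apply: measurable_fun_div => //; exact: mg.
have mA := Fzc_measurable sA.
have [psi [mpsi psi01 psiE]] := cond_exp_exists_on P mZ (@measurable_indic _ T R setT A mA)
   (fun x => @indic01 R _ A x) (live_measurable s0).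
pose p x := ev (fun y => psi (x, x + (gamma s y - gamma t y))).
(* Constant test functions suffice here: only the properties of [p] are extracted, and these do not
   involve [f] and [h]. *)
have [mp p01 _] := @esscher_incr t s u psi (fun=> 1) (fun=> 1) ts mpsi psi01
  (measurable_cst _) (fun _ => introT andP (conj ler01 (lexx 1)))
  (measurable_cst _) (fun _ => introT andP (conj ler01 (lexx 1))).
exists p; split => // f h mf f01 mh h01.
rewrite (filtration_step1 u ts sA mpsi psi01 psiE mf f01 mh h01).
have [_ _ e1] := esscher_incr u ts mpsi psi01 mf f01 mh h01.
have mpf : measurable_fun setT (fun x => p x * f x) by exact: measurable_funM.
have e2 := esscher_past u ts mpf (fun x => mul01 (p01 x) (f01 x)) mh h01.
apply: le_trans (lerD e1 e2); rewrite -/p.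
rewrite (_ : ev (fun x => p (gamma t x / rest s x) * _) =
  ev (fun x => p (gamma t x / rest s x) * f (gamma t x / rest s x) *
     (h (stopinc s u x / rest s x) * \1_(live s) x))); last by apply: eq_ev => x; ring.
rewrite (_ : ev (fun x => p (gamma t x / rest t x) * _) =
  ev (fun x => p (gamma t x / rest t x) * f (gamma t x / rest t x) *
     (h (stopinc s u x / rest s x) * \1_(live s) x))); last by apply: eq_ev => x; ring.
apply: le_trans (ler_normD _ _); rewrite le_eqVlt; apply/orP; left; apply/eqP.
by congr `|_|; ring.
Qed.

(** * Passage to the right limit along a sequence *)

Section germ.
Context (t : R) (sn : nat -> R).
Context (t0 : 0 <= t) (snt : forall n, t < sn n) (sncvg : sn @ \oo --> t).

Let sn0 n : 0 <= sn n. Proof. exact: le_trans (ltW (snt n)). Qed.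
Let tsn n : 0 <= t <= sn n. Proof. by rewrite t0 ltW. Qed.

Lemma gamma_sn w : (fun n => gamma (sn n) w) @ \oo --> gamma t w.
Proof.
by have /cvg_at_rightP /(_ sn) := @grc w t t0; apply; split.
Qed.

Lemma rest_sn w : t < tau w -> (fun n => rest (sn n) w) @ \oo --> rest t w.
Proof.
move=> tw; apply: (@cvg_near_eq R _ (fun n => gamma (tau w) w - gamma (sn n) w)).
  have h : \forall n \near \oo, sn n < tau w by apply: (cvgr_lt _ sncvg).
  apply: filterS h => n sw.
  by rewrite /rest max_r// ltW.
rewrite /rest max_r ?ltW//; apply: cvgB; first exact: cvg_cst.
exact: gamma_sn.
Qed.

Lemma stopinc_sn u w : t < u -> t < tau w -> (fun n => stopinc (sn n) u w) @ \oo --> stopinc t u w.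
Proof.
move=> tu tw; have tm : t < Num.min u (tau w) by rewrite lt_min tu.
apply: (@cvg_near_eq R _ (fun n => gamma (Num.min u (tau w)) w - gamma (sn n) w)).
  have h : \forall n \near \oo, sn n < Num.min u (tau w) by apply: (cvgr_lt _ sncvg).
  apply: filterS h => n sw.
  by rewrite /stopinc max_r// ltW.
rewrite /stopinc max_r ?ltW//; apply: cvgB; first exact: cvg_cst.
exact: gamma_sn.
Qed.

Lemma live_near w : live t w -> \forall n \near \oo, live (sn n) w.
Proof.
move=> [tw N0]; have h1 : \forall n \near \oo, sn n < tau w by apply: (cvgr_lt _ sncvg).
have h2 : \forall n \near \oo, 0 < rest (sn n) w by apply: (cvgr_gt _ (rest_sn tw)).
by apply: filterS2 h1 h2 => n; split.
Qed.

Lemma not_alive_sn w n : ~ t < tau w -> \1_(live (sn n)) w = 0 :> R.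
Proof.
move=> tw; rewrite indicE memNset// => -[sw _]; apply: tw.
exact: lt_trans (snt n) sw.
Qed.

Lemma live_sn : {ae P, forall w, (fun n => \1_(live (sn n)) w : R) @ \oo --> (\1_(live t) w : R)}.
Proof.
apply: filterS (rest_pos t0) => w hw; have [tw|tw] := pselect (t < tau w).
  have Dw : live t w by split => //; exact: hw.
  rewrite (indicE _ (live t)) mem_set//.
  apply: (@cvg_near_eq R _ (fun=> 1)); last exact: cvg_cst.
  by apply: filterS (live_near Dw) => n Dn; rewrite indicE mem_set.
rewrite (indicE _ (live t)) memNset; last by move=> [].
apply: (@cvg_near_eq R _ (fun=> 0)); last exact: cvg_cst.
by apply: nearW => n; exact: not_alive_sn.
Qed.

(** The cap at 1 in the error provides the domination; pointwise the base stays bounded while the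
    exponent [sn n - t] tends to 0. *)
Lemma err1_sn : (fun n => ev (err1 t (sn n))) @ \oo --> (0 : R).
Proof.
rewrite -[X in _ --> X](ev_cst P); apply: (@ev_cvg _ _ _ P _ _ 1).
- by move=> n; have [] := bmfun_err1 t (sn0 n).
- exact: measurable_cst.
- by move=> n x; apply: norm_err; [exact: powR_ge0 | exact: indic01].
apply: filterS (rest_pos t0) => w hw; have [tw|tw] := pselect (t < tau w); last first.
  apply: (@cvg_near_eq R _ (fun=> 0)); last exact: cvg_cst.
  by apply: nearW => n; rewrite /err1 not_alive_sn// mul0r.
have N0 := hw tw; have Dw : live t w by split.
(* Eventually [rest (sn n) w] lies between half of [rest t w] and [rest t w], so [K] bounds both it
   and its inverse. *)
pose K := Num.max (rest t w) (rest t w / 2)^-1.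
have K0 : 0 < K by rewrite lt_max N0.
have cK : (fun n => K `^ (sn n - t) - 1) @ \oo --> (0 : R).
  rewrite [X in _ --> X](_ : 0 = 1 - 1 :> R); last by rewrite subrr.
  apply: cvgB; last exact: cvg_cst.
  have -> : (fun n => K `^ (sn n - t)) = (fun n => expR ((sn n - t) * ln K)).
    by apply/funext => n; rewrite /powR gt_eqF.
  rewrite [X in _ --> X](_ : 1 = expR (0 * ln K)); last by rewrite mul0r expR0.
  apply: (@cvg_comp _ _ _ (fun n => (sn n - t) * ln K) (@expR R)); last exact: continuous_expR.
  apply: cvgM; last exact: cvg_cst.
  by rewrite -(subrr t); apply: cvgB => //; exact: cvg_cst.
apply: (@squeeze_cvgr _ _ _ _ (fun=> 0) (fun n => K `^ (sn n - t) - 1)) => //; last exact: cvg_cst.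
have N2 : rest t w / 2 < rest t w by lra.
have h2 : \forall n \near \oo, rest t w / 2 < rest (sn n) w by apply: (cvgr_gt _ (rest_sn tw)).
near=> n.
have [an Nn] : live (sn n) w by near: n; exact: live_near.
have hn : rest t w / 2 < rest (sn n) w by near: n.
rewrite /err1 indicE mem_set// mul1r.
have C1 : 1 <= Num.max (rest (sn n) w) (rest (sn n) w)^-1.
  rewrite le_max; have [//|l1] := leP 1 (rest (sn n) w).
  by rewrite /= invf_ge1// ltW.
have a0 : 0 <= sn n - t by rewrite subr_ge0 ltW.
apply/andP; split.
  by rewrite le_min ler01 /= subr_ge0 powR_ge1.
rewrite ge_min; apply/orP; right; rewrite lerD2r.
apply: ge0_ler_powR => //; rewrite ?nnegrE ?(ltW K0) ?(le_trans ler01)//.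
rewrite ge_max /K !le_max; apply/andP; split.
  by rewrite (rest_le (tsn n) an).
apply/orP; right; rewrite lef_pV2 ?posrE//; first exact: ltW.
by rewrite divr_gt0.
Unshelve. all: by end_near. Qed.

(** Here the exponent [t] is fixed and it is the base [rest t / rest (sn n)] that tends to 1. *)
Lemma err2_sn : (fun n => ev (err2 t (sn n))) @ \oo --> (0 : R).
Proof.
rewrite -[X in _ --> X](ev_cst P); apply: (@ev_cvg _ _ _ P _ _ 1).
- by move=> n; have [] := bmfun_err2 t0 (sn0 n).
- exact: measurable_cst.
- by move=> n x; apply: norm_err; [exact: powR_ge0 | exact: indic01].
apply: filterS (rest_pos t0) => w hw; have [tw|tw] := pselect (t < tau w); last first.
  apply: (@cvg_near_eq R _ (fun=> 0)); last exact: cvg_cst.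
  by apply: nearW => n; rewrite /err2 not_alive_sn// mul0r.
have N0 := hw tw; have Dw : live t w by split.
have cC : (fun n => rest t w / rest (sn n) w) @ \oo --> (1 : R).
  rewrite -[X in _ --> X](divff (lt0r_neq0 N0)); apply: cvgM; first exact: cvg_cst.
  by apply: cvgV; [rewrite gt_eqF | exact: rest_sn].
have cK : (fun n => expR (t * ln (rest t w / rest (sn n) w)) - 1) @ \oo --> (0 : R).
  rewrite [X in _ --> X](_ : 0 = 1 - 1 :> R); last by rewrite subrr.
  apply: cvgB; last exact: cvg_cst.
  rewrite [X in _ --> X](_ : 1 = expR (t * ln 1)); last by rewrite ln1 mulr0 expR0.
  apply: (@cvg_comp _ _ _ (fun n => t * ln (rest t w / rest (sn n) w)) (@expR R)); last exact: continuous_expR.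
  apply: cvgM; first exact: cvg_cst.
  by apply: (@cvg_comp _ _ _ (fun n => rest t w / rest (sn n) w) (@ln R)); [exact: cC | apply: continuous_ln; exact: ltr01].
apply: (@squeeze_cvgr _ _ _ _ (fun=> 0) (fun n => expR (t * ln (rest t w / rest (sn n) w)) - 1)) => //; last exact: cvg_cst.
near=> n.
have [an Nn] : live (sn n) w by near: n; exact: live_near.
have C1 : 1 <= rest t w / rest (sn n) w.
  by rewrite ler_pdivlMr// mul1r; exact: (rest_le (tsn n) an).
have C0 : 0 < rest t w / rest (sn n) w by exact: lt_le_trans C1.
have -> : expR (t * ln (rest t w / rest (sn n) w)) = (rest t w / rest (sn n) w) `^ t.
  by rewrite /powR gt_eqF.
rewrite /err2 indicE mem_set// mul1r; apply/andP; split.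
  by rewrite le_min ler01 /= subr_ge0 powR_ge1.
by rewrite ge_min lexx orbT.
Unshelve. all: by end_near. Qed.

(** Nothing but boundedness is known of the [p n], so the test functions at time [sn n] are replaced
    by those at time [t] in mean: the expected absolute difference tends to 0, whatever factors
    bounded by 1 multiply it. *)
Lemma germ_cvg u A (p : nat -> R -> R) (f h : R -> R) : t < u ->
  measurable A ->
  (forall n, measurable_fun setT (p n)) -> (forall n x, 0 <= p n x <= 1) ->
  measurable_fun setT f -> (forall x, 0 <= f x <= 1) ->
  measurable_fun setT h -> (forall x, 0 <= h x <= 1) ->
  (forall n, `|ev (fun x => \1_A x * (f (gamma t x / rest (sn n) x) *
       h (stopinc (sn n) u x / rest (sn n) x) * \1_(live (sn n)) x)) -
    ev (fun x => p n (gamma t x / rest t x) * (f (gamma t x / rest t x) *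
       (h (stopinc (sn n) u x / rest (sn n) x) * \1_(live (sn n)) x)))|
    <= ev (err1 t (sn n)) + ev (err2 t (sn n))) ->
  (forall w, live t w ->
    ((fun n => f (gamma t w / rest (sn n) w)) @ \oo --> f (gamma t w / rest t w)) /\
    ((fun n => h (stopinc (sn n) u w / rest (sn n) w)) @ \oo --> h (stopinc t u w / rest t w))) ->
  (fun n => ev (fun x => (p n (gamma t x / rest t x) - \1_A x) * \1_(live t) x *
     (f (gamma t x / rest t x) * h (stopinc t u x / rest t x)))) @ \oo --> (0 : R).
Proof.
move=> tu mA mp p01 mf f01 mh h01 step cvfh.
pose X0 x := gamma t x / rest t x.
pose fn n x := f (gamma t x / rest (sn n) x).
pose hn n x := h (stopinc (sn n) u x / rest (sn n) x).
pose dn n x : R := \1_(live (sn n)) x.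
have mX0 : measurable_fun setT X0.
  by apply: measurable_fun_div; [exact: mg | exact: measurable_rest].
have bA : bmfun (\1_A : T -> R) by exact: bmfun_indic.
have bp n : bmfun (fun x => p n (X0 x)) by apply: bmfun01 => //; exact: measurableT_comp.
have bf : bmfun (fun x => f (X0 x)) by apply: bmfun01 => //; exact: measurableT_comp.
have bh : bmfun (fun x => h (stopinc t u x / rest t x)).
  apply: bmfun01 => //; apply: (measurableT_comp mh); apply: measurable_fun_div.
    exact: measurable_stopinc.
  exact: measurable_rest.
have bd : bmfun (\1_(live t) : T -> R) by apply: bmfun_indic; exact: live_measurable.
have bfn n : bmfun (fn n).
  apply: bmfun01; last by move=> x; exact: f01.
  apply: (measurableT_comp mf); apply: measurable_fun_div; first exact: mg.
  exact: (measurable_rest (sn0 n)).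
have bhn n : bmfun (hn n).
  apply: bmfun01; last by move=> x; exact: h01.
  rewrite /hn; apply: (measurableT_comp mh); apply: measurable_fun_div; first exact: (measurable_stopinc u (sn0 n)).
  exact: (measurable_rest (sn0 n)).
have bdn n : bmfun (dn n) by apply: bmfun_indic; exact: (live_measurable (sn0 n)).
pose H x := h (stopinc t u x / rest t x) * \1_(live t) x.
pose Hn n x := hn n x * dn n x.
pose G x := f (X0 x) * H x.
pose Gn n x := fn n x * Hn n x.
have bH : bmfun H by exact: bmfunM.
have bHn n : bmfun (Hn n) by exact: bmfunM.
have bG : bmfun G by exact: bmfunM.
have bGn n : bmfun (Gn n) by exact: bmfunM.
have H01 x : 0 <= H x <= 1 by apply: mul01; [exact: h01 | exact: indic01].
have Hn01 n x : 0 <= Hn n x <= 1 by apply: mul01; [exact: h01 | exact: indic01].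
have G01 x : 0 <= G x <= 1 by apply: mul01; [exact: f01 | exact: H01].
have Gn01 n x : 0 <= Gn n x <= 1 by apply: mul01; [exact: f01 | exact: Hn01].
have [cH cG] : (fun n => ev (fun x => `|Hn n x - H x|)) @ \oo --> (0 : R) /\
   (fun n => ev (fun x => `|Gn n x - G x|)) @ \oo --> (0 : R).
  have cvd (k : T -> R) (kn : nat -> T -> R) : bmfun k -> (forall n, bmfun (kn n)) ->
    (forall x, 0 <= k x <= 1) -> (forall n x, 0 <= kn n x <= 1) ->
    {ae P, forall x, (fun n => kn n x) @ \oo --> k x} ->
    (fun n => ev (fun x => `|kn n x - k x|)) @ \oo --> (0 : R).
    move=> bk bkn k01 kn01 ck; rewrite -[X in _ --> X](ev_cst P).
    apply: (@ev_cvg _ _ _ P _ _ 1).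
    - by move=> n; have [] := bmfun_abs (bmfunB (bkn n) bk).
    - exact: measurable_cst.
    - by move=> n x; rewrite normr_id; exact: dist01.
    - apply: filterS ck => x cx; rewrite -(normr0 R); apply: cvg_norm.
      by rewrite -(subrr (k x)); apply: cvgB => //; exact: cvg_cst.
  have hd : {ae P, forall x, ((fun n => Hn n x) @ \oo --> H x) /\ ((fun n => Gn n x) @ \oo --> G x)}.
    apply: filterS2 live_sn (rest_pos t0) => x cd hx.
    have [tx|tx] := pselect (t < tau x).
      have Dx : live t x by split => //; exact: hx.
      have [cf ch] := cvfh x Dx.
      have cHx : (fun n => Hn n x) @ \oo --> H x by exact: cvgM.
      by split => //; exact: cvgM.
    have H0 : H x = 0 by rewrite /H (indicE _ (live t)) memNset ?mulr0// => -[].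
    have Hn0 n : Hn n x = 0 by rewrite /Hn /dn not_alive_sn// mulr0.
    rewrite /G H0 mulr0; split; apply: (@cvg_near_eq R _ (fun=> 0)); try exact: cvg_cst.
      by apply: nearW.
    by apply: nearW => n; rewrite /Gn Hn0 mulr0.
  split; apply: cvd => //; apply: filterS hd => x; by case.
apply/norm_cvg0P.
apply: (@squeeze_cvgr _ _ _ _ (fun=> 0) (fun n => ev (fun x => `|Hn n x - H x|) +
   (ev (err1 t (sn n)) + ev (err2 t (sn n))) + ev (fun x => `|Gn n x - G x|))); last 2 first.
- exact: cvg_cst.
- rewrite [X in _ --> X](_ : 0 = 0 + (0 + 0) + 0 :> R); last by rewrite !addr0.
  apply: cvgD => //; apply: cvgD => //; apply: cvgD; [exact: err1_sn | exact: err2_sn].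
apply: nearW => n; rewrite normr_ge0 /=.
have b1 : bmfun (fun x => p n (X0 x) * (f (X0 x) * H x)) by apply: bmfunM.
have b2 : bmfun (fun x => p n (X0 x) * (f (X0 x) * Hn n x)) by apply: bmfunM => //; exact: bmfunM.
have b3 : bmfun (fun x => \1_A x * G x) by exact: bmfunM.
have b4 : bmfun (fun x => \1_A x * Gn n x) by exact: bmfunM.
(* Three moves: the future factor next to [p n], the estimate assumed in the hypothesis, both
   factors next to the indicator of [A]. The past factor next to [p n] is already taken at time
   [t]. *)
have -> : ev (fun x => (p n (gamma t x / rest t x) - \1_A x) * \1_(live t) x *
     (f (gamma t x / rest t x) * h (stopinc t u x / rest t x))) =
  (ev (fun x => p n (X0 x) * (f (X0 x) * H x)) - ev (fun x => p n (X0 x) * (f (X0 x) * Hn n x))) +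
  (ev (fun x => p n (X0 x) * (f (X0 x) * Hn n x)) - ev (fun x => \1_A x * Gn n x)) +
  (ev (fun x => \1_A x * Gn n x) - ev (fun x => \1_A x * G x)).
  transitivity (ev (fun x => p n (X0 x) * (f (X0 x) * H x)) - ev (fun x => \1_A x * G x)); last by ring.
  by rewrite -evB//; apply: eq_ev => x; rewrite /G /H /X0; ring.
rewrite (le_trans (ler_normD _ _))// lerD//; first rewrite (le_trans (ler_normD _ _))// lerD//.
- rewrite -evB// (le_trans (le_norm_ev P _))//; first exact: bmfunB.
  apply: le_ev; [by apply: bmfun_abs; exact: bmfunB | by apply: bmfun_abs; exact: bmfunB|].
  move=> x; rewrite -mulrBr -mulrBr !normrM distrC mulrA.
  have /andP[a0 a1] := p01 n (X0 x); have /andP[c0 c1] := f01 (X0 x).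
  by rewrite ler_piMl// (ger0_norm a0) (ger0_norm c0) mulr_ile1.
- rewrite distrC; apply: le_trans (step n); rewrite le_eqVlt; apply/orP; left; apply/eqP.
  congr (`|_ - _|); apply: eq_ev => x; rewrite /Gn /Hn /fn /hn /dn; ring.
- rewrite -evB// (le_trans (le_norm_ev P _))//; first exact: bmfunB.
  apply: le_ev; [by apply: bmfun_abs; exact: bmfunB | by apply: bmfun_abs; exact: bmfunB|].
  move=> x; rewrite -mulrBr normrM ler_piMl//.
  by have /andP[a0 a1] := @indic01 R _ A x; rewrite ger0_norm.
Qed.

(** [rest] decreases in time during life, so the ratio reaches its limit from above, the side
    required by [indic_lt_cvg]. *)
Lemma past_ratio_cvg w : live t w ->
  (fun n => gamma t w / rest (sn n) w) @ \oo --> gamma t w / rest t w /\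
  \forall n \near \oo, gamma t w / rest t w <= gamma t w / rest (sn n) w.
Proof.
move=> Dw; have [tw /= N0] := Dw; split.
  apply: cvgM; first exact: cvg_cst.
  by apply: cvgV; [rewrite gt_eqF | exact: rest_sn].
apply: filterS (live_near Dw) => n [an /= Nn].
apply: ler_wpM2l; first exact: gamma_ge0.
by rewrite lef_pV2 ?posrE//; exact: (rest_le (tsn n) an).
Qed.

(** Numerator and denominator both lose [gamma (sn n) - gamma t]. A fraction at most 1 decreases
    when its two terms lose the same amount, so the limit is reached from below, as [indic_gt_cvg]
    requires. *)
Lemma future_ratio_cvg u w : t < u -> live t w ->
  (fun n => stopinc (sn n) u w / rest (sn n) w) @ \oo --> stopinc t u w / rest t w /\
  \forall n \near \oo, stopinc (sn n) u w / rest (sn n) w <= stopinc t u w / rest t w.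
Proof.
move=> tu Dw; have [tw /= N0] := Dw; split.
  apply: cvgM; first exact: stopinc_sn.
  by apply: cvgV; [rewrite gt_eqF | exact: rest_sn].
have h : \forall n \near \oo, sn n < Num.min u (tau w).
  by apply: (cvgr_lt _ sncvg); rewrite lt_min tu.
apply: filterS2 h (live_near Dw) => n sm [an /= Nn].
have tm : t < Num.min u (tau w) by rewrite lt_min tu.
have gts : gamma t w <= gamma (sn n) w by exact: (gmono w (tsn n)).
have gmt : gamma (Num.min u (tau w)) w <= gamma (tau w) w.
  by apply: gmono; rewrite (le_trans t0 (ltW tm)) ge_min lexx orbT.
have an' : sn n <= tau w by exact: ltW an.
have tw' : t <= tau w by exact: ltW tw.
move: N0 Nn; rewrite /stopinc /rest (max_r (ltW sm)) (max_r (ltW tm)) (max_r an') (max_r tw') => N0 Nn.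
rewrite ler_pdivrMr// mulrAC ler_pdivlMr//; nra.
Qed.

(** The kernels come from [filtration_step] before any test function is chosen, so [sigma_cvg] can
    extend the limit from rays to every bounded [F]. *)
Lemma germ_joint u A : t < u -> Fzc_plus P gamma tau t A ->
  exists p : nat -> R -> R, [/\ forall n, measurable_fun setT (p n),
    (forall n x, 0 <= p n x <= 1) &
    forall F : R * R -> R, measurable_fun setT F -> (exists K, forall z, `|F z| <= K) ->
    (fun n => ev (fun x => (p n (gamma t x / rest t x) - \1_A x) * \1_(live t) x *
       F (gamma t x / rest t x, stopinc t u x / rest t x))) @ \oo --> (0 : R)].
Proof.
move=> tu tA; have mA : measurable A := Fzc_measurable (tA _ (snt 0)).
have /choice[p hp] := fun n => filtration_step u (tsn n) (tA _ (snt n)).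
have mp n : measurable_fun setT (p n) by have [] := hp n.
have p01 n : forall x, 0 <= p n x <= 1 by have [] := hp n.
exists p; split => // F mF bF.
pose X0 x := gamma t x / rest t x; pose R0 x := stopinc t u x / rest t x.
have mX0 : measurable_fun setT X0.
  by apply: measurable_fun_div; [exact: mg | exact: measurable_rest].
have mR0 : measurable_fun setT R0.
  by apply: measurable_fun_div; [exact: measurable_stopinc | exact: measurable_rest].
(* Left rays for the past ratio, right rays for the future one: the orientations match the sides
   from which the ratios converge. *)
pose ray1 (B : set R) := B = setT \/ exists x, B = [set z | z < x].
pose ray2 (B : set R) := B = setT \/ exists x, B = [set z | x < z].
have mray1 B : ray1 B -> measurable B.
  by move=> [->//|[x ->]]; rewrite (_ : [set z | z < x] = `]-oo, x[%classic)//.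
have mray2 B : ray2 B -> measurable B.
  move=> [->//|[x ->]]; rewrite (_ : [set z | x < z] = `]x, +oo[%classic)//.
  by apply/seteqP; split => z /=; rewrite in_itv /= andbT.
pose Pi := [set S | exists B1 B2, [/\ ray1 B1, ray2 B2 & S = X0 @^-1` B1 `&` R0 @^-1` B2]].
have ray1T : ray1 setT by left. have ray2T : ray2 setT by left.
have PiT : Pi setT by exists setT, setT; split => //; rewrite !preimage_setT setIT.
have cvf B : ray1 B -> forall w, live t w ->
    (fun n => \1_B (gamma t w / rest (sn n) w) : R) @ \oo --> (\1_B (gamma t w / rest t w) : R).
  move=> [->|[x ->]] w Dw; last by have [] := past_ratio_cvg Dw; exact: indic_lt_cvg.
  by rewrite indicT; exact: cvg_cst.
have cvh B : ray2 B -> forall w, live t w ->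
    (fun n => \1_B (stopinc (sn n) u w / rest (sn n) w) : R) @ \oo --> (\1_B (stopinc t u w / rest t w) : R).
  move=> [->|[x ->]] w Dw; last by have [] := future_ratio_cvg tu Dw; exact: indic_gt_cvg.
  by rewrite indicT; exact: cvg_cst.
have mD : measurable (live t) by exact: live_measurable.
apply: (@sigma_cvg _ _ _ P Pi
  (fun n x => (p n (X0 x) - \1_A x) * \1_(live t) x) (fun x => F (X0 x, R0 x)) 1).
- move=> _ _ [B1 [B2 [r1 r2 ->]]] [C1 [C2 [q1 q2 ->]]].
  exists (B1 `&` C1), (B2 `&` C2); split.
  + case: r1 => [->|[x ->]]; first by rewrite setTI.
    case: q1 => [->|[y ->]]; first by rewrite setIT; right; exists x.
    right; exists (Num.min x y); apply/seteqP; split => z /=; rewrite lt_min; first by case=> -> ->.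
    by move=> /andP[].
  + case: r2 => [->|[x ->]]; first by rewrite setTI.
    case: q2 => [->|[y ->]]; first by rewrite setIT; right; exists x.
    right; exists (Num.max x y); apply/seteqP; split => z /=; rewrite gt_max; first by case=> -> ->.
    by move=> /andP[].
  + by rewrite !preimage_setI setIACA.
- move=> _ [B1 [B2 [r1 r2 ->]]]; apply: measurableI; rewrite -[X in measurable X]setTI.
    by apply: mX0 => //; exact: mray1.
  by apply: mR0 => //; exact: mray2.
- move=> n; apply: measurable_funM; last exact: measurable_indic.
  by apply: measurable_funB; [exact: measurableT_comp | exact: measurable_indic].
- move=> n x; rewrite normrM mulr_ile1//.
    by apply: dist01; [exact: p01 | exact: indic01].
  by have /andP[a0 a1] := @indic01 R _ (live t) x; rewrite ger0_norm.
- move=> S hS; have [B1 [B2 [r1 r2 ->]]] : Pi S by case: hS => [//|->].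
  have := @germ_cvg u A p (\1_B1) (\1_B2) tu mA mp p01
    (measurable_indic (mray1 _ r1)) (fun x => @indic01 R _ B1 x)
    (measurable_indic (mray2 _ r2)) (fun x => @indic01 R _ B2 x).
  have hst n := let: And3 _ _ hn := hp n in hn (\1_B1) (\1_B2)
    (measurable_indic (mray1 _ r1)) (fun x => @indic01 R _ B1 x)
    (measurable_indic (mray2 _ r2)) (fun x => @indic01 R _ B2 x).
  move=> /(_ hst) /(_ (fun w Dw => conj (cvf _ r1 w Dw) (cvh _ r2 w Dw))) cvg0.
  suff -> : (fun n => ev (fun x => (p n (X0 x) - \1_A x) * \1_(live t) x *
      \1_(X0 @^-1` B1 `&` R0 @^-1` B2) x)) =
    (fun n => ev (fun x => (p n (gamma t x / rest t x) - \1_A x) * \1_(live t) x *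
     (\1_B1 (gamma t x / rest t x) * \1_B2 (stopinc t u x / rest t x)))) by exact: cvg0.
  by apply/funext => n; apply: eq_ev => x; rewrite indicI /= !indicE.
- move=> B mB; rewrite (_ : _ @^-1` B = (fun x => (X0 x, R0 x)) @^-1` (F @^-1` B))//.
  have mFB : measurable (F @^-1` B) by rewrite -[X in measurable X]setTI; exact: mF.
  (* With one coordinate left free, the rays of the other generate the Borel sets; hence the pair is
     measurable for the sigma-algebra of [Pi]. *)
  suff : gmeas Pi (fun x => (X0 x, R0 x)) by move=> /gmeas_preimage; apply.
  apply/measurable_fun_pairP; split.
    apply: (measurability _ (RGenInftyO.measurableE R)) => _ [_ [x ->] <-].
    rewrite setTI; apply: sub_sigma_algebra; exists [set z | z < x], setT; split => //.
      by right; exists x.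
    by rewrite preimage_setT setIT; congr (_ @^-1` _).
  apply: (measurability _ (RGenOInfty.measurableE R)) => _ [_ [x ->] <-].
  rewrite setTI; apply: sub_sigma_algebra; exists setT, [set z | x < z]; split => //.
    by right; exists x.
  rewrite preimage_setT setTI; congr (_ @^-1` _).
  by apply/seteqP; split => z /=; rewrite in_itv /= andbT.
- by case: bF => K FK; exists K => x; exact: FK.
Qed.

End germ.

(** * The Markov property for the right-limit filtration *)

Lemma zeta_dead t : 0 <= t ->
  {ae P, forall w, ~ live t w -> forall v, t <= v -> zeta gamma tau v w = 1}.
Proof.
move=> t0; apply: filterS2 (rest_pos t0) (rest_pos (lexx 0)) => w hw h0 nD v tv.
have vw : tau w <= v.
  apply: le_trans tv; rewrite leNgt; apply/negP => tw; apply: nD; split => //.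
  exact: hw.
(* The quotient is 1, and not the default value 0, because [gamma] is positive at [tau]: this is
   [rest_pos] at time 0. *)
rewrite /zeta (min_r vw) divff//.
by have := h0 (tau_gt0 w); rewrite /rest (max_r (ltW (tau_gt0 w))) g0 subr0 => /lt0r_neq0.
Qed.

Lemma zeta_future t u w : 0 <= t -> t < u -> live t w ->
  zeta gamma tau u w = (gamma t w / rest t w + stopinc t u w / rest t w) / (1 + gamma t w / rest t w).
Proof.
move=> t0 tu [tw /= N0]; have gt0 := gamma_ge0 w t0.
rewrite /zeta (gamma_tau tw).
have -> : gamma (Num.min u (tau w)) w = gamma t w + stopinc t u w.
  by rewrite /stopinc max_r ?(addrC (gamma t w)) ?subrK// le_min (ltW tu) ltW.
by field; apply/andP; split; apply/lt0r_neq0; lra.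
Qed.

Lemma zeta_present t w : 0 <= t -> live t w ->
  zeta gamma tau t w = gamma t w / rest t w / (1 + gamma t w / rest t w) /\ zeta gamma tau t w < 1.
Proof.
move=> t0 [tw /= N0]; have gt0 := gamma_ge0 w t0; rewrite (zeta_alive (lexx t) tw).
have N1 : 0 < gamma t w + rest t w by lra.
split; first by field; apply/andP; split; apply/lt0r_neq0; lra.
by rewrite ltr_pdivrMr// mul1r; lra.
Qed.

(** Let [H] be [g (zeta u) - h (zeta t)], and split its integral over [A] along [live t]. On
    [live t], the sequence in [germ_joint] turns out not to depend on [n], so its limit 0 is its
    value; off [live t], [H] is almost surely the constant [g 1 - h 1]. *)
Lemma markov_germ01 t u (g : R -> R) : 0 <= t -> t < u ->
  measurable_fun setT g -> (forall x, 0 <= g x <= 1) ->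
  exists h : R -> R, [/\ measurable_fun setT h, (forall x, 0 <= h x <= 1) &
    forall A, Fzc_plus P gamma tau t A ->
      ev (fun x => g (zeta gamma tau u x) * \1_A x) = ev (fun x => h (zeta gamma tau t x) * \1_A x)].
Proof.
move=> t0 tu mgg g01; have u0 : 0 <= u by exact: le_trans (ltW tu).
have mzt := measurable_zeta t0; have mzu := measurable_zeta u0.
have mgz : measurable_fun setT (fun x => g (zeta gamma tau u x)) by exact: measurableT_comp.
have [h [mh h01 hE]] := cond_exp_exists P mzt mgz (fun x => g01 _).
exists h; split => // A tA.
pose H x := g (zeta gamma tau u x) - h (zeta gamma tau t x).
have bg : bmfun (fun x => g (zeta gamma tau u x)) by exact: bmfun01.
have bh : bmfun (fun x => h (zeta gamma tau t x)).
  by apply: bmfun01 => //; exact: measurableT_comp.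
have bH : bmfun H by exact: bmfunB.
have HE (f : R -> R) : measurable_fun setT f -> (exists K, forall z, `|f z| <= K) ->
    ev (fun x => H x * f (zeta gamma tau t x)) = 0.
  move=> mf bf; apply: (@cond_exp_fun _ _ _ P _ _ (zeta gamma tau t) H f) => // B mB.
  have bB : bmfun (fun x => \1_B (zeta gamma tau t x) : R) by exact: bmfun_indic_comp.
  rewrite (@eq_ev _ _ _ P _ (fun x => g (zeta gamma tau u x) * \1_B (zeta gamma tau t x) -
    h (zeta gamma tau t x) * \1_B (zeta gamma tau t x))); last by move=> x; rewrite mulrBl.
  by rewrite evB ?hE ?subrr//; exact: bmfunM.
have snt n : t < t + n.+1%:R^-1 by rewrite ltrDl invr_gt0.
have sncvg : (fun n : nat => t + n.+1%:R^-1) @ \oo --> t.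
  rewrite -[X in _ --> X]addr0; apply: cvgD; first exact: cvg_cst.
  exact: cvg_harmonic.
have [p [mp p01 pF]] := germ_joint t0 snt sncvg tu tA.
have mA : measurable A := Fzc_measurable (tA _ (snt 0%N)).
have bA : bmfun (\1_A : T -> R) by exact: bmfun_indic.
have mD := live_measurable t0.
have bD : bmfun (\1_(live t) : T -> R) by exact: bmfun_indic.
pose X0 x := gamma t x / rest t x.
have mX0 : measurable_fun setT X0.
  by apply: measurable_fun_div; [exact: mg | exact: measurable_rest].
have bp n : bmfun (fun x => p n (X0 x)) by apply: bmfun01 => //; exact: measurableT_comp.
have onD : ev (fun x => \1_A x * \1_(live t) x * H x) = 0.
  pose F (z : R * R) := g ((z.1 + z.2) / (1 + z.1)) - h (z.1 / (1 + z.1)).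
  have mF : measurable_fun setT F.
    have m1 : measurable_fun setT (fun z : R * R => 1 + z.1).
      by apply: measurable_funD; [exact: measurable_cst | exact: measurable_fst].
    apply: measurable_funB.
      apply: (measurableT_comp mgg); apply: measurable_fun_div => //.
      by apply: measurable_funD; [exact: measurable_fst | exact: measurable_snd].
    by apply: (measurableT_comp mh); apply: measurable_fun_div => //; exact: measurable_fst.
  have FK : exists K, forall z, `|F z| <= K by exists 1 => z; exact: dist01.
  have := pF F mF FK.
  have -> : (fun n => ev (fun x => (p n (gamma t x / rest t x) - \1_A x) * \1_(live t) x *
       F (gamma t x / rest t x, stopinc t u x / rest t x))) =
     (fun n => - ev (fun x => \1_A x * \1_(live t) x * H x)).
    apply/funext => n.
    have FH x : \1_(live t) x * F (gamma t x / rest t x, stopinc t u x / rest t x) = \1_(live t) x * H x.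
      have [Dx|Dx] := pselect (live t x); last by rewrite indicE memNset// !mul0r.
      by rewrite /H (zeta_future t0 tu Dx) (proj1 (zeta_present t0 Dx)).
    rewrite (@eq_ev _ _ _ P _ (fun x => p n (X0 x) * \1_(live t) x * H x -
      \1_A x * \1_(live t) x * H x)); last first.
      by move=> x; rewrite -mulrA FH /X0; ring.
    have b1 : bmfun (fun x => p n (X0 x) * \1_(live t) x * H x).
      by apply: bmfunM => //; exact: bmfunM.
    rewrite evB//; last by apply: bmfunM => //; exact: bmfunM.
    suff -> : ev (fun x => p n (X0 x) * \1_(live t) x * H x) = 0 by rewrite sub0r.
    (* [p n] at the odds is a function of [zeta t], and [live t] is almost surely the event
       [zeta t < 1]; the term is thus [H] tested against a function of [zeta t]. *)
    pose phi z : R := p n (z / (1 - z)) * \1_[set z : R | z < 1] z.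
    have mlt : measurable [set z : R | z < 1].
      by rewrite (_ : [set z | z < 1] = `]-oo, 1[%classic)//.
    have mphi : measurable_fun setT phi.
      apply: measurable_funM; last exact: measurable_indic.
      apply: (measurableT_comp (mp n)); apply: measurable_fun_div => //.
      by apply: measurable_funB; [exact: measurable_cst | exact: measurable_id].
    have bphi : exists K, forall z, `|phi z| <= K.
      exists 1 => z; have /andP[a0 a1] : 0 <= phi z <= 1.
        by apply: mul01; [exact: p01 | exact: indic01].
      by rewrite ger0_norm.
    rewrite -(HE phi mphi bphi); apply: ae_eq_ev.
    - by case: b1.
    - by apply: measurable_funM; [case: bH | exact: measurableT_comp].
    apply: filterS (zeta_dead t0) => x dead.
    have [Dx|Dx] := pselect (live t x).
      have [_ lt1] := zeta_present t0 Dx; have [tx _] := Dx.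
      rewrite /phi zeta_odds ?t0 ?lexx// !indicE !mem_set//.
      by rewrite !mulr1 mulrC.
    rewrite /phi (dead Dx t (lexx t)) !indicE memNset// memNset ?mulr0 ?mul0r//=.
    by rewrite ltxx.
  move=> c0; apply/eqP; rewrite -oppr_eq0; apply/eqP.
  exact: (cvg_eq (cvg_cst _) c0 (fun=> erefl)).
have bDc : bmfun (fun x => 1 - \1_(live t) x : R) by apply: bmfunB => //; exact: bmfun_cst.
have offD : ev (fun x => \1_A x * (1 - \1_(live t) x) * H x) = 0.
  have Hdead (k : T -> R) : bmfun k -> ev (fun x => k x * (1 - \1_(live t) x) * H x) =
      ev (fun x => k x * (1 - \1_(live t) x)) * (g 1 - h 1).
    move=> bk; have bkD : bmfun (fun x => k x * (1 - \1_(live t) x)) by exact: bmfunM.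
    rewrite -evZr//; apply: ae_eq_ev.
    - by have [] := bmfunM bkD bH.
    - by have [] := bmfunM bkD (bmfun_cst (g 1 - h 1)).
    apply: filterS (zeta_dead t0) => x dead.
    have [Dx|Dx] := pselect (live t x); first by rewrite indicE mem_set// subrr mulr0 !mul0r.
    by rewrite /H (dead Dx t (lexx t)) (dead Dx u (ltW tu)).
  (* Obtained by testing [H] against the event [zeta t = 1], almost surely the complement of
     [live t]. *)
  have c0 : ev (fun x => 1 - \1_(live t) x) * (g 1 - h 1) = 0.
    have m1 : measurable_fun setT (\1_[set (1 : R)] : R -> R) by exact: measurable_indic.
    have b1 : exists K : R, forall z : R, `|\1_[set (1 : R)] z : R| <= K.
      by exists 1 => z; have /andP[a0 a1] := @indic01 R _ [set (1 : R)] z; rewrite ger0_norm.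
    have := Hdead (fun=> 1) (bmfun_cst 1).
    rewrite (@eq_ev _ _ _ P (fun x => 1 * (1 - \1_(live t) x)) (fun x => 1 - \1_(live t) x)); last first.
      by move=> x; rewrite mul1r.
    move=> <-; rewrite -(HE _ m1 b1); apply: ae_eq_ev.
    - by have [] := bmfunM (bmfunM (bmfun_cst 1) bDc) bH.
    - by apply: measurable_funM; [case: bH | exact: measurableT_comp].
    apply: filterS (zeta_dead t0) => x dead.
    have [Dx|Dx] := pselect (live t x).
      have [_ lt1] := zeta_present t0 Dx.
      rewrite !indicE mem_set// memNset ?subrr ?mulr0 ?mul0r//= => e1.
      by rewrite e1 ltxx in lt1.
    by rewrite (dead Dx t (lexx t)) !indicE memNset// mem_set// subr0 !mul1r mulr1.
  (* Either the complement of [live t] is null or [g 1 = h 1]; the integral over its part in [A]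
     vanishes in both cases. *)
  rewrite Hdead//; move/eqP: c0; rewrite mulf_eq0 => /orP[/eqP e0|/eqP ->]; last by rewrite mulr0.
  suff -> : ev (fun x => \1_A x * (1 - \1_(live t) x)) = 0 by rewrite mul0r.
  have D01 x : 0 <= 1 - \1_(live t) x :> R by have /andP[_] := @indic01 R _ (live t) x; rewrite subr_ge0.
  have A01 x := @indic01 R T A x.
  apply/eqP; rewrite eq_le; apply/andP; split.
    rewrite -e0; apply: le_ev => //; first exact: bmfunM.
    by move=> x; have /andP[a0 a1] := A01 x; rewrite ler_piMl.
  rewrite -(ev_cst P 0); apply: le_ev; [exact: bmfun_cst | exact: bmfunM |].
  by move=> x; have /andP[a0 a1] := A01 x; rewrite mulr_ge0.
have b3 : bmfun (fun x => \1_A x * \1_(live t) x * H x) by apply: bmfunM => //; exact: bmfunM.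
have b4 : bmfun (fun x => \1_A x * (1 - \1_(live t) x) * H x) by apply: bmfunM => //; exact: bmfunM.
apply/eqP; rewrite -subr_eq0 -evB; [|exact: bmfunM|exact: bmfunM].
apply/eqP; rewrite -[RHS]addr0 -{1}onD -offD -evD//.
by apply: eq_ev => x; rewrite /H; ring.
Qed.

(** An affine change brings [g] into [[0, 1]] and is undone on [h]; adding 1 to the bound makes the
    scale positive even when [g] vanishes. *)
Lemma markov_germ t u (g : R -> R) : 0 <= t -> t < u ->
  measurable_fun setT g -> (exists M, forall x, `|g x| <= M) ->
  exists h : R -> R, [/\ measurable_fun setT h, (exists M, forall x, `|h x| <= M) &
    forall A, Fzc_plus P gamma tau t A ->
      ev (fun x => g (zeta gamma tau u x) * \1_A x) = ev (fun x => h (zeta gamma tau t x) * \1_A x)].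
Proof.
move=> t0 tu mgg [M gM]; have u0 : 0 <= u by exact: le_trans (ltW tu).
pose K := M + 1.
have M0 : 0 <= M by exact: le_trans (gM 0).
have K0 : 0 < K by rewrite /K; lra.
pose g' x := (g x + K) / (2 * K).
have mg' : measurable_fun setT g'.
  apply: measurable_funM; last exact: measurable_cst.
  by apply: measurable_funD => //; exact: measurable_cst.
have g'01 x : 0 <= g' x <= 1.
  have := gM x; rewrite ler_norml => /andP[g1 g2]; apply/andP; split.
    by rewrite divr_ge0//; rewrite /K; lra.
  by rewrite ler_pdivrMr; rewrite /K; lra.
have [h [mh h01 hE]] := markov_germ01 t0 tu mg' g'01.
exists (fun x => 2 * K * h x - K); split.
- apply: measurable_funB; last exact: measurable_cst.
  by apply: measurable_funM => //; exact: measurable_cst.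
- exists K => x; have /andP[a0 a1] := h01 x.
  rewrite ler_norml; apply/andP; split; nra.
move=> A tA; have t1 : t < t + 1 by rewrite ltrDl.
have mA : measurable A := Fzc_measurable (tA _ t1).
have bA : bmfun (\1_A : T -> R) by exact: bmfun_indic.
have bg : bmfun (fun x => g' (zeta gamma tau u x)).
  by apply: bmfun01 => //; apply: measurableT_comp => //; exact: measurable_zeta.
have bh : bmfun (fun x => h (zeta gamma tau t x)).
  by apply: bmfun01 => //; apply: measurableT_comp => //; exact: measurable_zeta.
have E (f : T -> R) : bmfun f -> ev (fun x => (2 * K * f x - K) * \1_A x) =
    2 * K * ev (fun x => f x * \1_A x) - K * ev \1_A.
  move=> bf; have bfA : bmfun (fun x => f x * \1_A x) by exact: bmfunM.
  rewrite -evZ// -evZ// -evB.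
  - by apply: eq_ev => x; ring.
  - exact: (bmfunM (bmfun_cst _)).
  - exact: (bmfunM (bmfun_cst _)).
rewrite (E _ bh) -(hE A tA) -(E _ bg); apply: eq_ev => x; rewrite /g'.
by congr (_ * _); field; apply/lt0r_neq0.
Qed.

Lemma Fzc_plus_sigma t : sigma_algebra setT (Fzc_plus P gamma tau t).
Proof.
have sF s : sigma_algebra setT (Fzc P gamma tau s) by exact: smallest_sigma_algebra.
split.
- by move=> s _; have [] := sF s.
- by move=> A tA s ts; have [_ + _] := sF s; apply; exact: tA.
- by move=> A tA s ts; have [_ _] := sF s; apply => i; exact: tA.
Qed.

Lemma gen_zeta_Fzc_plus t : 0 <= t ->
  gen_sigma [set tt] (fun _ => zeta gamma tau t) `<=` Fzc_plus P gamma tau t.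
Proof.
move=> t0; apply: smallest_sub; first exact: Fzc_plus_sigma.
move=> _ [_ [_ [B [mB ->]]]] s ts; apply: sub_sigma_algebra; left.
apply: sub_sigma_algebra; exists t; split; first by rewrite /= t0 ltW.
by exists B.
Qed.

End gamma_process.

(** The set where one version lies below the other belongs to [G], and their difference has integral
    0 over it, so [pos_null] makes it null; the same holds with the versions exchanged. *)
Lemma cond_exp_unique {d : measure_display} {T : measurableType d} {R : realType}
    (P : probability T R) (G : set (set T)) (X Y Z : T -> R) :
  sigma_algebra setT G -> G `<=` measurable ->
  is_cond_exp P G X Y -> is_cond_exp P G X Z -> {ae P, forall x, Y x = Z x}.
Proof.
move=> sG mG.
have lt_null (Y1 Y2 : T -> R) : is_cond_exp P G X Y1 -> is_cond_exp P G X Y2 ->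
    measurable [set x | Y1 x < Y2 x] /\ P [set x | Y1 x < Y2 x] = 0%E.
  move=> [mY1 [i1 e1]] [mY2 [i2 e2]].
  have gY (W : T -> R) : (forall B, measurable B -> G (W @^-1` B)) -> gmeas G W.
    by move=> mW _ B mB; rewrite setTI; apply: sub_sigma_algebra; exact: mW.
  have GS : G [set x | Y1 x < Y2 x].
    rewrite -(sigma_algebra_id sG).
    have gB : gmeas G (fun x => Y2 x - Y1 x) by apply: measurable_funB; exact: gY.
    have := gmeas_preimage gB (measurable_itv `]0, +oo[).
    suff -> : (fun x => Y2 x - Y1 x) @^-1` `]0, +oo[ = [set x | Y1 x < Y2 x] by [].
    by apply/seteqP; split => x /=; rewrite in_itv /= andbT subr_gt0.
  have mS := mG _ GS; split => //.
  have i1S := integrableS measurableT mS (@subsetT _ _) i1.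
  have i2S := integrableS measurableT mS (@subsetT _ _) i2.
  apply: (@pos_null _ _ _ P (fun x => Y2 x - Y1 x)) => //.
  - by have := integrableB measurableT i2 i1.
  - by move=> x /=; rewrite subr_gt0.
  have -> : (\int[P]_(x in [set x | (Y1 x < Y2 x)%R]) (Y2 x - Y1 x)%R%:E =
     \int[P]_(x in [set x | (Y1 x < Y2 x)%R]) ((EFin \o Y2) x - (EFin \o Y1) x))%E.
    by apply: eq_integral => x _; rewrite /= EFinB.
  rewrite (integralB mS i2S i1S) /= (e1 _ GS) (e2 _ GS) subee//.
  by rewrite -(e1 _ GS); exact: integrable_fin_num.
move=> cY cZ; have [m1 n1] := lt_null _ _ cY cZ; have [m2 n2] := lt_null _ _ cZ cY.
apply: (@negligibleS _ _ _ P ([set x | Y x < Z x] `|` [set x | Z x < Y x])).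
  move=> x /= /eqP; rewrite neq_lt => /orP[]; by [left | right].
by apply: negligibleU; [exists [set x | Y x < Z x] | exists [set x | Z x < Y x]]; split.
Qed.

Theorem mainTheorem10 (d : measure_display) (T : measurableType d) (R : realType)
  (P : probability T R) (gamma : R -> T -> R) (tau : T -> R) :
  measure_is_complete P ->
  standard_gamma_process P gamma ->
  measurable_fun setT tau ->
  (forall w, 0 < tau w) ->
  indep_sigma P (gen_sigma [set tt] (fun _ => tau))
                (gen_sigma [set r | 0 <= r] gamma) ->
  (exists alpha : R, 0 < alpha /\
     (\int[P]_x ((tau x) `^ alpha)%:E < +oo)%E) ->
  forall (t u : R), 0 <= t -> t < u ->
  forall g : R -> R, measurable_fun setT g -> (exists M : R, forall x, `|g x| <= M) ->
  forall Y1 Y2 : T -> R,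
    is_cond_exp P (Fzc_plus P gamma tau t) (g \o zeta gamma tau u) Y1 ->
    is_cond_exp P (gen_sigma [set tt] (fun _ => zeta gamma tau t)) (g \o zeta gamma tau u) Y2 ->
    {ae P, forall x, Y1 x = Y2 x}.
Proof.
move=> cP [mg [g0 [gmono [grc [_ [gind glap]]]]]] mtau tau_gt0 tind _ t u t0 tu g mgg bg Y1 Y2 c1 c2.
have u0 : 0 <= u by exact: le_trans (ltW tu).
have [h [mh bh hE]] := markov_germ mg g0 gmono gind glap mtau tind grc tau_gt0 cP t0 tu mgg bg.
have mz r : 0 <= r -> measurable_fun setT (zeta gamma tau r).
  by move=> r0; apply: measurable_zeta.
have bgz : bmfun (fun x => g (zeta gamma tau u x)) by apply: bmfun_comp => //; exact: mz.
have bhz : bmfun (fun x => h (zeta gamma tau t x)) by apply: bmfun_comp => //; exact: mz.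
have mF : Fzc_plus P gamma tau t `<=` measurable.
  move=> A tA; have t1 : t < t + 1 by rewrite ltrDl.
  by apply: Fzc_measurable (tA _ t1).
(* [h (zeta t)] is a version for any [G] between the sigma-algebra of [zeta t] and [Fzc_plus]: it is
   measurable for the smaller and has the right integrals on the larger. Both given versions are
   then compared with it. *)
have ce (G : set (set T)) : G `<=` Fzc_plus P gamma tau t ->
    gen_sigma [set tt] (fun _ => zeta gamma tau t) `<=` G ->
    is_cond_exp P G (g \o zeta gamma tau u) (fun x => h (zeta gamma tau t x)).
  move=> GF zG; split; [|split].
  - move=> B mB; apply: zG; apply: sub_sigma_algebra; exists tt; split => //.
    exists (h @^-1` B); split => //.
    by rewrite -[X in measurable X]setTI; exact: mh.
  - exact: bmfun_integrable.
  - move=> A GA; have mA := mF _ (GF _ GA).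
    by rewrite !integral_indicM// (hE _ (GF _ GA)).
have zF : gen_sigma [set tt] (fun _ => zeta gamma tau t) `<=` Fzc_plus P gamma tau t.
  exact: gen_zeta_Fzc_plus.
have e1 := cond_exp_unique (Fzc_plus_sigma P gamma tau t) mF c1 (ce _ (@subset_refl _ _) zF).
have e2 := cond_exp_unique (smallest_sigma_algebra _ _) (subset_trans zF mF) c2
  (ce _ zF (@subset_refl _ _)).
by apply: filterS2 e1 e2 => x -> ->.
Qed.
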